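(* Let $d\ge3$ and $n\ge2$. Then the set \[ \{ f\in\mathrm{End}_d^n : f \text{ is post-critically periodic}\} \] is contained in a proper Zariski closed subset of $\mathrm{End}_d^n$.
   Context: Work over an algebraically closed field $\mathbb{F}$ of characteristic $0$. $\mathrm{End}_d^n$ is the set of morphisms $f:\mathbb{P}^n\to\mathbb{P}^n$ of algebraic degree $d$ (i.e. $f=[f_0:\dots:f_n]$, $f_i$ homogeneous of degree $d$ with no common zero), viewed as a Zariski open subset of $\mathbb{P}^N$, $N=(n+1)\binom{d+n}{n}-1$. The critical locus is $\mathcal{C}_f=\{\det(\partial f_i/\partial x_j)=0\}$. A map $f$ is post-critically periodic if $f^k(\mathcal{C}_f)\subseteq\mathcal{C}_f$ for some $k\ge1$. *)

(* Defs.v *)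
From HB Require Import structures.
From mathcomp Require Import all_boot all_order all_algebra.
From mathcomp Require Import mpoly.
Set Implicit Arguments. Unset Strict Implicit. Unset Printing Implicit Defensive.
Import Order.TTheory GRing.Theory.
Local Open Scope ring_scope.

(* Projective space P^n has homogeneous coordinates indexed by 'I_n.+1.
   A degree-d map is given by its coefficient vector: one coefficient for each
   pair (i, m) with i : 'I_n.+1 a component and m a monomial of degree d in
   n+1 variables.  The coefficient vectors form the affine cone over P^N,
   N + 1 = #|coeff_index n d| = (n+1) * binom(d+n, n). *)

Definition deg_monom (n d : nat) : finType :=
  {m : 'X_{1..n.+1 < d.+1} | mdeg m == d}.

Definition coeff_index (n d : nat) : finType :=
  ('I_n.+1 * deg_monom n d)%type.

Definition param_dim (n d : nat) : nat := #|coeff_index n d|.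

Section Maps.
Variables (F : fieldType) (n d : nat).

Definition poly_map (c : 'I_(param_dim n d) -> F) (i : 'I_n.+1)
  : {mpoly F[n.+1]} :=
  \sum_(m : deg_monom n d)
     c (enum_rank ((i, m) : coeff_index n d)) *: 'X_[bmnm (val m)].

Definition eval_map (c : 'I_(param_dim n d) -> F) (x : 'I_n.+1 -> F)
  : 'I_n.+1 -> F := fun i => (poly_map c i).@[x].

Definition nonzero_pt (x : 'I_n.+1 -> F) : Prop := exists i, x i != 0.

(* c is (a representative of) a point of End_d^n: the f_i have no common
   zero in P^n *)
Definition is_morphism (c : 'I_(param_dim n d) -> F) : Prop :=
  forall x, nonzero_pt x -> exists i, eval_map c x i != 0.

Definition jac_det (c : 'I_(param_dim n d) -> F) : {mpoly F[n.+1]} :=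
  \det (\matrix_(i < n.+1, j < n.+1) (poly_map c i)^`M(j)).

Definition in_crit (c : 'I_(param_dim n d) -> F) (x : 'I_n.+1 -> F) : Prop :=
  nonzero_pt x /\ (jac_det c).@[x] = 0.

Definition post_crit_periodic (c : 'I_(param_dim n d) -> F) : Prop :=
  exists k : nat, (0 < k)%N /\
    forall x, in_crit c x -> in_crit c (iter k (eval_map c) x).

End Maps.

(* Main.v *)
Require Import Defs.
From HB Require Import structures.
From Stdlib Require Import Classical.
From mathcomp Require Import all_boot all_order all_algebra.
From mathcomp Require Import mpoly.
From mathcomp Require Import fraction ring zify.
Set Implicit Arguments. Unset Strict Implicit. Unset Printing Implicit Defensive.
Import Order.TTheory GRing.Theory.
Local Open Scope ring_scope.

(** Let [J] be the Jacobian determinant of [f].  A dimension count over the second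
    order jets of [f] shows that for a generic [f] the critical locus [J = 0] is
    irreducible, has no singular point on the plane spanned by the first three
    coordinates, and contains a fold point, where the kernel of [Df] is
    transverse to it.  Assume that [f^k] maps such a critical locus into itself,
    with [k] minimal, and put [g = f^k].  Then [J o g = H * J], and [Dg = N * Df]
    with [det N] not divisible by [J].  At a fold point this forces [J] to divide
    [H], so along [J = 0] the vector [B = (grad J) o g] is in the left kernel of
    [Dg] and hence proportional to the rows of [adj Dg].  The entries of [B] have
    larger degree than those of [adj Dg].  Modulo [J], proportionality gives both
    families the same relations, so the Hilbert function of the quotient by
    [(J, B)] grows too fast for an ideal of height three, whereas smoothness of
    [J = 0] on the plane gives [(J, B)] height at least three. *)

(** * Nullstellensatz *)

(** Smallness of a set of maps is expressed by a polynomial relation among more polynomials than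
    variables, and height by a count of monomials. Smoothness is asked only on a plane because it
    cannot be asked everywhere: points of corank two form a locus of codimension four, which is
    nonempty for large n and along which J is singular. On the plane, a point x with left and right
    kernel vectors w and v has 2 + n + n parameters, while a singular point satisfies 3(n + 1) - 2
    independent conditions, the 2 counting w(Df v) = (w Df)v and Euler's relation; 2n + 2 < 3n + 1
    needs n > 1. A fold point is found on a line, where 1 + 2n < 2n + 2 leaves no room for tangency.
    The plane suffices for the rest: two factors of J would meet on it in a singular point, and a
    common nonzero root of J, B and the components of g after the third would be sent by g to a
    singular point of J on it. Those n - 2 components, together with (J, B), thus vanish
    simultaneously only at the origin, which is the form in which height three is used. *)

Section SplitLastVariable.
Variables (F : fieldType) (n : nat).
Implicit Types (p : {mpoly F[n.+1]}) (l : 'I_n -> F).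

Lemma mpoly_rmorph_ext (m : nat) (R : comNzRingType)
    (f1 f2 : {rmorphism {mpoly F[m]} -> R}) :
    (forall c, f1 c%:MP = f2 c%:MP) -> (forall i, f1 'X_i = f2 'X_i) ->
  f1 =1 f2.
Proof.
move=> eqC eqX q; rewrite [q]mpolyE !rmorph_sum; apply: eq_bigr => k _ /=.
rewrite -mul_mpolyC !rmorphM eqC mpolyXE_id !rmorph_prod; congr (_ * _).
by apply: eq_bigr => i _; rewrite !rmorphXn eqX.
Qed.

(** The shear along the direction (l, 1) of Noether normalization: for suitable [l] a given
    polynomial becomes monic in the last variable, up to a scalar. *)
Definition split_var l (i : 'I_n.+1) : {poly {mpoly F[n]}} :=
  if unlift ord_max i is Some j then ('X_j)%:P + ((l j)%:MP)%:P * 'X else 'X.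

Definition msplit l : {mpoly F[n.+1]} -> {poly {mpoly F[n]}} :=
  mmap (polyC \o @mpolyC _ _) (split_var l).

HB.instance Definition _ l := GRing.RMorphism.copy (msplit l) (msplit l).

Definition mjoin l : {poly {mpoly F[n]}} -> {mpoly F[n.+1]} :=
  horner_eval 'X_ord_max \o
  map_poly (comp_mpoly [tuple 'X_(lift ord_max i) - l i *: 'X_ord_max | i < n]).

HB.instance Definition _ l := GRing.RMorphism.copy (mjoin l) (mjoin l).

Lemma msplitK l : cancel (msplit l) (mjoin l).
Proof.
move=> p; rewrite -[mjoin l _]/((mjoin l \o msplit l) p) -[RHS]/(idfun p).
apply: mpoly_rmorph_ext => [c|i] /=; rewrite /msplit.
  by rewrite mmapC /= /mjoin /= map_polyC /= comp_mpolyC /horner_eval hornerC.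
rewrite mmapX mmap1U /split_var; case: unliftP => [j|] -> /=.
  rewrite rmorphD rmorphM /= /mjoin /= !map_polyC /= map_polyX /horner_eval.
  rewrite !hornerC hornerX comp_mpolyC comp_mpolyXU -tnth_nth tnth_mktuple.
  by rewrite mul_mpolyC subrK.
by rewrite /mjoin /= map_polyX /horner_eval hornerX.
Qed.

Definition join_pt l (a : 'I_n -> F) (x : F) (i : 'I_n.+1) : F :=
  if unlift ord_max i is Some j then a j + l j * x else x.

Lemma msplit_eval l a x p :
  (map_poly (meval a) (msplit l p)).[x] = p.@[join_pt l a x].
Proof.
rewrite -[LHS]/((horner_eval x \o map_poly (meval a) \o msplit l) p).
apply: mpoly_rmorph_ext => [c|i] /=; rewrite /msplit.
  by rewrite mmapC /= map_polyC /= /horner_eval hornerC !mevalC.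
rewrite mmapX mmap1U /split_var mevalXU /join_pt.
case: unliftP => [j|] _ /=.
  rewrite rmorphD rmorphM /= !map_polyC /= map_polyX /horner_eval.
  by rewrite !hornerE mevalXU mevalC.
by rewrite map_polyX /horner_eval hornerX.
Qed.

End SplitLastVariable.

Lemma mpoly_nonroot (F : closedFieldType) n (p : {mpoly F[n]}) :
  p != 0 -> exists a, p.@[a] != 0.
Proof.
elim: n p => [|n IHn] p nz_p.
  exists (fun=> 0); move: nz_p.
  by rewrite (nvar0_mpolyC p) mevalC mpolyC_eq0.
pose l (i : 'I_n) : F := 0.
have nz_q : msplit l p != 0.
  by apply: contraNneq nz_p => q0; rewrite -[p](msplitK l) q0 rmorph0.
have [a nz_a] : exists a, (lead_coef (msplit l p)).@[a] != 0.
  by apply: IHn; rewrite lead_coef_eq0.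
have /closed_nonrootP [x nx] : map_poly (meval a) (msplit l p) != 0.
  apply: contraNneq nz_a => q0; rewrite lead_coefE.
  by have := coef_map (meval a) (msplit l p) (size (msplit l p)).-1; rewrite q0 coef0 => <-.
by exists (join_pt l a x); rewrite -msplit_eval.
Qed.

Section TopCoefficient.
Variable R : comNzRingType.
Implicit Types p q : {poly R}.

(** A formal leading coefficient in which [c] may be zero, so that it is multiplicative without any
    condition of nonvanishing. *)
Definition top_coef (k : nat) (c : R) p := (size p <= k.+1)%N /\ p`_k = c.

Lemma top_coefM k j c e p q :
  top_coef k c p -> top_coef j e q -> top_coef (k + j) (c * e) (p * q).
Proof.
move=> [sp cp] [sq cq]; split.
  apply: leq_trans (size_polyMleq _ _) _.
  by rewrite -subn1 leq_subLR (leq_trans (leq_add sp sq)) // addSn addnS add1n.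
rewrite coefM.
rewrite (bigD1 (inord k)) //= inordK ?ltnS ?leq_addr // addKn cp cq.
rewrite big1 ?addr0 // => i; rewrite -val_eqE /= inordK ?ltnS ?leq_addr //.
rewrite neq_ltn => /orP[lt_ik|lt_ki]; last first.
  by rewrite nth_default ?mul0r // (leq_trans sp).
by rewrite [q`__]nth_default ?mulr0 // (leq_trans sq) // ltn_subRL ltn_add2r.
Qed.

Lemma top_coef_exp k c p m : top_coef k c p -> top_coef (k * m) (c ^+ m) (p ^+ m).
Proof.
move=> tp; elim: m => [|m IHm]; last by rewrite exprS mulnS exprS; exact: top_coefM.
by rewrite muln0 !expr0; split; rewrite ?coef1 // size_polyC; case: eqP.
Qed.

Lemma top_coef_prod (I : Type) (r : seq I) (k : I -> nat) (c : I -> R) (p : I -> {poly R}) :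
  (forall i, top_coef (k i) (c i) (p i)) ->
  top_coef (\sum_(i <- r) k i) (\prod_(i <- r) c i) (\prod_(i <- r) p i).
Proof.
move=> tp; elim: r => [|i r IHr]; last by rewrite !big_cons; exact: top_coefM.
by rewrite !big_nil; split; rewrite ?coef1 // size_polyC; case: eqP.
Qed.

End TopCoefficient.

(** Under the shear each variable is linear in X, with the corresponding coordinate of (l, 1) as
    coefficient; hence X^d collects the value at (l, 1) of the part of degree d. *)
Lemma msplit_top (F : fieldType) n (l : 'I_n -> F) (p : {mpoly F[n.+1]}) d :
  (msize p <= d.+1)%N ->
  top_coef d ((pihomog mdeg d p).@[join_pt l (fun=> 0) 1])%:MP (msplit l p).
Proof.
move=> sp; set b := join_pt _ _ _.
have topX (m : 'X_{1..n.+1}) :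
    top_coef (mdeg m) (('X_[m]).@[b])%:MP (msplit l 'X_[m]).
  rewrite /msplit mmapX mdegE mevalX rmorph_prod.
  apply: top_coef_prod => i; rewrite -{1}[m i]mul1n rmorphXn; apply: top_coef_exp.
  rewrite /split_var /b /join_pt; case: unliftP => [j|] _.
    rewrite add0r mulr1; split; last by rewrite coefD coefC coefCM coefX mulr1 add0r.
    rewrite (leq_trans (size_polyD _ _)) // geq_max.
    rewrite (leq_trans (size_polyC_leq1 _)) //=.
    by rewrite mul_polyC (leq_trans (size_scale_leq _ _)) ?size_polyX.
  by split; rewrite ?size_polyX // coefX.
pose low (m : 'X_{1..n.+1}) : {mpoly F[n.+1]} := if mdeg m == d then p@_m *: 'X_[m] else 0.
have top_sum (r : seq 'X_{1..n.+1}) : all (fun m => mdeg m <= d)%N r ->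
    top_coef d ((\sum_(m <- r) low m).@[b])%:MP
      (msplit l (\sum_(m <- r) p@_m *: 'X_[m])); last first.
  rewrite pihomogE big_mkcond [in msplit _ _](mpolyE p); apply: top_sum.
  by apply/allP => m /msize_mdeg_lt lt; rewrite -ltnS (leq_trans lt).
elim: r => [|m r IHr] /=.
  by rewrite !big_nil meval0 mpolyC0 rmorph0; split; rewrite ?size_poly0 ?coef0.
case/andP=> le_md /IHr [sr cr]; rewrite !big_cons mevalD mpolyCD rmorphD /=.
have [sm cm] := topX m.
have -> : msplit l (p@_m *: 'X_[m]) = (p@_m)%:MP *: msplit l 'X_[m].
  by rewrite -mul_mpolyC rmorphM /= {1}/msplit mmapC /= mul_polyC.
split.
  rewrite (leq_trans (size_polyD _ _)) // geq_max sr andbT.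
  by apply: leq_trans (size_scale_leq _ _) _; apply: leq_trans sm _.
rewrite coefD cr coefZ; congr (_ + _).
rewrite /low; case: eqP => [<-|ne]; first by rewrite cm mevalZ mpolyCM.
rewrite meval0 nth_default ?mulr0 ?mpolyC0 // (leq_trans sm) //.
by rewrite ltn_neqAle le_md andbT; apply/eqP.
Qed.

Section Ideals.
Variable R : comNzRingType.

Definition is_ideal (I : R -> Prop) :=
  (forall x y, I x -> I y -> I (x + y)) /\ (forall a x, I x -> I (a * x)).

Lemma ideal_sum (I : R -> Prop) (T : Type) (r : seq T) (P : pred T) (f : T -> R) :
  is_ideal I -> I 0 -> (forall i, P i -> I (f i)) -> I (\sum_(i <- r | P i) f i).
Proof. by move=> [ID _] I0 If; elim/big_rec: _ => // i x /If Ii Ix; exact: ID. Qed.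

Definition ideal_gen (T : finType) (f : T -> R) (x : R) :=
  exists a : T -> R, x = \sum_i a i * f i.

Lemma ideal_gen_ideal (T : finType) (f : T -> R) : is_ideal (ideal_gen f).
Proof.
split=> [x y [a ->] [b ->]|c x [a ->]].
  exists (fun i => a i + b i); rewrite -big_split /=.
  by apply: eq_bigr => i _; rewrite mulrDl.
by exists (fun i => c * a i); rewrite mulr_sumr; apply: eq_bigr => i _; rewrite mulrA.
Qed.

Lemma ideal_gen_mem (T : finType) (f : T -> R) i : ideal_gen f (f i).
Proof.
exists (fun j => (j == i)%:R); rewrite (bigD1 i) //= eqxx mul1r big1 ?addr0 //.
by move=> j /negbTE->; rewrite mul0r.
Qed.

End Ideals.

(* Arrondo's argument.  If [h] lies in the ideal and specialises to [1], then
   modulo the monic element every [X ^ i] equals a combination of the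
   [X ^ j] whose coefficients vanish at [a]; Cramer's rule then produces an
   element of the elimination ideal with value [1] at [a]. *)
Lemma specialized_ideal_proper (F : fieldType) (A : comNzRingType) (e : {rmorphism A -> F})
    (I : {poly A} -> Prop) (g : {poly A}) :
    is_ideal I -> g \is monic -> I g ->
    (forall a, I a%:P -> e a = 0) ->
  forall h, I h -> map_poly e h <> 1.
Proof.
move=> II mon_g Ig I0 h Ih eh1; have [ID IM] := II.
pose D := (size g).-1.
have size_g : size g = D.+1 by rewrite /D prednK // lt0n size_poly_eq0 monic_neq0.
pose r (i : nat) := Pdiv.Ring.rmodp ('X^i * (1 - h)) g.
have size_r i : (size (r i) <= D)%N.
  by rewrite -ltnS -size_g Pdiv.Ring.ltn_rmodpN0 // monic_neq0.
(* Since [h] specialises to 1, the specialised remainder is a multiple of the specialised [g], which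
   is monic of larger degree. *)
have er i : map_poly e (r i) = 0.
  have /(congr1 (map_poly e)) := Pdiv.RingMonic.rdivp_eq mon_g ('X^i * (1 - h)).
  rewrite rmorphM rmorphB rmorph1 /= eh1 subrr mulr0 rmorphD rmorphM /= -/(r i).
  set q := map_poly e (Pdiv.Ring.rdivp _ _) => eq0.
  have mon_eg : map_poly e g \is monic by exact: monic_map.
  have sz_eg : size (map_poly e g) = D.+1 by rewrite size_map_poly_id0 // (monicP mon_g) rmorph1 oner_neq0.
  have : (size (map_poly e (r i)) < size (map_poly e g))%N.
    by rewrite sz_eg ltnS (leq_trans (size_poly _ _)).
  have -> : map_poly e (r i) = (- q) * map_poly e g.
    by apply/eqP; rewrite mulNr -addr_eq0 addrC -eq0.
  have [->|nz_q] := eqVneq q 0; first by rewrite oppr0 mul0r.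
  rewrite size_mul ?oppr_eq0 ?(monic_neq0 mon_eg) //. rewrite sz_eg addnS /= ltnS.
  by rewrite -[X in (_ <= X)%N]add0n leq_add2r leqn0 size_poly_eq0 oppr_eq0 (negbTE nz_q).
pose T : 'M[A]_D.+1 := \matrix_(i, j) (r i)`_j.
have eT : map_mx e T = 0.
  apply/matrixP => i j; rewrite !mxE.
  by have := coef_map e (r i) j; rewrite er coef0 => <-.
have Ir (i : 'I_D.+1) : I ('X^i - \sum_(j < D.+1) (T i j)%:P * 'X^j).
  have -> : \sum_(j < D.+1) (T i j)%:P * 'X^j = r i.
    rewrite -[RHS]coefK; apply/polyP => k; rewrite coef_sum coef_poly.
    have [lt_kD|le_Dk] := ltnP k D.+1; last first.
      rewrite ifN; last by rewrite -leqNgt (leq_trans (size_r i)) // (leq_trans _ le_Dk).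
      rewrite big1 // => j _; rewrite coefCM coefXn gtn_eqF ?mulr0 //.
      by rewrite (leq_trans (ltn_ord j)).
    rewrite (bigD1 (Ordinal lt_kD)) //= coefCM coefXn eqxx mulr1 mxE big1 ?addr0.
      by case: ltnP => // /(nth_default 0) ->.
    move=> j ne; rewrite coefCM coefXn.
    by rewrite -[k == j]/(val (Ordinal lt_kD) == val j) val_eqE eq_sym (negbTE ne) mulr0.
  rewrite /r; set u := _ * (1 - h).
  have -> : 'X^i - Pdiv.Ring.rmodp u g = 'X^i * h + Pdiv.Ring.rdivp u g * g.
    have eu := Pdiv.RingMonic.rdivp_eq mon_g u.
    have -> : Pdiv.Ring.rdivp u g * g = u - Pdiv.Ring.rmodp u g.
      by rewrite {2}eu addrK.
    by rewrite /u mulrBr mulr1 addrA [_ + ('X^i - _)]addrC subrK.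
  by apply: ID; apply: IM.
have Iz : I 0 by rewrite -(mul0r g); apply: IM.
pose V : 'cV[{poly A}]_D.+1 := \col_j 'X^j.
pose M : 'M[{poly A}]_D.+1 := 1%:M - map_mx polyC T.
have IMV i : I ((M *m V) i 0).
  have -> : (M *m V) i 0 = 'X^i - \sum_(j < D.+1) (T i j)%:P * 'X^j; last exact: Ir.
  rewrite mulmxBl mul1mx !mxE; congr (_ - _).
  by apply: eq_bigr => j _; rewrite !mxE.
have : I ((\adj M *m (M *m V)) 0 0).
  by rewrite mxE; apply: ideal_sum => // j _; apply: IM.
rewrite mulmxA mul_adj_mx mul_scalar_mx !mxE expr0 mulr1.
have -> : \det M = (\det (1%:M - T))%:P.
  by rewrite -det_map_mx map_mxB map_mx1.
move=> /I0; rewrite -det_map_mx map_mxB map_mx1 eT subr0 det1.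
by move/eqP; rewrite oner_eq0.
Qed.

Lemma meval_homog_scale (R : comNzRingType) n d (p : {mpoly R[n]}) (c : R) x :
  p \is d.-homog -> p.@[fun i => c * x i] = c ^+ d * p.@[x].
Proof.
move=> /dhomogP hp; rewrite !mevalE mulr_sumr; apply: eq_big_seq => m /hp <-.
under eq_bigr do rewrite exprMn; rewrite big_split /= prodrXr -mdegE.
by rewrite mulrCA.
Qed.

Lemma mcoeff_pihomog (R : nzRingType) n d (p : {mpoly R[n]}) m :
  (pihomog mdeg d p)@_m = if mdeg m == d then p@_m else 0.
Proof.
rewrite pihomogE big_mkcond raddf_sum /=; have [mp|mp] := boolP (m \in msupp p).
  rewrite (bigD1_seq m) ?msupp_uniq //= big1 ?addr0 => [|m' /negbTE ne].
    by case: eqP; rewrite ?mcoeff0 // mcoeffZ mcoeffX eqxx mulr1.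
  by case: eqP; rewrite ?mcoeff0 // mcoeffZ mcoeffX ne mulr0.
rewrite (memN_msupp_eq0 mp) if_same big_seq big1 // => m' m'p.
case: eqP; rewrite ?mcoeff0 // mcoeffZ mcoeffX; case: eqP => [mm'|_ _]; last by rewrite mulr0.
by rewrite mm' in m'p; rewrite m'p in mp.
Qed.

Lemma pihomog_top_neq0 (R : nzRingType) n (p : {mpoly R[n]}) :
  p != 0 -> pihomog mdeg (msize p).-1 p != 0.
Proof.
move=> nz_p; apply: contraNneq (nz_p) => top0.
have := congr1 (mcoeff (mlead p)) top0; rewrite mcoeff_pihomog mcoeff0.
by rewrite -mlead_deg //= eqxx => /eqP; rewrite mleadc_eq0.
Qed.

(** Induction on the number of variables: a shear puts into the ideal an element monic in the last
    variable, the elimination ideal has a zero [a], and the ideal specialised at [a] is still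
    proper, so its elements share a root. *)
Lemma weak_nullstellensatz (F : closedFieldType) n (I : {mpoly F[n]} -> Prop) :
  is_ideal I -> ~ I 1 -> exists a, forall p, I p -> p.@[a] = 0.
Proof.
elim: n I => [|n IHn] I II nI1; have [ID IM] := II.
  exists (fun=> 0) => p Ip; rewrite (nvar0_mpolyC p) mevalC.
  apply/eqP/negPn/negP => nz; apply: nI1.
  have -> : 1 = ((p@_0)^-1)%:MP * p by rewrite {2}(nvar0_mpolyC p) -mpolyCM mulVf.
  exact: IM.
have [[g [Ig nz_g]]|noG] := classic (exists g, I g /\ g != 0); last first.
  exists (fun=> 0) => p Ip; have [->|nz] := eqVneq p 0; first by rewrite meval0.
  by case: noG; exists p.
pose D := (msize g).-1; pose gD := pihomog mdeg D g.
(* The factor ['X_ord_max] makes the last coordinate of [b] invertible, so that [b] can be rescaled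
   to the form (l, 1). *)
have [b] : exists b, (gD * 'X_ord_max).@[b] != 0.
  apply: mpoly_nonroot; rewrite mulf_neq0 ?pihomog_top_neq0 //.
  by rewrite -msize_poly_eq0 msizeX.
rewrite mevalM mevalXU mulf_eq0 negb_or => /andP[gDb nz_b].
pose l j := b (lift ord_max j) / b ord_max.
pose c := gD.@[join_pt l (fun=> 0) 1].
have nz_c : c != 0.
  apply: contraNneq gDb => c0; rewrite (meval_eq (v2 := fun i => b ord_max * join_pt l (fun=> 0) 1 i)).
    by rewrite (meval_homog_scale _ _ (pihomogP _ _ _)) -/c c0 mulr0.
  move=> i; rewrite /join_pt; case: unliftP => [j|] ->; last by rewrite mulr1.
  by rewrite add0r mulr1 /l mulrC divfK.
have [sz_g cf_g] : top_coef D c%:MP (msplit l g).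
  by apply: msplit_top; rewrite /D; case: (msize g).
pose I1 q := I (mjoin l q).
have II1 : is_ideal I1.
  by split=> [x y|a x]; rewrite /I1 (rmorphD, rmorphM) /=; [apply: ID | apply: IM].
have [_ IM1] := II1.
pose G := (c^-1)%:MP%:P * msplit l g.
have IG : I1 G by apply: IM1; rewrite /I1 msplitK.
have cfG : G`_D = 1 by rewrite coefCM cf_g -mpolyCM mulVf.
have szG : size G = D.+1.
  apply/eqP; rewrite eqn_leq; apply/andP; split.
    by rewrite /G mul_polyC; apply: leq_trans (size_scale_leq _ _) _.
  by rewrite ltnNge; apply/negP => /(nth_default 0); rewrite cfG; apply/eqP/oner_neq0.
have monG : G \is monic by rewrite monicE lead_coefE szG cfG.
have [a aP] : exists a, forall p, I1 p%:P -> p.@[a] = 0.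
  apply: IHn; last by rewrite /I1 rmorph1.
  split=> [x y|u x]; rewrite (polyCD, polyCM); first by apply II1.
  exact: IM1.
have notone := specialized_ideal_proper II1 monG IG aP.
suff [x xP] : exists x, forall q, I1 q -> root (map_poly (meval a) q) x.
  exists (join_pt l a x) => p Ip; rewrite -msplit_eval; apply/rootP/xP.
  by rewrite /I1 msplitK.
have : map_poly (meval a) G != 0 by rewrite monic_neq0 ?monic_map.
(* Euclidean descent: while the specialisation of [G] fails to divide that of some [q], a remainder
   of smaller size takes its place. The final one divides all specialisations and is not constant by
   [notone]. *)
move: IG; have [k] := ubnP (size (map_poly (meval a) G)).
move: G {cfG szG monG}; elim: k => // k IHk G lek IG nzG.
set h := map_poly _ G in nzG lek.
have [[q [Iq ndv]]|dv] := classic (exists q, I1 q /\ ~~ (h %| map_poly (meval a) q)).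
  pose Q := map_poly (@mpolyC n F) (map_poly (meval a) q %/ h).
  have eQ : map_poly (meval a) Q = map_poly (meval a) q %/ h.
    by rewrite -map_poly_comp map_poly_id // => u _ /=; rewrite mevalC.
  have er : map_poly (meval a) (q + (- Q) * G) = map_poly (meval a) q %% h.
    rewrite rmorphD rmorphM rmorphN /= eQ -/h {1}(divp_eq (map_poly (meval a) q) h).
    by rewrite mulNr addrAC subrr add0r.
  apply: (IHk (q + (- Q) * G)); rewrite ?er //.
    by rewrite -ltnS (leq_trans _ lek) // ltnS ltn_modp.
  by apply II1 => //; apply: IM1.
have /closed_rootP [x rx] : size h != 1%N.
  apply/negP => /size_poly1P [u nz_u hu].
  apply: (notone ((u^-1)%:MP%:P * G)); first exact: IM1.
  by rewrite rmorphM /= map_polyC /= mevalC -/h hu -polyCM mulVf.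
exists x => q Iq; have : h %| map_poly (meval a) q.
  by apply/negPn/negP => nd; apply: dv; exists q.
by move/dvdpP => [u ->]; rewrite rootM rx orbT.
Qed.

(* Rabinowitsch's trick: adjoin a variable [y] and specialise it to [1 / p]. *)
Theorem nullstellensatz (F : closedFieldType) n (I : {mpoly F[n]} -> Prop)
    (p : {mpoly F[n]}) :
    is_ideal I -> I 0 ->
    (forall a, (forall q, I q -> q.@[a] = 0) -> p.@[a] = 0) ->
  exists N, I (p ^+ N).
Proof.
move=> II I0 zp; have [ID IM] := II.
have [p0|nz_p] := eqVneq p 0; first by exists 1%N; rewrite p0 expr1.
pose tf : {mpoly F[n]} -> {fraction {mpoly F[n]}} := @tofrac _.
have nz_tp : tf p != 0 by rewrite tofrac_eq0.
pose e : {rmorphism {poly {mpoly F[n]}} -> {fraction {mpoly F[n]}}} :=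
  horner_eval ((tf p)^-1) \o map_poly tf.
have eC a : e a%:P = tf a by rewrite /= map_polyC /horner_eval hornerC.
have eX : e 'X = (tf p)^-1 by rewrite /= map_polyX /horner_eval hornerX.
have clear q : exists N b, tf (p ^+ N) * e q = tf b.
  elim/poly_ind: q => [|q c [N [b Nb]]]; first by exists 0%N, 0; rewrite rmorph0 mulr0 /tf tofrac0.
  exists N.+1, (b + p ^+ N.+1 * c).
  rewrite rmorphD rmorphM eX eC.
  have tfM x y : tf (x * y) = tf x * tf y by exact: tofracM.
  have -> : tf (b + p ^+ N.+1 * c) = tf b + tf (p ^+ N.+1) * tf c.
    by rewrite -tfM; exact: tofracD.
  by rewrite mulrDr exprSr tfM mulrACA mulfV // mulr1 Nb.
(* The polynomials whose value at y = 1 / p falls into the ideal once denominators are cleared; the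
   conclusion says that 1 is among them. *)
pose K q := exists M i, I i /\ tf (p ^+ M) * e q = tf i.
pose l (j : 'I_n) : F := 0.
have [|noz] := classic (K 1).
  move=> [M [i [Ii]]]; rewrite rmorph1 mulr1 => /eqP; rewrite tofrac_eq => /eqP pM.
  by exists M; rewrite pM.
have [||a aP] := @weak_nullstellensatz _ _ (fun q => K (msplit l q)).
- split=> [x y [M1 [i1 [I1 e1]]] [M2 [i2 [I2 e2]]]|x y [M [i [Ii ei]]]].
    exists (M1 + M2)%N, (p ^+ M2 * i1 + p ^+ M1 * i2); split; first by apply: ID; apply: IM.
    rewrite !rmorphD /tf tofracD !tofracM -/tf -e1 -e2 exprD /tf tofracM mulrDr.
    by congr (_ + _); rewrite !mulrA // [tofrac (p ^+ M2) * _]mulrC.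
  have [N [b Nb]] := clear (msplit l x).
  exists (N + M)%N, (b * i); split; first exact: IM.
  by rewrite !rmorphM exprD /tf !tofracM -/tf -Nb -ei mulrACA.
- by rewrite rmorph1.
pose w : {mpoly F[n]} -> {mpoly F[n.+1]} :=
  comp_mpoly [tuple 'X_(lift ord_max i) | i < n].
have sw q : msplit l (w q) = q%:P.
  rewrite -[LHS]/((msplit l \o w) q) -[RHS]/(polyC q).
  apply: mpoly_rmorph_ext => [c|i] /=; rewrite /w ?comp_mpolyC /msplit ?mmapC //.
  rewrite comp_mpolyXU -tnth_nth tnth_mktuple mmapX mmap1U /split_var.
  by rewrite liftK mpolyC0 mul0r addr0.
have ew q : (w q).@[a] = q.@[fun i => a (lift ord_max i)].
  by rewrite comp_mpoly_meval; apply: meval_eq => i; rewrite tnth_mktuple mevalXU.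
have sy : msplit l 'X_ord_max = 'X.
  by rewrite /msplit mmapX mmap1U /split_var unlift_none.
have : (1 - 'X_ord_max * w p).@[a] = 0.
  apply: aP; exists 0%N, 0; split=> //.
  have -> : msplit l (1 - 'X_ord_max * w p) = 1 - 'X * p%:P.
    have sB x y : msplit l (x - y) = msplit l x - msplit l y by exact: rmorphB.
    have sM x y : msplit l (x * y) = msplit l x * msplit l y by exact: rmorphM.
    by rewrite sB sM sw sy rmorph1.
  rewrite rmorphB rmorphM rmorph1.
  by rewrite eX eC mulVf // subrr mulr0 /tf tofrac0.
rewrite mevalB meval1 mevalM ew zp ?mulr0 ?subr0 => [/eqP|q Iq].
  by rewrite oner_eq0.
rewrite -ew; apply: aP; exists 0%N, q; split=> //.
by rewrite sw eC expr0 /tf tofrac1 mul1r.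
Qed.

(** * Unique factorization *)

Section Factorial.

Definition rdvd (R : idomainType) (a b : R) := exists c, b = c * a.

Definition rprime (R : idomainType) (p : R) :=
  [/\ p != 0, p \isn't a GRing.unit &
      forall a b, rdvd p (a * b) -> rdvd p a \/ rdvd p b].

(** Factors are prime elements rather than irreducible ones, which builds uniqueness into the
    notion. *)
Definition prime_factored (R : idomainType) (a : R) :=
  exists u (s : seq R), [/\ u \is a GRing.unit, forall p, p \in s -> rprime p &
                  a = u * \prod_(p <- s) p].

Definition factorial_ring (R : idomainType) :=
  forall a : R, a != 0 -> prime_factored a.

Variable R : idomainType.
Implicit Types (a b c p q : R) (f g h : {poly R}).

Lemma rdvd_mull a b c : rdvd a b -> rdvd a (c * b).
Proof. by case=> d ->; exists (c * d); rewrite mulrA. Qed.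

Lemma rdvdD a b c : rdvd a b -> rdvd a c -> rdvd a (b + c).
Proof. by move=> [d ->] [e ->]; exists (d + e); rewrite mulrDl. Qed.

Lemma rdvdN a b : rdvd a b -> rdvd a (- b).
Proof. by move=> [d ->]; exists (- d); rewrite mulNr. Qed.

Lemma rdvd0 a : rdvd a 0.
Proof. by exists 0; rewrite mul0r. Qed.

Lemma rdvd_sum (I : Type) (r : seq I) (P : pred I) (F : I -> R) a :
  (forall i, P i -> rdvd a (F i)) -> rdvd a (\sum_(i <- r | P i) F i).
Proof. by move=> dF; elim/big_rec: _ => [|i x /dF]; [exact: rdvd0 | exact: rdvdD]. Qed.

Lemma rprime_dvd_prod (S : idomainType) (p u : S) (s : seq S) :
  rprime p -> u \is a GRing.unit -> rdvd p (u * \prod_(q <- s) q) ->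
  exists2 q, q \in s & rdvd p q.
Proof.
move=> [nz nu pr] uu; elim: s => [|q s IHs].
  by rewrite big_nil mulr1 => -[c uE]; move: uu; rewrite uE unitrM (negbTE nu) andbF.
rewrite big_cons mulrCA => /pr [dq|/IHs [r rs dr]].
  by exists q; rewrite ?mem_head.
by exists r => //; rewrite inE rs orbT.
Qed.

Lemma rdvd_polyC p f : (forall i, rdvd p f`_i) -> rdvd p%:P f.
Proof.
elim/poly_ind: f => [|f c IHf] df; first by exists 0; rewrite mul0r.
have [g ->] : rdvd p%:P f.
  by apply: IHf => i; have := df i.+1; rewrite coefD coefMX coefC /= addr0.
have [d ->] : rdvd p c by have := df 0%N; rewrite coefD coefMX coefC /= add0r.
by exists (g * 'X + d%:P); rewrite mulrDl polyCM mulrAC.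
Qed.

Lemma rdvd_coef p f i : rdvd p%:P f -> rdvd p f`_i.
Proof. by case=> g ->; exists g`_i; rewrite coefMC. Qed.

Lemma rprime_polyC p : rprime p -> rprime p%:P.
Proof.
move=> [nz nu pr]; split; rewrite ?polyC_eq0 //.
  by apply: contra nu; rewrite poly_unitE coefC => /andP[].
have dX f : rdvd p%:P (f * 'X) -> rdvd p%:P f.
  move=> df; apply: rdvd_polyC => i.
  by have := rdvd_coef i.+1 df; rewrite coefMX.
have dMX f c : rdvd p%:P f -> rdvd p c -> rdvd p%:P (f * 'X + c%:P).
  move=> [g ->] [d ->]; exists (g * 'X + d%:P).
  by rewrite mulrDl polyCM mulrAC.
elim/poly_ind => [|f c IHf] g; first by left; exists 0; rewrite mul0r.
elim/poly_ind: g => [|g e IHg]; first by right; exists 0; rewrite mul0r.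
move=> dfg.
have [dc|ndc] := classic (rdvd p c).
  have : rdvd p%:P (f * (g * 'X + e%:P)).
    apply: dX; have [d cE] := dc; case: dfg => k kE.
    exists (k - d%:P * (g * 'X + e%:P)); move: kE; rewrite cE polyCM => kE.
    by rewrite mulrBl -kE; ring.
  by case/IHf => [df|]; [left; exact: dMX | right].
have [de|nde] := classic (rdvd p e).
  have : rdvd p%:P ((f * 'X + c%:P) * g).
    apply: dX; have [d eE] := de; case: dfg => k kE.
    exists (k - d%:P * (f * 'X + c%:P)); move: kE; rewrite eE polyCM => kE.
    by rewrite mulrBl -kE; ring.
  by case/IHg => [|dg]; [left | right; exact: dMX].
have := rdvd_coef 0 dfg; rewrite coef0M !coefD !coefMX !coefC /= !add0r.
by case/pr.
Qed.

Hypothesis ufd : factorial_ring R.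

(** Each prime factor of [c] divides [g] or [h] and is cancelled there without changing sizes. This
    brings a factorization with denominators back to [R]. *)
Lemma strip_content c f g h : c != 0 -> c%:P * f = g * h ->
  exists g1 h1, [/\ f = g1 * h1, size g1 = size g & size h1 = size h].
Proof.
move=> /ufd [u [s [uu ps ->]]]; elim: s ps g h => [|p s IHs] ps g h.
  rewrite big_nil mulr1 => eqf; exists ((u^-1)%:P * g), h; split=> //.
    by rewrite -mulrA -eqf mulrA -polyCM mulVr // mul1r.
  by rewrite mul_polyC size_scale // invr_eq0; apply: contraTneq uu => ->; rewrite unitr0.
have pp : rprime p by apply: ps; rewrite mem_head.
have [nzp _ pr] := rprime_polyC pp.
have {}IHs := IHs (fun q qs => ps q (@mem_behead _ (p :: s) q qs)).
rewrite big_cons mulrCA polyCM -mulrA => eqf.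
have /pr [[k kE]|[k kE]] : rdvd p%:P (g * h).
- by exists ((u * \prod_(q <- s) q)%:P * f); rewrite -eqf mulrC.
- move: eqf; rewrite kE [k * _]mulrC -mulrA => /(mulfI nzp) /IHs [g1 [h1 [fE sg sh]]].
  by exists g1, h1; split=> //; rewrite sg mul_polyC size_scale // -polyC_eq0.
move: eqf; rewrite kE [g * _]mulrA [g * k * _]mulrC => /(mulfI nzp) /IHs [g1 [h1 [fE sg sh]]].
by exists g1, h1; split=> //; rewrite sh mulrC mul_polyC size_scale // -polyC_eq0.
Qed.

Definition primitive_poly f := forall p, rprime p -> ~ rdvd p%:P f.

Lemma primitive_dvd c f g h : primitive_poly f -> c != 0 -> c%:P * g = h * f ->
  rdvd f g.
Proof.
move=> prim_f /ufd [u [s [uu ps ->]]]; elim: s ps h => [|p s IHs] ps h.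
  rewrite big_nil mulr1 => eqf; exists ((u^-1)%:P * h).
  by rewrite -mulrA -eqf mulrA -polyCM mulVr // mul1r.
have pp : rprime p by apply: ps; rewrite mem_head.
have [nzp _ pr] := rprime_polyC pp.
rewrite big_cons mulrCA polyCM -mulrA => eqf.
have /pr [[k kE]|] : rdvd p%:P (h * f); last by move/(prim_f _ pp).
  by exists ((u * \prod_(q <- s) q)%:P * g); rewrite -eqf mulrC.
move: eqf; rewrite kE [k * _]mulrC -mulrA => /(mulfI nzp).
by apply: IHs => q qs; apply: ps; rewrite inE qs orbT.
Qed.

(** Extracting a prime constant from [f] removes one prime from the leading coefficient, so the
    number of these primes decreases. *)
Lemma exists_primitive f : f != 0 ->
  exists c f1, [/\ c != 0, f = c%:P * f1 & primitive_poly f1].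
Proof.
rewrite -lead_coef_eq0 => /ufd [u [s [uu ps lcE]]].
have [k] := ubnP (size s); move: f u s uu ps lcE.
elim: k => // k IHk f u s uu ps lcE lek.
have [prim|] := classic (primitive_poly f).
  by exists 1, f; rewrite oner_neq0 polyC1 mul1r.
move=> /not_all_ex_not [p np]; have [pp ndv] := imply_to_and _ _ np.
have [h fE] := NNPP _ ndv.
have [nzp nup _] := pp.
have lch : lead_coef f = lead_coef h * p by rewrite fE lead_coefM lead_coefC.
have [q qs [t qE]] : exists2 q, q \in s & rdvd p q.
  by apply: (rprime_dvd_prod pp uu); exists (lead_coef h); rewrite -lcE.
have [nzq nuq prq] := ps q qs.
have ut : t \is a GRing.unit.
  have /prq [[r rE]|[r rE]] : rdvd q (t * p) by exists 1; rewrite mul1r qE.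
    have : 1 * q = (r * p) * q by rewrite mul1r {1}qE rE mulrAC.
    move/(mulIf nzq) => rp1; move: nup.
    by have := unitr1 R; rewrite rp1 unitrM => /andP[_ ->].
  have : 1 * p = (r * t) * p by rewrite mul1r {1}rE qE mulrA.
  by move/(mulIf nzp) => rt1; have := unitr1 R; rewrite rt1 unitrM => /andP[].
have [c [f1 [nzc hE prim]]] : exists c f1, [/\ c != 0, h = c%:P * f1 & primitive_poly f1].
  apply: (IHk h (u * t) (rem q s)); rewrite ?unitrM ?uu //.
  - by move=> r /mem_rem /ps.
  - apply: (mulIf nzp); rewrite -lch lcE (perm_big _ (perm_to_rem qs)) big_cons qE /=.
    by ring.
  - rewrite size_rem // -ltnS prednK //.
    by case: (s) qs.
by exists (p * c), f1; rewrite mulf_neq0 // fE hE polyCM; split=> //; rewrite mulrC mulrA.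
Qed.

(** The gcd of [f] and [a] taken up to constants lifts to a true factor of [f], hence is constant or
    of full degree: [f] divides [b] or [a] up to a constant, which primitivity removes. *)
Lemma primitive_irreducible_prime f : (1 < size f)%N -> primitive_poly f ->
    (forall g h, f = g * h -> (size g < size f)%N -> (size h < size f)%N -> False) ->
  rprime f.
Proof.
move=> sz_f prim irr.
have nz_f : f != 0 by rewrite -size_poly_gt0 ltnW.
split=> //; first by rewrite poly_unitE negb_and gtn_eqF.
move=> a b [k kE]; pose d := gcdp f a.
have nz_d : d != 0 by rewrite gcdp_eq0 negb_and nz_f.
have /Pdiv.Idomain.dvdpP [[c q] /= nzc cE] := dvdp_gcdl f a.
have [d1 [q1 [fE sd sq]]] : exists d1 q1 : {poly R}, [/\ f = d1 * q1, size d1 = size d & size q1 = size q].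
  by apply: (@strip_content c); rewrite // mul_polyC cE mulrC.
have nz_d1 : d1 != 0 by rewrite -size_poly_eq0 sd size_poly_eq0.
have nz_q1 : q1 != 0 by apply: contraNneq nz_f => q0; rewrite fE q0 mulr0.
have sz_dq : size f = (size d1 + size q1).-1 by rewrite {1}fE size_mul.
have sd0 : (0 < size d1)%N by rewrite size_poly_gt0.
have sq0 : (0 < size q1)%N by rewrite size_poly_gt0.
have [sd1|sd1] := eqVneq (size d1) 1%N.
  right; have cop : coprimep f a by rewrite /coprimep -/d -sd sd1.
  have : f %| a * b by apply/Pdiv.Idomain.dvdpP; exists (1, k); rewrite ?oner_neq0 //= scale1r.
  rewrite Gauss_dvdpr // => /Pdiv.Idomain.dvdpP [[e r] /= nze eE].
  by apply: (primitive_dvd prim nze (h := r)); rewrite mul_polyC.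
left; have sq1 : size q1 = 1%N.
  apply/eqP/negPn/negP => nsq1; apply: (irr d1 q1 fE); rewrite sz_dq.
    by move: sq0 nsq1; case: (size q1) => [|[|m]] // _ _; rewrite !addnS /= ltnS leq_addr.
  by move: sd0 sd1; case: (size d1) => [|[|m]] // _ _; rewrite !addSn /= ltnS leq_addl.
have eqd : d %= f.
  rewrite -dvdp_size_eqp ?dvdp_gcdl // -sd sz_dq sq1 addn1 //.
have : f %| a by rewrite -(eqp_dvdl _ eqd) dvdp_gcdr.
case/Pdiv.Idomain.dvdpP=> [[e r] /= nze eE].
by apply: (primitive_dvd prim nze (h := r)); rewrite mul_polyC.
Qed.

Lemma poly_factorial : factorial_ring {poly R}.
Proof.
move=> f; have [k] := ubnP (size f); elim: k f => // k IHk f lek nz_f.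
have constF c : c != 0 -> prime_factored c%:P.
  move=> /ufd [u [s [uu ps ->]]]; exists u%:P, (map polyC s); split.
  - have nzu : u != 0 by apply: contraTneq uu => ->; rewrite unitr0.
    by rewrite poly_unitE size_polyC nzu coefC uu.
  - by move=> q /mapP [p /ps pp ->]; exact: rprime_polyC.
  - by rewrite big_map polyCM rmorph_prod.
have prodF g h : prime_factored g -> prime_factored h -> prime_factored (g * h).
  move=> [u [s [uu ps ->]]] [v [t [vu pt ->]]]; exists (u * v), (s ++ t); split.
  - by rewrite unitrM uu.
  - by move=> p; rewrite mem_cat => /orP[/ps|/pt].
  - by rewrite big_cat mulrACA.
have [c [f1 [nzc fE prim]]] := exists_primitive nz_f.
have nz_f1 : f1 != 0 by apply: contraNneq nz_f => f0; rewrite fE f0 mulr0.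
have sz_f1 : size f1 = size f by rewrite fE mul_polyC size_scale.
rewrite fE; apply: (prodF c%:P f1); first exact: constF.
have [le1|gt1] := leqP (size f1) 1.
  have /size_poly1P [e nze ->] : size f1 == 1%N by rewrite eqn_leq le1 size_poly_gt0.
  exact: constF.
have [[g [h [f1E [lg lh]]]]|irr] :=
    classic (exists g h, f1 = g * h /\ (size g < size f1)%N /\ (size h < size f1)%N).
  have : (g != 0) && (h != 0) by rewrite -negb_or -mulf_eq0 -f1E.
  case/andP=> nzg nzh; rewrite f1E; apply: prodF; apply: IHk => //.
    by rewrite -ltnS (leq_trans _ lek) // ltnS -sz_f1.
  by rewrite -ltnS (leq_trans _ lek) // ltnS -sz_f1.
exists 1, [:: f1]; rewrite unitr1 big_seq1 mul1r; split=> // p.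
rewrite inE => /eqP ->; apply: primitive_irreducible_prime => // g h f1E lg lh.
by apply: irr; exists g, h.
Qed.

End Factorial.

Lemma factorial_transport (R S : idomainType) (f : {rmorphism R -> S})
    (g : {rmorphism S -> R}) :
  cancel f g -> cancel g f -> factorial_ring R -> factorial_ring S.
Proof.
move=> fK gK ufd a nz_a.
have [|u [s [uu ps aE]]] := ufd (g a).
  by apply: contraNneq nz_a => ga0; rewrite -[a]gK ga0 rmorph0.
exists (f u), (map f s); split; first exact: rmorph_unit.
  move=> q /mapP [p /ps [nz nu pr] ->]; split.
  - by apply: contraNneq nz => fp0; rewrite -[p]fK fp0 rmorph0.
  - by apply: contra nu => /(rmorph_unit g); rewrite fK.
  - move=> b c [k kE]; have : rdvd p (g b * g c).
      by exists (g k); rewrite -rmorphM kE rmorphM fK.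
    by case/pr => -[d dE]; [left|right]; exists (f d); rewrite -rmorphM -dE gK.
by rewrite -[a]gK aE rmorphM rmorph_prod big_map.
Qed.

Section MpolyFactorial.
Variable F : fieldType.

Lemma mjoinK n (l : 'I_n -> F) : cancel (mjoin l) (msplit l).
Proof.
have sM x y : msplit l (x * y) = msplit l x * msplit l y by exact: rmorphM.
have sD x y : msplit l (x + y) = msplit l x + msplit l y by exact: rmorphD.
have sB x y : msplit l (x - y) = msplit l x - msplit l y by exact: rmorphB.
have jM x y : mjoin l (x * y) = mjoin l x * mjoin l y by exact: rmorphM.
have jD x y : mjoin l (x + y) = mjoin l x + mjoin l y by exact: rmorphD.
have jC a : msplit l (mjoin l a%:P) = a%:P.
  rewrite -[LHS]/((msplit l \o (mjoin l \o polyC)) a) -[RHS]/(polyC a).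
  apply: mpoly_rmorph_ext => [c|i] /=; rewrite /mjoin /= map_polyC /= /horner_eval hornerC.
    by rewrite comp_mpolyC /msplit mmapC.
  rewrite comp_mpolyXU -tnth_nth tnth_mktuple -mul_mpolyC sB sM.
  rewrite /msplit mmapC !mmapX !mmap1U /split_var liftK unlift_none.
  by rewrite /= addrK.
have jX : msplit l (mjoin l 'X) = 'X.
  rewrite /mjoin /= map_polyX /horner_eval hornerX.
  by rewrite /msplit mmapX mmap1U /split_var unlift_none.
by elim/poly_ind => [|q c IHq]; rewrite ?rmorph0 // jD jM sD sM IHq jC jX.
Qed.

Lemma mpoly_factorial n : factorial_ring {mpoly F[n]}.
Proof.
elim: n => [|n IHn].
  move=> p nz_p; exists p, [::]; rewrite big_nil mulr1; split=> //.
  apply/unitrP; exists ((p@_0)^-1)%:MP.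
  move: nz_p; rewrite (nvar0_mpolyC p) mpolyC_eq0 mcoeffC eqxx mulr1 => nz.
  by rewrite -!mpolyCM mulVf // mulfV.
pose l (i : 'I_n) : F := 0.
exact: (factorial_transport (mjoinK l) (msplitK l) (poly_factorial IHn)).
Qed.

End MpolyFactorial.

(** * Elimination by counting dimensions *)

Section MsizeBounds.
Variables (R : idomainType) (n : nat).
Implicit Types p q : {mpoly R[n]}.

Lemma msizeM_bound p q a b : (msize p <= a.+1)%N -> (msize q <= b.+1)%N ->
  (msize (p * q) <= (a + b).+1)%N.
Proof.
have [->|nzp] := eqVneq p 0; first by rewrite mul0r msize0.
have [->|nzq] := eqVneq q 0; first by rewrite mulr0 msize0.
by rewrite msizeM //; lia.
Qed.

Lemma msizeX_bound p a k : (msize p <= a.+1)%N -> (msize (p ^+ k) <= (a * k).+1)%N.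
Proof.
move=> sp; elim: k => [|k IHk]; first by rewrite expr0 msize1.
by rewrite exprS mulnS msizeM_bound.
Qed.

Lemma msize_prod_bound (I : Type) (r : seq I) (f : I -> {mpoly R[n]}) (k : I -> nat) :
  (forall i, msize (f i) <= (k i).+1)%N ->
  (msize (\prod_(i <- r) f i) <= (\sum_(i <- r) k i).+1)%N.
Proof.
move=> sf; elim: r => [|i r IHr]; first by rewrite !big_nil msize1.
by rewrite !big_cons msizeM_bound.
Qed.

Lemma msizeD_bound p q a : (msize p <= a)%N -> (msize q <= a)%N -> (msize (p + q) <= a)%N.
Proof. by move=> sp sq; rewrite (leq_trans (msizeD_le _ _)) // geq_max sp. Qed.

Lemma msize_sum_bound (I : Type) (r : seq I) (P : pred I) (f : I -> {mpoly R[n]}) a :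
  (forall i, P i -> msize (f i) <= a)%N -> (msize (\sum_(i <- r | P i) f i) <= a)%N.
Proof.
move=> sf; elim/big_rec: _ => [|i p /sf sp sq]; first by rewrite msize0.
exact: msizeD_bound.
Qed.

Lemma msizeZ_bound (c : R) p a : (msize p <= a)%N -> (msize (c *: p) <= a)%N.
Proof. exact: leq_trans (msizeZ_le _ _). Qed.

Lemma mcoeff_ge_msize p m : (msize p <= mdeg m)%N -> p@_m = 0.
Proof. by move/msize_mdeg_ge/memN_msupp_eq0. Qed.

End MsizeBounds.

Lemma kernel_neq0 (F : fieldType) m n (A : 'M[F]_(m, n)) :
  (n < m)%N -> exists2 v : 'rV[F]_m, v != 0 & v *m A = 0.
Proof.
move=> lt_nm; have : kermx A != 0.
  by rewrite -mxrank_eq0 mxrank_ker subn_eq0 -ltnNge (leq_ltn_trans (rank_leq_col A)).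
case/rowV0Pn=> v /sub_kermxP vA nz_v; by exists v.
Qed.

(** The m^P monomials in [phi] with exponents below m lie in a space whose dimension grows only like
    m^Q, so for large m they are linearly dependent. *)
Lemma algebraic_dependence (F : fieldType) P Q (phi : 'I_P -> {mpoly F[Q]}) :
  (Q < P)%N ->
  exists2 G : {mpoly F[P]}, G != 0 & G \mPo [tuple phi i | i < P] = 0.
Proof.
move=> lt_QP.
pose D := (\max_i msize (phi i))%N.
have sphi i : (msize (phi i) <= D.+1)%N by rewrite leqW // /D (leq_bigmax i).
(* Chosen so that (m (P D + 1))^Q < m^(Q + 1) <= m^P. *)
pose m := ((P * D).+1 ^ Q).+1.
pose K := (P * m * D).+1.
pose E := {ffun 'I_P -> 'I_m}; pose B := {ffun 'I_Q -> 'I_K}.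
pose mon (e : E) : 'X_{1..P} := [multinom val (e i) | i < P].
pose mon' (b : B) : 'X_{1..Q} := [multinom val (b i) | i < Q].
pose im (e : E) : {mpoly F[Q]} := 'X_[mon e] \mPo [tuple phi i | i < P].
have s_im e : (msize (im e) <= K)%N.
  rewrite /im comp_mpolyX; apply: leq_trans (_ : (\sum_(i < P) D * m).+1 <= _)%N.
    apply: (@msize_prod_bound _ _ _ _ _ (fun=> D * m)%N) => i.
    rewrite tnth_mktuple mnmE; apply: leq_trans (msizeX_bound _ (sphi i)) _.
    by rewrite ltnS leq_mul2l (ltnW (ltn_ord _)) orbT.
  by rewrite sum_nat_const card_ord /K ltnS; lia.
have cardlt : (#|{: B}| < #|{: E}|)%N.
  rewrite !card_ffun !card_ord.
  apply: leq_ltn_trans (_ : (m * (P * D).+1) ^ Q < _)%N.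
    have leX a b e : (a <= b -> a ^ e <= b ^ e)%N by case: e => // e; rewrite leq_exp2r.
    by apply: leX; rewrite /K /m; lia.
  rewrite expnMn; apply: leq_trans (_ : m ^ Q.+1 <= _)%N; last by rewrite leq_pexp2l.
  by rewrite expnSr ltn_pmul2l ?expn_gt0.
pose A : 'M[F]_(#|{: E}|, #|{: B}|) :=
  \matrix_(i, j) (im (enum_val i))@_(mon' (enum_val j)).
have [v nz_v vA] := kernel_neq0 A cardlt.
exists (\sum_i v 0 i *: 'X_[mon (enum_val i)]).
  apply: contraNneq nz_v => G0; apply/eqP/rowP => i; rewrite mxE.
  have := congr1 (mcoeff (mon (enum_val i))) G0; rewrite mcoeff0 raddf_sum /=.
  rewrite (bigD1 i) //= mcoeffZ mcoeffX eqxx mulr1 big1 ?addr0 // => j ne_ji.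
  rewrite mcoeffZ mcoeffX; case: eqP => [/mnmP eqm|]; last by rewrite mulr0.
  case/eqP: ne_ji; apply: enum_val_inj; apply/ffunP => k; apply: val_inj.
  by have := eqm k; rewrite !mnmE.
rewrite raddf_sum /=; apply/mpolyP => mu; rewrite mcoeff0 raddf_sum /=.
have [le_K|lt_K] := leqP K (mdeg mu).
  rewrite big1 // => i _; rewrite comp_mpolyZ mcoeffZ mcoeff_ge_msize ?mulr0 //.
  exact: leq_trans (s_im _) le_K.
have lt_mu i : (mu i < K)%N.
  by apply: leq_ltn_trans lt_K; rewrite mdegE (bigD1 i) //= leq_addr.
pose b : B := [ffun i => Ordinal (lt_mu i)].
have <- : mon' b = mu by apply/mnmP => i; rewrite mnmE ffunE.
move/rowP/(_ (enum_rank b)): vA; rewrite !mxE => vb; rewrite -[RHS]vb.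
by apply: eq_bigr => i _; rewrite mxE enum_rankK comp_mpolyZ mcoeffZ.
Qed.

Lemma rank_minor (F : fieldType) m n (A : 'M[F]_(m, n)) :
  exists (f : {ffun 'I_(\rank A) -> 'I_m}) (g : {ffun 'I_(\rank A) -> 'I_n}),
    injective f /\ \det (mxsub f g A) != 0.
Proof.
pose B := rowsub (maxrankfun A) A.
have fullB : row_full B^T.
  by rewrite /row_full mxrank_tr; exact: maxrowsub_free.
exists (maxrankfun A), (fullrankfun fullB); split; first exact: maxrankfun_inj.
have := fullrowsub_unit fullB; rewrite unitmxE unitfE -det_tr.
by congr (\det _ != 0); apply/matrixP => i j; rewrite !mxE.
Qed.

(** The values at [x] of the homogeneous components are the coefficients of G(c x) as a polynomial
    in [c], which has every scalar as a root. *)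
Lemma homog_component_vanish (F : closedFieldType) n (G : {mpoly F[n]}) x e :
  (forall c, G.@[fun i => c * x i] = 0) -> (pihomog mdeg e G).@[x] = 0.
Proof.
move=> G0; pose K := msize G.
have q0 : \poly_(d < K) (pihomog mdeg d G).@[x] = 0.
  apply/eqP/negPn/negP => /closed_nonrootP [c]; rewrite rootE horner_poly => /eqP; apply.
  rewrite -[RHS](G0 c) [in RHS](pihomog_partitionE (mf := mdeg) (leqnn K)) raddf_sum /=.
  by apply: eq_bigr => d _; rewrite (meval_homog_scale _ _ (pihomogP _ _ _)) mulrC.
have [lt_eK|le_Ke] := ltnP e K.
  by have := congr1 (fun q : {poly F} => q`_e) q0; rewrite coef_poly lt_eK coef0.
have -> : pihomog mdeg e G = 0; last by rewrite meval0.
apply/mpolyP => m; rewrite mcoeff_pihomog mcoeff0; case: eqP => // dm.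
by apply: mcoeff_ge_msize; rewrite dm.
Qed.

Lemma exists_homog_component (R : nzRingType) n (G : {mpoly R[n]}) :
  G != 0 -> exists2 e, pihomog mdeg e G != 0 & pihomog mdeg e G \is e.-homog.
Proof. by move/pihomog_top_neq0; exists (msize G).-1; rewrite ?pihomogP. Qed.

Section NonDense.
Variables (F : closedFieldType) (k P r : nat).
Variables (pat : 'I_k -> option F) (E : 'M[{mpoly F[k]}]_(P, r)).

Definition fits_pattern (z : 'I_k -> F) := forall i a, pat i = Some a -> z i = a.

(** Where the minor D is nonzero, Cramer's rule expresses D times the coordinates of [c] in the rows
    [f] through the other coordinates. So D c is a polynomial function of at most P - s coordinates
    and the free entries of [z], fewer than P quantities in all. *)
Lemma non_dense_minor s (f : {ffun 'I_s -> 'I_P}) (g : {ffun 'I_s -> 'I_r}) :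
  (#|[pred i | pat i == None]| < s)%N -> injective f ->
  exists G : {mpoly F[P]}, [/\ G != 0, exists e, G \is e.-homog &
    forall z (c : 'rV[F]_P), fits_pattern z ->
      \det (mxsub f g (map_mx (meval z) E)) != 0 ->
      c *m map_mx (meval z) E = 0 -> G.@[c 0] = 0].
Proof.
move=> lt_s inj_f.
pose J : finType := ({i | pat i == None} + {i | i \notin codom f})%type.
pose X (j : J) : {mpoly F[#|J|]} := 'X_(enum_rank j).
pose zt (i : 'I_k) := if insub i is Some j then X (inl j) else (odflt 0 (pat i))%:MP.
pose ct (i : 'I_P) := if insub i is Some j then X (inr j) else 0.
pose Et := map_mx (comp_mpoly [tuple zt i | i < k]) E.
pose D := \det (mxsub f g Et).
pose Y := (\row_i ct i) *m colsub g Et *m \adj (mxsub f g Et).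
pose phi (i : 'I_P) := if [pick a | f a == i] is Some a then - Y 0 a else D * ct i.
have card_J : (#|J| < P)%N.
  rewrite card_sum !card_sig.
  have cf : #|codom f| = s by rewrite card_codom // card_ord.
  have := cardC (mem (codom f)); rewrite cf card_ord.
  rewrite (eq_card (A := [predC codom f]) (B := [pred i | i \notin codom f])) //.
  by move: lt_s; set u := #|_|; set v := #|_|; lia.
have [G nzG G0] := algebraic_dependence phi card_J.
have [e nzGe homGe] := exists_homog_component nzG.
exists (pihomog mdeg e G); split=> //; first by exists e.
move=> z c fit nzdet cE0.
set D0 := \det _ in nzdet.
(* The parametrised set is a cone, since [c] may be scaled by [x]; a relation on it can therefore be
   replaced by a homogeneous component, from which the power of [D0] splits off. *)
suff GD x : G.@[fun i => x * (D0 * c 0 i)] = 0.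
  have := homog_component_vanish e GD.
  rewrite (meval_homog_scale _ _ homGe) => /eqP.
  by rewrite mulf_eq0 expf_eq0 (negbTE nzdet) andbF => /eqP.
pose tau (j : J) := match j with inl i => z (val i) | inr i => x * c 0 (val i) end.
pose t (i : 'I_#|J|) := tau (enum_val i).
have Xt j : (X j).@[t] = tau j by rewrite mevalXU /t enum_rankK.
have ztE i : (zt i).@[t] = z i.
  rewrite /zt; case: insubP => [j _ <-|]; first by rewrite Xt.
  by case pi: (pat i) => [a|] //= _; rewrite mevalC (fit _ _ pi).
have ctE i : (ct i).@[t] = if i \in codom f then 0 else x * c 0 i.
  rewrite /ct; case: insubP => [j nj ji|]; first by rewrite (negbTE nj) Xt /= ji.
  by rewrite negbK => ->; rewrite meval0.
have EtE0 i j : (E i j \mPo [tuple zt i | i < k]).@[t] = (E i j).@[z].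
  by rewrite comp_mpoly_meval; apply: meval_eq => l; rewrite tnth_mktuple ztE.
have EtE : map_mx (meval t) Et = map_mx (meval z) E.
  by apply/matrixP => i j; rewrite !mxE EtE0.
have subE : map_mx (meval t) (mxsub f g Et) = mxsub f g (map_mx (meval z) E).
  by rewrite -EtE; apply/matrixP => i j; rewrite !mxE.
have DE : D.@[t] = D0 by rewrite /D -det_map_mx subE.
have YE a : (Y 0 a).@[t] = - (x * (D0 * c 0 (f a))).
  have -> : (Y 0 a).@[t] = (map_mx (meval t) Y) 0 a by rewrite [RHS]mxE.
  rewrite /Y !map_mxM map_mx_adj subE.
  have -> : map_mx (meval t) (\row_i ct i) *m map_mx (meval t) (colsub g Et)
      = - (x *: ((\row_b c 0 (f b)) *m mxsub f g (map_mx (meval z) E))).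
    apply/rowP => b; have /rowP/(_ (g b)) := cE0; rewrite !mxE => cb.
    apply/eqP; rewrite -addr_eq0; apply/eqP.
    move/(congr1 ( *%R x)): cb; rewrite mulr0 => cb.
    rewrite -[RHS]cb [in RHS](bigID (mem (codom f))) /= mulrDr addrC.
    congr (_ + _).
      congr (_ * _); rewrite -big_uniq /=; last by rewrite map_inj_uniq ?enum_uniq.
      by rewrite big_image; apply: eq_bigr => a0 _; rewrite !mxE.
    rewrite mulr_sumr [RHS]big_mkcond; apply: eq_bigr => i _; rewrite !mxE ctE.
    by case: ifP => _; rewrite ?mul0r //= EtE0 mulrA.
  rewrite mulNmx -scalemxAl -mulmxA mul_mx_adj mul_mx_scalar !mxE.
  by rewrite -/D0.
have := congr1 (meval t) G0; rewrite meval0 comp_mpoly_meval => Gt; rewrite -[RHS]Gt.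
apply: meval_eq => i; rewrite tnth_mktuple /phi; case: pickP => [a /eqP <-|no].
  by rewrite mevalN YE opprK.
rewrite [RHS](mevalM t D (ct i)) DE ctE ifN; first by rewrite mulrCA.
by apply/negP => /codomP [a ai]; have := no a; rewrite -ai eqxx.
Qed.

(* The matrix [E] has polynomial entries in [k] parameters, some of which are
   frozen by the pattern.  The union of the left kernels of its
   specialisations of rank at least [s] is parametrised by fewer than [P]
   coordinates when fewer than [s] parameters are free. *)
Lemma non_dense s : (#|[pred i | pat i == None]| < s)%N ->
  exists G : {mpoly F[P]}, [/\ G != 0, exists e, G \is e.-homog &
    forall z (c : 'rV[F]_P), fits_pattern z ->
      (s <= \rank (map_mx (meval z) E))%N ->
      c *m map_mx (meval z) E = 0 -> G.@[c 0] = 0].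
Proof.
move=> lt_s.
pose idx (q : 'I_P.+1) := ({ffun 'I_q -> 'I_P} * {ffun 'I_q -> 'I_r})%type.
have [H HP] : exists H : forall q, idx q -> {mpoly F[P]}, forall q (fg : idx q),
    (s <= q)%N -> injective fg.1 ->
    [/\ H q fg != 0, exists e, H q fg \is e.-homog &
    forall z (c : 'rV[F]_P), fits_pattern z ->
      \det (mxsub fg.1 fg.2 (map_mx (meval z) E)) != 0 ->
      c *m map_mx (meval z) E = 0 -> (H q fg).@[c 0] = 0].
  have step (q : 'I_P.+1) : exists H : idx q -> {mpoly F[P]}, forall fg : idx q,
    (s <= q)%N -> injective fg.1 ->
    [/\ H fg != 0, exists e, H fg \is e.-homog &
    forall z (c : 'rV[F]_P), fits_pattern z ->
      \det (mxsub fg.1 fg.2 (map_mx (meval z) E)) != 0 ->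
      c *m map_mx (meval z) E = 0 -> (H fg).@[c 0] = 0].
    have one (fg : idx q) : exists G : {mpoly F[P]}, (s <= q)%N -> injective fg.1 ->
        [/\ G != 0, exists e, G \is e.-homog &
        forall z (c : 'rV[F]_P), fits_pattern z ->
          \det (mxsub fg.1 fg.2 (map_mx (meval z) E)) != 0 ->
          c *m map_mx (meval z) E = 0 -> G.@[c 0] = 0]; last first.
      by have [H HP] := fin_all_exists one; exists H.
    case: fg => f g /=; have [le_sq|lt_qs] := leqP s q; last by exists 1.
    have [inj_f|ninj] := classic (injective f); last by exists 1.
    have [G GP] := @non_dense_minor q f g (leq_trans lt_s le_sq) inj_f.
    by exists G.
  by have [H HP] := fin_all_exists step; exists H.
pose ok q (fg : idx q) := (s <= q)%N && injectiveb fg.1.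
(* The nonzero minor at hand has the exact rank as its size, which can be any q >= s; the product
   provides for every size and every position. *)
exists (\prod_(q < P.+1) \prod_(fg : idx q | ok q fg) H q fg); split.
- apply/prodf_neq0 => q _; apply/prodf_neq0 => fg /andP[le_sq /injectiveP inj].
  by have [] := HP q fg le_sq inj.
- have homP (T : finType) (A : pred T) (K : T -> {mpoly F[P]}) :
      (forall i, A i -> exists e, K i \is e.-homog) ->
      exists e, \prod_(i | A i) K i \is e.-homog.
    move=> hK; elim/big_rec: _ => [|i p /hK [e1 h1] [e2 h2]].
      by exists 0%N; exact: dhomog1.
    by exists (e1 + e2)%N; exact: dhomogM.
  apply: (homP _ _ _) => q _; apply: (homP _ _ _) => fg /andP[le_sq /injectiveP inj].
  by have [] := HP q fg le_sq inj.
move=> z c fit le_s cE0; set M := map_mx _ _ in le_s cE0.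
have ltP : (\rank M < P.+1)%N by rewrite ltnS rank_leq_row.
have [f [g [inj_f nzdet]]] := rank_minor M.
have := HP (Ordinal ltP) (f, g) le_s inj_f => -[_ _ /(_ z c fit nzdet cE0) H0].
rewrite (bigD1 (Ordinal ltP)) //= mevalM (bigD1 (f, g)) /=; last first.
  by rewrite /ok /= le_s /=; apply/injectiveP.
by rewrite mevalM H0 !mul0r.
Qed.

End NonDense.

(** * Counting monomials and the growth of binomial coefficients *)

Lemma sum_binomial n T : (\sum_(d < T) 'C(d + n, d) = 'C(T + n, n.+1))%N.
Proof.
elim: T => [|T IHT]; first by rewrite big_ord0 add0n bin_small.
rewrite big_ord_recr /= IHT addSn binS; congr (_ + _)%N.
by rewrite -(bin_sub (leq_addl T n)) addnK.
Qed.

Lemma card_bmultinom n T : #|{: 'X_{1..n.+1 < T}}| = 'C(T + n, n.+1).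
Proof.
rewrite -sum_binomial -sum1_card.
rewrite (partition_big (fun m : 'X_{1..n.+1 < T} => Ordinal (bmdeg m)) predT) //=.
apply: eq_bigr => d _; rewrite -size_basis sum1_card.
rewrite cardE -(size_map (@bmnm _ _)); apply/perm_size/uniq_perm.
- by rewrite map_inj_uniq ?enum_uniq //; exact: val_inj.
- exact: uniq_basis.
move=> m; rewrite -basis_cover; apply/mapP/eqP => [[m' + ->]|dm].
  by rewrite mem_enum => /eqnP.
have lt_m : (mdeg m < T)%N by rewrite dm.
by exists (BMultinom lt_m); rewrite // mem_enum; apply/eqnP.
Qed.

Lemma card_bmultinom_le n T : (#|{: 'X_{1..n < T}}| <= T ^ n)%N.
Proof.
have lt (m : 'X_{1..n < T}) i : (bmnm m i < T)%N.
  by apply: leq_ltn_trans (bmdeg m); rewrite mdegE (bigD1 i) //= leq_addr.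
pose f (m : 'X_{1..n < T}) := [ffun i => Ordinal (lt m i)].
have inj_f : injective f.
  move=> m1 m2 /ffunP eqf; apply: val_inj; apply/mnmP => i.
  by have := congr1 val (eqf i); rewrite !ffunE.
by have := leq_card f inj_f; rewrite card_ffun !card_ord.
Qed.

(** The mixed difference of [s] with steps p and q is the sum of the second differences of [s] at X
    + i + j for i < p and j < q; only the largest one is kept. *)
Lemma binomial_growth r X p q (s := fun T => 'C(T + r.+2, r.+3)) : (0 < p)%N -> (0 < q)%N ->
  (s (X + p) + s (X + q) + 'C(X + p + q + r, r.+1) <= s (X + p + q) + s X)%N.
Proof.
pose d T := 'C(T + r.+2, r.+2); pose e T := 'C(T + r.+2, r.+1).
have sS T : s T.+1 = (s T + d T)%N by rewrite /s /d addSn binS.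
have dS T : d T.+1 = (d T + e T)%N by rewrite /d /e addSn binS.
have d_mono Y k : (d Y <= d (Y + k))%N.
  by elim: k => [|k IHk]; rewrite ?addn0 // addnS dS (leq_trans IHk) ?leq_addr.
case: p => // p _; case: q => // q _.
have low : (s (X + p) + s (X + q.+1) <= s (X + p + q.+1) + s X)%N.
  elim: p => [|p IHp]; first by rewrite !addn0 addnC.
  have := d_mono (X + p)%N q.+1.
  by rewrite [(X + p.+1)%N]addnS addSn !sS; lia.
have := d_mono (X + p)%N q.
have -> : (X + p.+1 + q.+1 + r = X + p + q + r.+2)%N by lia.
rewrite -/(e (X + p + q)%N) [(X + p.+1)%N]addnS [((X + p).+1 + _)%N]addSn !sS.
by rewrite [(X + p + q.+1)%N]addnS dS; move: low; rewrite [(X + p + q.+1)%N]addnS; lia.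
Qed.

(** The mixed difference is at least a binomial coefficient of degree r + 1 in T, which is at least
    T^(r+1) / (r+1)! and so overtakes K T^r. *)
Lemma growth_contradiction r K p q T (s := fun T => 'C(T + r.+2, r.+3)) :
    (0 < p)%N -> (0 < q)%N -> (p + q + K * (r.+1)`! < T)%N ->
  (K * T ^ r + s (T - q) + s (T - p) < s T + s (T - q - p))%N.
Proof.
move=> p0 q0 ltT.
have := @binomial_growth r (T - q - p) p q p0 q0; rewrite -/s.
have -> : (T - q - p + p = T - q)%N by lia.
have -> : (T - q - p + q = T - p)%N by lia.
have -> : (T - q + q = T)%N by lia.
move=> growth; suff : (K * T ^ r < 'C(T + r, r.+1))%N.
  rewrite /s; move: growth; clear; move: (K * T ^ r)%N 'C(T - q + r.+2, r.+3)
    'C(T - p + r.+2, r.+3) 'C(T + r, r.+1) 'C(T + r.+2, r.+3) 'C(T - q - p + r.+2, r.+3).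
  by lia.
rewrite -(ltn_pmul2r (fact_gt0 r.+1)) bin_ffact.
have ffl k : (T ^ k.+1 <= (T + k) ^_ k.+1)%N.
  elim: k => [|k IHk]; first by rewrite addn0 ffactn1.
  by rewrite expnS addnS ffactSS leq_mul //; lia.
apply: leq_trans (ffl r); rewrite mulnAC expnS ltn_pmul2r ?expn_gt0; lia.
Qed.

(** The left kernel of [A], of dimension at least a + b - c, projects injectively to the first
    block, with image inside the row space of [B]. *)
Lemma kernel_dimension_bound (F : fieldType) a b c l (A : 'M[F]_(a + b, c)) (B : 'M[F]_(l, a)) :
    (forall (v1 : 'rV_a) (v2 : 'rV_b), row_mx v1 v2 *m A = 0 ->
       (exists u, v1 = u *m B) /\ (v1 = 0 -> v2 = 0)) ->
  (a + b <= c + l)%N.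
Proof.
move=> H; pose K := kermx A.
pose Pi : 'M[F]_(a + b, a) := col_mx 1%:M 0.
have sub : (K *m Pi <= B)%MS.
  apply/row_subP => i; rewrite row_mul.
  have : row i K *m A = 0 by apply/sub_kermxP; rewrite row_sub.
  rewrite -[row i K]hsubmxK => /H [[u v1E] _].
  by rewrite mul_row_col mulmx1 mulmx0 addr0 v1E submxMl.
have cap : (K :&: kermx Pi)%MS = 0.
  apply/eqP; rewrite -submx0; apply/rV_subP => v; rewrite sub_capmx.
  case/andP=> /sub_kermxP vA /sub_kermxP.
  move: vA; rewrite -[v]hsubmxK => /H [_ v2].
  rewrite mul_row_col mulmx1 mulmx0 addr0 => v10.
  by rewrite v10 (v2 v10) row_mx0 sub0mx.
have := mxrank_mul_ker K Pi; rewrite cap mxrank0 addn0 => rk.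
have := mxrankS sub; rewrite rk mxrank_ker => le1.
have := rank_leq_row B; have := rank_leq_col A.
by move: le1; lia.
Qed.

Lemma pihomogM (R : nzRingType) n d e (h f : {mpoly R[n]}) : f \is e.-homog ->
  pihomog mdeg d (h * f) = if (e <= d)%N then pihomog mdeg (d - e) h * f else 0.
Proof.
move=> hf; rewrite {1}(pihomog_partitionE (mf := mdeg) (leqnn (msize h))).
rewrite mulr_suml raddf_sum /=.
have hom k : pihomog mdeg k h * f \is (k + e).-homog by rewrite dhomogM ?pihomogP.
have ne k : (k + e != d)%N -> pihomog mdeg d (pihomog mdeg k h * f) = 0.
  by move=> ne_d; rewrite (pihomog_ne0 ne_d (hom k)).
case: leqP => [le_ed|lt_de]; last first.
  by rewrite big1 // => k _; apply: ne; rewrite neq_ltn ltn_addl ?orbT.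
have [lt|ge] := ltnP (d - e) (msize h).
  rewrite (bigD1 (Ordinal lt)) //= pihomog_dE; last by have := hom (d - e)%N; rewrite subnK.
  rewrite big1 ?addr0 // => k; rewrite -val_eqE /= => nk; apply: ne.
  by apply: contraNneq nk => <-; rewrite addnK.
have -> : pihomog mdeg (d - e) h = 0.
  apply/mpolyP => m; rewrite mcoeff_pihomog mcoeff0; case: eqP => // dm.
  by apply/memN_msupp_eq0/msize_mdeg_ge; rewrite dm.
rewrite mul0r big1 // => k _; apply: ne; apply: contraTneq (ltn_ord k) => kd.
by rewrite -leqNgt; move: ge; rewrite -kd addnK.
Qed.

Lemma msize_homog (R : nzRingType) n d (p : {mpoly R[n]}) :
  p \is d.-homog -> (msize p <= d.+1)%N.
Proof.
move/dhomogP => hp; rewrite msizeE; apply/bigmax_leqP_seq => m mp _.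
by rewrite hp.
Qed.

(** * Hilbert functions in height three *)

Section Decomposition.
Variables (F : closedFieldType) (v r : nat) (T : finType).
Variables (J : {mpoly F[v]}) (B : T -> {mpoly F[v]}) (g : 'I_r -> {mpoly F[v]}).
Variables (p b D : nat).
Hypotheses (homJ : J \is p.-homog) (homB : forall j, B j \is b.-homog).
Hypotheses (homg : forall i, g i \is D.-homog) (D_gt0 : (0 < D)%N).
Hypothesis no_zero : forall x, J.@[x] = 0 -> (forall j, (B j).@[x] = 0) ->
  (forall i, (g i).@[x] = 0) -> forall k, x k = 0.

Let gen (u : T + 'I_r + 'I_1) : {mpoly F[v]} :=
  match u with inr _ => J | inl (inl j) => B j | inl (inr i) => g i end.
Let gdeg (u : T + 'I_r + 'I_1) : nat :=
  match u with inr _ => p | inl (inl j) => b | inl (inr i) => D end.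

Lemma high_monomials : exists N, forall m : 'X_{1..v}, (N <= mdeg m)%N ->
  ideal_gen gen 'X_[m].
Proof.
have one (k : 'I_v) : exists N, ideal_gen gen ('X_k ^+ N).
  apply: nullstellensatz.
  - exact: ideal_gen_ideal.
  - by exists (fun=> 0); rewrite big1 // => i _; rewrite mul0r.
  move=> x zx; rewrite mevalXU; apply: no_zero.
  - exact: (zx J (ideal_gen_mem gen (inr ord0))).
  - by move=> j; exact: (zx _ (ideal_gen_mem gen (inl (inl j)))).
  - by move=> i; exact: (zx _ (ideal_gen_mem gen (inl (inr i)))).
have [N NP] := fin_all_exists one.
exists (\sum_k (N k) + 1)%N => m le_m.
have [k le_k] : exists k, (N k <= m k)%N.
  apply/existsP; apply/contraT; rewrite negb_exists => /forallP lt.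
  move: le_m; rewrite leqNgt => /negP; case.
  rewrite mdegE addn1 ltnS; apply: leq_sum => k _.
  by apply: ltnW; rewrite ltnNge.
have -> : 'X_[m] = 'X_[m - U_(k) *+ N k] * ('X_k ^+ N k) :> {mpoly F[v]}.
  rewrite mpolyXn -mpolyXD submK //; apply/mnm_lepP => i.
  by rewrite mulmnE mnm1E; case: eqP => [<-|]; rewrite ?mul1n ?mul0n.
by apply: (ideal_gen_ideal gen).2.
Qed.

Lemma high_monomials_homog N :
  (forall m : 'X_{1..v}, (N <= mdeg m)%N -> ideal_gen gen 'X_[m]) ->
  forall m : 'X_{1..v}, (N <= mdeg m)%N ->
  exists2 h, (forall u, msize (h u) <= (mdeg m).+1 - gdeg u)%N &
             'X_[m] = \sum_u h u * gen u.
Proof.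
move=> NP m /NP [h hE].
exists (fun u => if (gdeg u <= mdeg m)%N then pihomog mdeg (mdeg m - gdeg u) (h u) else 0).
  move=> u; case: ifP => le_u; last by rewrite msize0.
  by apply: leq_trans (msize_homog (pihomogP _ _ _)) _; rewrite subSn.
have hX : ('X_[m] : {mpoly F[v]}) \is (mdeg m).-homog by rewrite dhomogX.
rewrite -[LHS](pihomog_dE hX) hE raddf_sum /=; apply: eq_bigr => u _.
rewrite (@pihomogM _ _ _ (gdeg u)); first by case: ifP; rewrite ?mul0r.
by case: u => [[j|i]|i] /=.
Qed.

Variable N : nat.
Hypothesis NP : forall m : 'X_{1..v}, (N <= mdeg m)%N -> ideal_gen gen 'X_[m].

Definition gmon (be : 'X_{1..r}) : {mpoly F[v]} := \prod_i g i ^+ be i.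

Definition term (t : F * 'X_{1..v} * 'X_{1..r}) : {mpoly F[v]} :=
  t.1.1 *: ('X_[t.1.2] * gmon t.2).

(** Modulo J and B, polynomials are spanned over F[g] by the monomials of degree below [N]. The
    counting needs bounds on the coefficients of the [B j] and on the exponents of [g], but none on
    the multiple of [J]. *)
Definition decomposed (M : nat) (q : {mpoly F[v]}) := exists P P' l,
  [/\ q = \sum_j P j * B j + P' * J + \sum_(t <- l) term t,
      (forall j, msize (P j) <= M.+1 - b)%N &
      all (fun t => (mdeg t.1.2 < N) && (mdeg t.2 <= M))%N l].

Lemma decomposed0 M : decomposed M 0.
Proof.
exists (fun=> 0), 0, [::]; split=> //; last by move=> j; rewrite msize0.
by rewrite big_nil mul0r !addr0 big1 // => j _; rewrite mul0r.
Qed.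

Lemma decomposedD M q1 q2 : decomposed M q1 -> decomposed M q2 -> decomposed M (q1 + q2).
Proof.
move=> [P1 [P1' [l1 [-> s1 a1]]]] [P2 [P2' [l2 [-> s2 a2]]]].
exists (fun j => P1 j + P2 j), (P1' + P2'), (l1 ++ l2); split.
- rewrite big_cat /= mulrDl.
  rewrite [\sum_j (P1 j + P2 j) * B j](eq_bigr (fun j => P1 j * B j + P2 j * B j)); last first.
    by move=> j _; rewrite mulrDl.
  by rewrite big_split /=; ring.
- by move=> j; rewrite msizeD_bound.
- by rewrite all_cat a1.
Qed.

Lemma decomposedZ M c q : decomposed M q -> decomposed M (c *: q).
Proof.
move=> [P [P' [l [-> s a]]]].
exists (fun j => c *: P j), (c *: P'), [seq (c * t.1.1, t.1.2, t.2) | t <- l]; split.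
- rewrite big_map !scalerDr !scaler_sumr scalerAl; congr (_ + _ + _).
    by apply: eq_bigr => j _; rewrite scalerAl.
  by apply: eq_bigr => t _; rewrite /term scalerA.
- by move=> j; rewrite msizeZ_bound.
- by rewrite all_map; apply: sub_all a.
Qed.

Lemma decomposed_sum M (I : Type) (s : seq I) (f : I -> {mpoly F[v]}) :
  (forall i, decomposed M (f i)) -> decomposed M (\sum_(i <- s) f i).
Proof.
move=> df; elim/big_rec: _ => [|i q _ dq]; first exact: decomposed0.
exact: decomposedD.
Qed.

Lemma decomposed_leq M M' q : (M <= M')%N -> decomposed M q -> decomposed M' q.
Proof.
move=> le_M [P [P' [l [qE s a]]]]; exists P, P', l; split=> //.
  by move=> j; rewrite (leq_trans (s j)) // leq_sub2r.
by apply: sub_all a => t /andP[-> /leq_trans ->].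
Qed.

Lemma decomposed_mulg M i q : decomposed M q -> decomposed (M + D) (q * g i).
Proof.
move=> [P [P' [l [-> s a]]]].
exists (fun j => P j * g i), (P' * g i), [seq (t.1, (t.2 + U_(i))%MM) | t <- l]; split.
- rewrite big_map !mulrDl !mulr_suml; congr (_ + _ + _); first last.
  + apply: eq_bigr => t _; rewrite /term /= -!scalerAl -mulrA; congr (_ *: (_ * _)).
    rewrite /gmon (bigD1 i) //= [RHS](bigD1 i) //= mnmDE mnm1E eqxx addn1 exprSr.
    rewrite mulrAC; congr (_ * _); apply: eq_bigr => k ne.
    by rewrite mnmDE mnm1E eq_sym (negbTE ne) addn0.
  + by rewrite mulrAC.
  + by apply: eq_bigr => j _; rewrite mulrAC.
- move=> j; have [->|nz] := eqVneq (P j) 0; first by rewrite mul0r msize0.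
  have := s j; rewrite (mpolySpred mdeg nz) => sPj.
  apply: leq_trans (@msizeM_bound _ _ _ _ (msize (P j)).-1 D _ (msize_homog (homg i))) _.
    by rewrite -(mpolySpred mdeg nz).
  by rewrite ltn_subRL addnA -[(M + D).+1]addSn ltn_add2r -ltn_subRL.
- rewrite all_map; apply: sub_all a => t /andP[/= -> /=].
  by rewrite mdegD mdeg1; lia.
Qed.

(** Induction on the degree: a monomial of degree at least [N] is a combination of the generators,
    and the coefficients of the forms [g i] have smaller degree because [D] is positive. *)
Lemma monomial_decomposed (m : 'X_{1..v}) : decomposed (mdeg m) 'X_[m].
Proof.
have [k] := ubnP (mdeg m); elim: k m => // k IHk m lt_mk.
have [le_N|lt_N] := leqP N (mdeg m); last first.
  exists (fun=> 0), 0, [:: (1, m, 0%MM)]; split.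
  - rewrite big_seq1 mul0r addr0 big1 ?add0r => [|j _]; last by rewrite mul0r.
    by rewrite /term scale1r /gmon big1 ?mulr1 // => i _; rewrite mnm0E expr0.
  - by move=> j; rewrite msize0.
  - by rewrite /= lt_N mdeg0.
have [h sh ->] := high_monomials_homog NP le_N.
rewrite !big_sumType /= big_ord1.
apply: decomposedD; last first.
  exists (fun=> 0), (h (inr ord0)), [::]; split=> //; last by move=> j; rewrite msize0.
  by rewrite big_nil addr0 big1 ?add0r // => j _; rewrite mul0r.
apply: decomposedD.
  exists (fun j => h (inl (inl j))), 0, [::]; split=> //.
  by rewrite big_nil mul0r !addr0.
apply: decomposed_sum => i.
have := sh (inl (inr i)) => /= si.
have [->|nz] := eqVneq (h (inl (inr i))) 0.
  by rewrite mul0r; exact: decomposed0.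
have leD : (D <= mdeg m)%N by move: si; rewrite (mpolySpred mdeg nz); lia.
apply: (@decomposed_leq (mdeg m - D + D)); first by rewrite subnK.
apply: decomposed_mulg; rewrite [h _]mpolyE.
rewrite big_seq; elim/big_rec: _ => [|m' q m'h dq]; first exact: decomposed0.
apply: decomposedD => //; apply: decomposedZ.
have lt_m' : (mdeg m' < msize (h (inl (inr i))))%N by exact: msize_mdeg_lt.
apply: (@decomposed_leq (mdeg m')); first by move: si; lia.
by apply: IHk; move: si; lia.
Qed.

End Decomposition.

Section BoundedPolynomials.
Variables (R : nzRingType) (n k : nat).
Local Notation dim := #|{: 'X_{1..n < k}}|.

Definition mpoly_rV (w : 'rV[R]_dim) : {mpoly R[n]} :=
  \sum_i w 0 i *: 'X_[enum_val i].

Lemma mcoeff_rV w (m : 'X_{1..n < k}) : (mpoly_rV w)@_m = w 0 (enum_rank m).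
Proof.
rewrite raddf_sum /= (bigD1 (enum_rank m)) //= mcoeffZ mcoeffX enum_rankK eqxx mulr1.
rewrite big1 ?addr0 // => i ne; rewrite mcoeffZ mcoeffX -bmeqP.
case: eqP => [im|]; last by rewrite mulr0.
by case/eqP: ne; rewrite -im enum_valK.
Qed.

Lemma mpoly_eq_bounded (p q : {mpoly R[n]}) : (msize p <= k)%N -> (msize q <= k)%N ->
  (forall m : 'X_{1..n < k}, p@_m = q@_m) -> p = q.
Proof.
move=> sp sq eq_pq; apply/mpolyP => m; have [lt|ge] := ltnP (mdeg m) k.
  exact: (eq_pq (BMultinom lt)).
by rewrite !(memN_msupp_eq0 (msize_mdeg_ge _)) // (leq_trans _ ge).
Qed.

Lemma mpoly_rV_onto (p : {mpoly R[n]}) : (msize p <= k)%N -> exists w, mpoly_rV w = p.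
Proof.
move=> sp; exists (\row_(i < dim) p@_(bmnm (enum_val i))).
rewrite [RHS](mpolywE sp) /mpoly_rV [RHS](reindex_onto enum_val enum_rank) /=.
  by apply: eq_big => [i|i _]; rewrite ?mxE // enum_valK eqxx.
by move=> m _; rewrite enum_rankK.
Qed.

Lemma mpoly_rV_eq0 w : mpoly_rV w = 0 -> w = 0.
Proof.
move=> w0; apply/rowP => i; rewrite mxE.
by have := mcoeff_rV w (enum_val i); rewrite w0 mcoeff0 enum_valK.
Qed.

End BoundedPolynomials.

Lemma msize_rV (R : idomainType) n k (w : 'rV[R]_#|{: 'X_{1..n < k}}|) :
  (msize (mpoly_rV w) <= k)%N.
Proof.
apply: msize_sum_bound => i _; apply: msizeZ_bound.
by rewrite msizeX bmdeg.
Qed.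

Lemma msize_homog_neq0 (R : nzRingType) n d (p : {mpoly R[n]}) :
  p != 0 -> p \is d.-homog -> msize p = d.+1.
Proof.
by move=> nz /dhomogP hp; rewrite -mlead_deg // hp // mlead_supp.
Qed.

(* The ideal [(J, B)] has height at least three, since adding the [r] forms [g]
   makes it primary to the origin in [r + 3] variables.  By the last hypothesis
   [(J, B) / (J)] is no larger than [(J, A) / (J)] shifted by [b - a > 0], so the
   Hilbert function of the quotient by [(J, B)] grows too fast for height three. *)
Theorem height_three_contradiction (F : closedFieldType) r (T : finType)
    (J : {mpoly F[r.+3]}) (B A : T -> {mpoly F[r.+3]}) (g : 'I_r -> {mpoly F[r.+3]})
    p b a D :
    J != 0 -> J \is p.-homog -> (0 < p)%N ->
    (forall j, B j \is b.-homog) -> (forall j, msize (A j) <= a.+1)%N -> (a < b)%N ->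
    (forall i, g i \is D.-homog) -> (0 < D)%N ->
    (forall x, J.@[x] = 0 -> (forall j, (B j).@[x] = 0) ->
       (forall i, (g i).@[x] = 0) -> forall k, x k = 0) ->
    (forall P : T -> {mpoly F[r.+3]}, rdvd J (\sum_j P j * A j) ->
       rdvd J (\sum_j P j * B j)) ->
  False.
Proof.
move=> nzJ homJ p0 homB sA ab homg D0 nz crit.
have [N NP] := high_monomials nz.
pose K := #|{: 'X_{1..r.+3 < N}}|; pose q := (b - a)%N.
(* Large enough for the growth estimate; the summand [b] keeps [t - b] positive. *)
pose t := (p + q + K * (r.+1)`! + b).+1.
pose KK : finType := ('X_{1..r.+3 < N} * 'X_{1..r < t})%type.
pose e (k : KK) : {mpoly F[r.+3]} := 'X_[k.1] * gmon g k.2.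
have collect (l : seq (F * 'X_{1..r.+3} * 'X_{1..r})) :
    all (fun u => (mdeg u.1.2 < N) && (mdeg u.2 <= t.-1))%N l ->
    exists ga : KK -> F, \sum_(u <- l) term g u = \sum_k ga k *: e k.
  elim: l => [|[[c al] be] l IHl] /=.
    by exists (fun=> 0); rewrite big_nil big1 // => k _; rewrite scale0r.
  case/andP=> /andP[lt_al le_be] /IHl [ga gaE].
  have lt_be : (mdeg be < t)%N by rewrite /t ltnS.
  pose k0 : KK := (BMultinom lt_al, BMultinom lt_be).
  exists (fun k => ga k + (k == k0)%:R * c); rewrite big_cons gaE addrC.
  under [RHS]eq_bigr do rewrite scalerDl; rewrite big_split /=; congr (_ + _).
  rewrite (bigD1 k0) //= eqxx mul1r big1 ?addr0 // => k /negbTE ->.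
  by rewrite mul0r scale0r.
have data (m : 'X_{1..r.+3 < t}) : exists d : (T -> {mpoly F[r.+3]}) * {mpoly F[r.+3]} * (KK -> F),
    'X_[m] = \sum_j d.1.1 j * B j + d.1.2 * J + \sum_k d.2 k *: e k /\
    forall j, (msize (d.1.1 j) <= t - b)%N.
  have : decomposed J B g b N t.-1 'X_[m].
    apply: decomposed_leq (monomial_decomposed homJ homB homg D0 NP m).
    by rewrite /t -ltnS bmdeg.
  case=> P [P' [l [mE sP al]]]; have [ga gaE] := collect l al.
  by exists (P, P', ga); rewrite /= mE gaE.
have [d dP] := fin_all_exists data.
(* The [B]-part of the decomposition of the monomial with [A] substituted for [B]: the degree bound
   falls by [q]. *)
pose Q (m : 'X_{1..r.+3 < t}) := \sum_j (d m).1.1 j * A j.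
have sQ m : (msize (Q m) <= t - q)%N.
  apply: msize_sum_bound => j _; have [->|nzP] := eqVneq ((d m).1.1 j) 0.
    by rewrite mul0r msize0.
  have /= sP := (dP m).2 j.
  have sP' : (msize ((d m).1.1 j) <= (t - b).-1.+1)%N by rewrite prednK // /t; lia.
  by apply: leq_trans (msizeM_bound sP' (sA j)) _; rewrite /q /t; lia.
pose Ga := \matrix_(i < #|{: 'X_{1..r.+3 < t}}|, k < #|KK|) (d (enum_val i)).2 (enum_val k).
pose Cf := \matrix_(i < #|{: 'X_{1..r.+3 < t}}|, j < #|{: 'X_{1..r.+3 < t - q}}|)
  (Q (enum_val i))@_(enum_val j).
pose Jm := \matrix_(i < #|{: 'X_{1..r.+3 < t - q - p}}|, j < #|{: 'X_{1..r.+3 < t - q}}|)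
  ('X_[enum_val i] * J)@_(enum_val j).
pose Bm := \matrix_(i < #|{: 'X_{1..r.+3 < t - p}}|, j < #|{: 'X_{1..r.+3 < t}}|)
  ('X_[enum_val i] * J)@_(enum_val j).
have sJ : msize J = p.+1 by exact: msize_homog_neq0.
have sumE k (w : 'rV[F]_#|{: 'X_{1..r.+3 < k}}|) : mpoly_rV w * J = \sum_i w 0 i *: ('X_[enum_val i] * J).
  by rewrite mulr_suml; apply: eq_bigr => i _; rewrite scalerAl.
(* A kernel vector is a polynomial [v1] of degree below [t] whose part in the monomials of [g]
   cancels and whose [A]-combination equals [v2] times [J]. The last hypothesis then makes [v1]
   itself a multiple of [J], hence a combination of the rows of [Bm]. *)
have /kernel_dimension_bound : forall (v1 : 'rV_ #|{: 'X_{1..r.+3 < t}}|) v2,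
    row_mx v1 v2 *m block_mx Ga Cf 0 (- Jm) = 0 ->
    (exists u, v1 = u *m Bm) /\ (v1 = 0 -> v2 = 0).
  move=> v1 v2; rewrite mul_row_block mulmx0 addr0 mulmxN -row_mx0 => /eq_row_mx [v1Ga].
  move/eqP; rewrite subr_eq0 => /eqP v1Cf.
  have QJ : \sum_i v1 0 i *: Q (enum_val i) = mpoly_rV v2 * J.
    apply: (@mpoly_eq_bounded _ _ (t - q)).
    - by apply: msize_sum_bound => i _; apply: msizeZ_bound.
    - have [->|nzv] := eqVneq (mpoly_rV v2) 0; first by rewrite mul0r msize0.
      rewrite msizeM // sJ; have := msize_rV v2.
      by move: (msize _) => u; rewrite /t /q; lia.
    move=> m; rewrite sumE !raddf_sum /=.
    have /rowP/(_ (enum_rank m)) := v1Cf; rewrite !mxE => E1.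
    transitivity (\sum_i v1 0 i * Cf i (enum_rank m)).
      by apply: eq_bigr => i _; rewrite mcoeffZ mxE enum_rankK.
    by rewrite E1; apply: eq_bigr => i _; rewrite mcoeffZ mxE enum_rankK.
  split; last first.
    move=> v10; move: QJ; rewrite big1 => [|i _]; last by rewrite v10 mxE scale0r.
    by move/esym/eqP; rewrite mulf_eq0 (negbTE nzJ) orbF => /eqP /mpoly_rV_eq0.
  pose Ph j := \sum_i v1 0 i *: (d (enum_val i)).1.1 j.
  have v1E : mpoly_rV v1 = \sum_j Ph j * B j + (\sum_i v1 0 i *: (d (enum_val i)).1.2) * J.
    rewrite /mpoly_rV (eq_bigr (fun i => v1 0 i *: (\sum_j (d (enum_val i)).1.1 j * B j) +
      v1 0 i *: ((d (enum_val i)).1.2 * J) +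
      v1 0 i *: (\sum_k (d (enum_val i)).2 k *: e k))); last first.
      by move=> i _; rewrite {1}(dP (enum_val i)).1 !scalerDr.
    rewrite !big_split /= [X in _ + _ + X](_ : _ = 0) ?addr0.
      congr (_ + _); last by rewrite mulr_suml; apply: eq_bigr => i _; rewrite scalerAl.
      under eq_bigr do rewrite scaler_sumr; rewrite exchange_big /=.
      by apply: eq_bigr => j _; rewrite mulr_suml; apply: eq_bigr => i _; rewrite scalerAl.
    under eq_bigr do rewrite scaler_sumr; rewrite exchange_big /= big1 // => k _.
    under eq_bigr do rewrite scalerA; rewrite -scaler_suml.
    have /rowP/(_ (enum_rank k)) := v1Ga; rewrite !mxE => E1.
    rewrite (_ : \sum_i _ = 0) ?scale0r // -[RHS]E1.
    by apply: eq_bigr => i _; rewrite mxE enum_rankK.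
  have [u uE] : rdvd J (mpoly_rV v1).
    rewrite v1E; apply: rdvdD; last by exists (\sum_i v1 0 i *: (d (enum_val i)).1.2).
    apply: crit; exists (mpoly_rV v2); rewrite -QJ.
    rewrite /Q; under [RHS]eq_bigr do rewrite scaler_sumr; rewrite exchange_big /=.
    by apply: eq_bigr => j _; rewrite mulr_suml; apply: eq_bigr => i _; rewrite scalerAl.
  have su : (msize u <= t - p)%N.
    have [->|nzu] := eqVneq u 0; first by rewrite msize0.
    have := msize_rV v1; rewrite uE msizeM // sJ.
    by move: (msize _) => w; lia.
  have [w wE] := mpoly_rV_onto su; exists w; apply/rowP => i.
  rewrite -[i in LHS]enum_valK -mcoeff_rV uE -wE sumE raddf_sum /= mxE.
  by apply: eq_bigr => j _; rewrite mcoeffZ mxE.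
have KKle : (#|KK| <= K * t ^ r)%N by rewrite card_prod leq_mul // card_bmultinom_le.
have q0 : (0 < q)%N by rewrite subn_gt0.
have ltt : (p + q + K * (r.+1)`! < t)%N by rewrite /t ltnS leq_addr.
have := growth_contradiction p0 q0 ltt; move: KKle; rewrite !card_bmultinom.
move: (K * t ^ r)%N #|KK| => u1 u2.
by move: 'C(_, _) 'C(_, _) 'C(_, _) 'C(_, _) => *; lia.
Qed.

(** * Jets of homogeneous maps *)

Section DirectionalDerivative.
Variables (F : fieldType) (n : nat).
Implicit Types (p q : {mpoly F[n]}) (a u x : 'I_n -> F).

Definition ddir u p : {mpoly F[n]} := \sum_j u j *: p^`M(j).

Lemma ddir_is_linear u : linear (ddir u).
Proof.
move=> c p q; rewrite /ddir scaler_sumr -big_split /=; apply: eq_bigr => j _.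
by rewrite linearP scalerDr !scalerA mulrC.
Qed.

HB.instance Definition _ u :=
  GRing.isLinear.Build F {mpoly F[n]} {mpoly F[n]} _ (ddir u) (ddir_is_linear u).

Lemma ddirM u p q : ddir u (p * q) = ddir u p * q + p * ddir u q.
Proof.
rewrite /ddir mulr_suml mulr_sumr -big_split /=; apply: eq_bigr => j _.
by rewrite mderivM scalerDr scalerAl scalerAr.
Qed.

Lemma ddir_eval u p x : (ddir u p).@[x] = \sum_j u j * p^`M(j).@[x].
Proof. by rewrite raddf_sum /=; apply: eq_bigr => j _; rewrite mevalZ. Qed.

Lemma mderiv_exp p j k : (p ^+ k.+1)^`M(j) = (k.+1)%:R *: (p ^+ k * p^`M(j)).
Proof.
elim: k => [|k IHk]; first by rewrite expr1 expr0 mul1r scale1r.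
rewrite exprS mderivM IHk -scalerAr mulrA -exprS [p^`M(j) * _]mulrC.
by rewrite -{1}[p ^+ k.+1 * _]scale1r -scalerDl nat1r.
Qed.

Lemma mderiv_homog p d j : p \is d.+1.-homog -> p^`M(j) \is d.-homog.
Proof.
move=> /dhomogP hp; apply/dhomogP => m; rewrite mcoeff_msupp mcoeff_deriv => nz.
have : (m + U_(j))%MM \in msupp p.
  by rewrite mcoeff_msupp; apply: contraNneq nz => ->; rewrite mul0rn.
by move/hp; rewrite /= mdegD mdeg1 addn1 => -[].
Qed.

Lemma euler p d x : p \is d.-homog -> \sum_j x j * p^`M(j).@[x] = d%:R * p.@[x].
Proof.
move=> /dhomogP hp.
have term_j j : x j * p^`M(j).@[x] = \sum_(m <- msupp p) (m j)%:R * (p@_m *: 'X_[m]).@[x].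
  rewrite /mderiv (raddf_sum (meval x)) /= mulr_sumr; apply: eq_bigr => m _.
  rewrite !mevalZ; have [->|nz] := eqVneq (m j) 0%N; first by rewrite !mul0r mulr0.
  have -> : 'X_[m] = 'X_j * 'X_[m - U_(j)] :> {mpoly F[n]}.
    by rewrite -mpolyXD addmC submK // lep1mP.
  by rewrite mevalM mevalXU; ring.
under eq_bigr do rewrite term_j; rewrite exchange_big /=.
rewrite [in RHS](mpolyE p) (raddf_sum (meval x)) /= mulr_sumr.
by apply: eq_big_seq => m /hp <-; rewrite -mulr_suml -natr_sum -mdegE.
Qed.

Definition dot a x := \sum_j a j * x j.

Definition linform a : {mpoly F[n]} := \sum_j a j *: 'X_j.

Lemma linform_homog a : linform a \is 1.-homog.
Proof. by apply: rpred_sum => j _; apply: rpredZ; rewrite dhomogX /= mdeg1. Qed.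

Lemma linform_eval a x : (linform a).@[x] = dot a x.
Proof. by rewrite raddf_sum /=; apply: eq_bigr => j _; rewrite mevalZ mevalXU. Qed.

Lemma linform_mderiv a k : (linform a)^`M(k) = (a k)%:MP.
Proof.
rewrite raddf_sum /= (bigD1 k) //= mderivZ mderivX mnm1E eqxx scale1r.
have -> : (U_(k) - U_(k))%MM = 0%MM :> 'X_{1..n} by apply/mnmP => i; rewrite mnmBE mnm0E subnn.
rewrite mpolyX0 big1 ?addr0; first by rewrite -mul_mpolyC mulr1.
by move=> j /negbTE ne; rewrite mderivZ mderivX mnm1E ne scale0r scaler0.
Qed.

Lemma linform_ddir u a : ddir u (linform a) = (dot a u)%:MP.
Proof.
rewrite /ddir /dot raddf_sum /=; apply: eq_bigr => j _.
by rewrite linform_mderiv -mul_mpolyC -mpolyCM mulrC.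
Qed.

End DirectionalDerivative.

Section SecondOrderJets.
Variables (F : fieldType) (n e : nat).
Hypothesis F0 : [pchar F] =i pred0.
Variables (x v w la mu : 'I_n -> F).
Hypotheses (lax : dot la x = 1) (lav : dot la v = 0).
Hypotheses (mux : dot mu x = 0) (muv : dot mu v = 1).

Let natF k : (k.+1)%:R != 0 :> F.
Proof. by have /pcharf0P -> := F0. Qed.

Lemma dotBl (a b y : 'I_n -> F) c : dot (fun j => a j - c * b j) y = dot a y - c * dot b y.
Proof.
rewrite /dot mulr_sumr -sumrB; apply: eq_bigr => j _; by rewrite mulrBl mulrA.
Qed.

(** The condition is Euler's relation for the derivative of h along v, a form of degree e + 1. The
    forms L and M of [la] and [mu] take the values 1, 0 at x and 0, 1 at v; in h = L^(e+1) a + L^e M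
    b the first term realises the gradient, and the second, invisible to first order at x, adjusts
    the second-order row. *)
Lemma scalar_jet (al ga : 'I_n -> F) : dot ga x = e.+1%:R * dot al v ->
  exists h : {mpoly F[n]}, [/\ h \is e.+2.-homog,
    forall k, h^`M(k).@[x] = al k, (ddir v h).@[x] = dot al v &
    forall k, (ddir v h)^`M(k).@[x] = ga k].
Proof.
(* The multiple of [la] in [a] offsets the derivative of L^(e+1), and the one in [ga'] does so for
   the v-derivative. The half in [b] appears because M b is differentiated through either factor,
   which gives b + (b . v) mu. *)
move=> gax.
pose a k := al k - (e.+1%:R / e.+2%:R * dot al x) * la k.
pose ga' k := ga k - (e.+1%:R * dot al v) * la k.
pose b k := ga' k - (dot ga' v / 2%:R) * mu k.
have ax : dot a x = dot al x / e.+2%:R.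
  rewrite dotBl lax mulr1; have := natF e.+1.
  have -> : e.+2%:R = e.+1%:R + 1 :> F by rewrite natr1.
  by move: e.+1%:R => E nz; field.
have av : dot a v = dot al v by rewrite dotBl lav mulr0 subr0.
have ga'x : dot ga' x = 0 by rewrite dotBl lax mulr1 gax subrr.
have bx : dot b x = 0 by rewrite dotBl mux mulr0 subr0.
have bv : dot b v = dot ga' v / 2%:R.
  by rewrite dotBl muv mulr1; have := natF 1 => nz; field.
pose L := linform la; pose M := linform mu.
have DL : ddir v L = 0 by rewrite linform_ddir lav mpolyC0.
have DLk k : ddir v (L ^+ k) = 0.
  elim: k => [|k IHk]; last by rewrite exprS ddirM DL IHk mul0r mulr0 addr0.
  rewrite expr0 /ddir big1 // => j _; by rewrite -mpolyC1 mderivC scaler0.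
pose h := L ^+ e.+1 * linform a + L ^+ e * M * linform b.
have Dh : ddir v h = L ^+ e.+1 * (dot al v)%:MP + L ^+ e * linform b + L ^+ e * M * (dot b v)%:MP.
  rewrite /h linearD /= !ddirM !DLk !linform_ddir av muv mpolyC1.
  by rewrite !mul0r !add0r mulr1 addrA.
have Lx k : (L ^+ k).@[x] = 1 by rewrite rmorphXn /= linform_eval lax expr1n.
have Mx : M.@[x] = 0 by rewrite linform_eval.
have LSk k j : (L ^+ k.+1)^`M(j).@[x] = k.+1%:R * la j.
  by rewrite mderiv_exp mevalZ mevalM Lx mul1r linform_mderiv mevalC.
have gradh k : h^`M(k).@[x] = al k.
  rewrite /h mderivD mevalD !mderivM !mevalD !mevalM Lx Mx LSk !linform_mderiv !mevalC.
  rewrite !linform_eval bx ax /a !(mulr0, mul1r, addr0, add0r).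
  have := natF e.+1; move: (e.+2%:R) (e.+1%:R) => E1 E2 nz.
  by field.
exists h; split=> //.
- have hL k : L ^+ k \is k.-homog by rewrite -[X in X.-homog]mul1n dhomogMn // linform_homog.
  apply: rpredD.
    by rewrite -[e.+2]addn1 dhomogM // linform_homog.
  by rewrite -[e.+2]addn1 dhomogM ?linform_homog // -[e.+1]addn1 dhomogM ?linform_homog.
- by rewrite ddir_eval; apply: eq_bigr => j _; rewrite gradh mulrC.
move=> k; rewrite Dh !mderivD !mevalD !mderivM !mevalD !mevalM LSk !Lx Mx !linform_mderiv.
rewrite !mderivC !meval0 !mevalC !linform_eval bx bv /b /ga' !(mulr0, mul1r, addr0, add0r).
rewrite mevalD !mevalM Mx Lx mulr0 add0r mevalC mul1r -/ga'.
by move: (dot _ v / 2%:R) => u; ring.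
Qed.

(* Every jet compatible with [w M v = al v = w be] and with Euler's relation
   along [x] is realised: [h] carries the [w]-component, and the remaining
   freedom sits in [la ^ (e+1) mu]. *)
Lemma vector_jet i0 (al be ga : 'I_n -> F) : w i0 != 0 ->
    dot ga x = e.+1%:R * dot al v -> dot w be = dot al v ->
  exists f : 'I_n -> {mpoly F[n]}, [/\ forall i, f i \is e.+2.-homog,
    forall k, \sum_i w i * (f i)^`M(k).@[x] = al k,
    forall i, (ddir v (f i)).@[x] = be i &
    forall k, \sum_i w i * (ddir v (f i))^`M(k).@[x] = ga k].
Proof.
move=> nzw gax wbe; have [h [homh hx hv hvv]] := scalar_jet gax.
pose om i := (i == i0)%:R / w i0.
have wom : dot w om = 1.
  rewrite /dot (bigD1 i0) //= /om eqxx mul1r mulfV // big1 ?addr0 // => i /negbTE ->.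
  by rewrite mul0r mulr0.
pose be' i := be i - dot al v * om i.
have wbe' : \sum_i w i * be' i = 0.
  rewrite /be'; under eq_bigr do rewrite mulrBr mulrCA.
  by rewrite sumrB -mulr_sumr -/(dot w om) -/(dot w be) wom wbe mulr1 subrr.
pose k0 := linform la ^+ e.+1 * linform mu.
have comb (phi : {mpoly F[n]} -> F) (philin : forall c c' p q,
    phi (c *: p + c' *: q) = c * phi p + c' * phi q) :
    \sum_i w i * phi (om i *: h + be' i *: k0) = phi h.
  transitivity (dot w om * phi h + (\sum_i w i * be' i) * phi k0).
    rewrite !mulr_suml -big_split /=; apply: eq_bigr => i _.
    by rewrite philin mulrDr !mulrA.
  by rewrite wom wbe' mul1r mul0r addr0.
exists (fun i => om i *: h + be' i *: k0); split.
- move=> i; apply: rpredD; apply: rpredZ => //.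
  rewrite -[e.+2]addn1 dhomogM ?linform_homog //.
  by rewrite -[X in X.-homog]mul1n dhomogMn // linform_homog.
- move=> k; rewrite (comb (fun p => p^`M(k).@[x])) // => c c' p q.
  by rewrite linearP /= linearZ /= mevalD !mevalZ.
- move=> i; rewrite linearP /= linearZ /= mevalD !mevalZ hv.
  rewrite /k0 ddirM linform_ddir muv mpolyC1 mulr1 mevalD mevalM.
  rewrite linform_eval mux mulr0 add0r rmorphXn /= linform_eval lax expr1n mulr1.
  by rewrite /be'; ring.
- move=> k; rewrite (comb (fun p => (ddir v p)^`M(k).@[x])) // => c c' p q.
  by rewrite linearP /= linearZ /= mderivD !mderivZ mevalD !mevalZ.
Qed.

End SecondOrderJets.

Lemma dual_pair (F : fieldType) n (x v : 'I_n -> F) p s : x p * v s != x s * v p ->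
  exists la mu, [/\ dot la x = 1, dot la v = 0, dot mu x = 0 & dot mu v = 1].
Proof.
rewrite -subr_eq0; set D := _ - _ => nzD.
have ne_ps : p != s by apply: contraNneq nzD => ps; rewrite /D ps subrr.
have dot2 (a b : F) (y : 'I_n -> F) :
    dot (fun j => if j == p then a else if j == s then b else 0) y = a * y p + b * y s.
  have sp : (s == p) = false by rewrite eq_sym; apply/negbTE.
  rewrite /dot (bigD1 p) //= (bigD1 s) /=; last by rewrite sp.
  rewrite !eqxx sp addrA.
  rewrite big1 ?addr0 // => j /andP[/negbTE -> /negbTE ->].
  by rewrite mul0r.
exists (fun j => if j == p then v s / D else if j == s then - v p / D else 0).
exists (fun j => if j == p then - x s / D else if j == s then x p / D else 0).
by rewrite !dot2; split; rewrite /D; field; rewrite -?/D.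
Qed.

(** * Generic maps *)

Section JoinThree.
Variables (T : Type) (n : nat).

Definition join3 (x w v : 'I_n -> T) (i : 'I_(n + n + n)) : T :=
  match split i with
  | inl i1 => match split i1 with inl j => x j | inr j => w j end
  | inr j => v j
  end.

Definition ix1 (j : 'I_n) : 'I_(n + n + n) := lshift n (lshift n j).
Definition ix2 (j : 'I_n) : 'I_(n + n + n) := lshift n (rshift n j).
Definition ix3 (j : 'I_n) : 'I_(n + n + n) := rshift (n + n) j.

Lemma join3_1 x w v j : join3 x w v (ix1 j) = x j.
Proof.
rewrite /join3 /ix1 (unsplitK (inl (lshift n j) : 'I_(n + n) + 'I_n)).
by rewrite (unsplitK (inl j : 'I_n + 'I_n)).
Qed.

Lemma join3_2 x w v j : join3 x w v (ix2 j) = w j.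
Proof.
rewrite /join3 /ix2 (unsplitK (inl (rshift n j) : 'I_(n + n) + 'I_n)).
by rewrite (unsplitK (inr j : 'I_n + 'I_n)).
Qed.

Lemma join3_3 x w v j : join3 x w v (ix3 j) = v j.
Proof. by rewrite /join3 /ix3 (unsplitK (inr j : 'I_(n + n) + 'I_n)). Qed.

Lemma ix_cases (Q : 'I_(n + n + n) -> Prop) :
  (forall j, Q (ix1 j)) -> (forall j, Q (ix2 j)) -> (forall j, Q (ix3 j)) -> forall i, Q i.
Proof.
move=> Q1 Q2 Q3 i; rewrite -(splitK i); case: (split i) => [i1|j] /=; last exact: Q3.
by rewrite -(splitK i1); case: (split i1) => j /=; [exact: Q1 | exact: Q2].
Qed.

End JoinThree.

Lemma card_join3 (T : eqType) n (a : T) (x w v : 'I_n -> T) :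
  #|[pred i | join3 x w v i == a]| =
  (#|[pred j | x j == a]| + #|[pred j | w j == a]| + #|[pred j | v j == a]|)%N.
Proof.
rewrite -!sum1_card !big_mkcond !big_split_ord /=.
congr (_ + _ + _)%N; rewrite [RHS]big_mkcond; apply: eq_bigr => j _; rewrite !inE.
- by rewrite -[lshift _ _]/(ix1 j) join3_1.
- by rewrite -[lshift _ _]/(ix2 j) join3_2.
- by rewrite -[rshift _ _]/(ix3 j) join3_3.
Qed.

(** A representative of a projective point of the coordinate subspace cut out by [Z]. The coordinate
    equal to 1 takes the scaling out of the parameter count. *)
Definition normalized (F : fieldType) n (Z : pred 'I_n) (y : 'I_n -> F) :=
  (forall j, Z j -> y j = 0) /\ exists p, y p = 1.

Definition norm_pattern (F : fieldType) n (Z : pred 'I_n) p (j : 'I_n) : option F :=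
  if j == p then Some 1 else if Z j then Some 0 else None.

Lemma card_norm_pattern (F : fieldType) n (Z : pred 'I_n) p : ~~ Z p ->
  #|[pred j | norm_pattern F Z p j == None]| = #|predC Z|.-1.
Proof.
move=> nZp; rewrite [in RHS](cardD1 p) inE /= nZp add1n /=.
apply: eq_card => j; rewrite !inE /norm_pattern.
by case: (j == p) => //=; case: (Z j).
Qed.

Section GenericFamily.
Variables (F : closedFieldType) (n P R : nat).
Variable E : 'M[{mpoly F[n + n + n]}]_(P, R).
Variables Zx Zw Zv : pred 'I_n.

(** Each choice of the three coordinates equal to 1 freezes one entry per vector and yields a
    relation; their product serves all choices. *)
Lemma generic_family s : (#|predC Zx|.-1 + #|predC Zw|.-1 + #|predC Zv|.-1 < s)%N ->
  exists G : {mpoly F[P]}, [/\ G != 0, exists e, G \is e.-homog &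
    forall (c : 'rV[F]_P) x w v, normalized Zx x -> normalized Zw w -> normalized Zv v ->
      (s <= \rank (map_mx (meval (join3 x w v)) E))%N ->
      c *m map_mx (meval (join3 x w v)) E = 0 -> G.@[c 0] = 0].
Proof.
move=> lt_s.
have one (t : 'I_n * 'I_n * 'I_n) : exists G : {mpoly F[P]},
    [/\ G != 0, exists e, G \is e.-homog &
    forall (c : 'rV[F]_P) x w v, normalized Zx x -> normalized Zw w -> normalized Zv v ->
      x t.1.1 = 1 -> w t.1.2 = 1 -> v t.2 = 1 ->
      (s <= \rank (map_mx (meval (join3 x w v)) E))%N ->
      c *m map_mx (meval (join3 x w v)) E = 0 -> G.@[c 0] = 0].
  case: t => [[p i0] j0] /=.
  have nz1 (Z : pred 'I_n) (y : 'I_n -> F) k : normalized Z y -> y k = 1 -> ~~ Z k.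
    move=> [yZ _] yk; apply/negP => /yZ; rewrite yk => /eqP.
    by rewrite oner_eq0.
  have [/and3P[Zp Zi Zj]|nZ] := boolP [&& ~~ Zx p, ~~ Zw i0 & ~~ Zv j0]; last first.
    exists 1; split; rewrite ?oner_neq0 //; first by exists 0%N; exact: dhomog1.
    move=> c x w v nx nw nv xp wi vj; move: nZ.
    by rewrite (nz1 _ _ _ nx xp) (nz1 _ _ _ nw wi) (nz1 _ _ _ nv vj).
  pose pat := join3 (norm_pattern F Zx p) (norm_pattern F Zw i0) (norm_pattern F Zv j0).
  have [|G [nzG homG GP]] := @non_dense _ _ _ _ pat E s.
    by rewrite card_join3 !card_norm_pattern.
  exists G; split=> // c x w v nx nw nv xp wi vj rk cE; apply: GP rk cE.
  have fit (Z : pred 'I_n) (y : 'I_n -> F) k j a : normalized Z y -> y k = 1 ->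
      norm_pattern F Z k j = Some a -> y j = a.
    move=> [yZ _] yk; rewrite /norm_pattern; case: eqP => [->|_]; first by case=> <-.
    by case: (boolP (Z j)) => // /yZ -> [].
  by apply: ix_cases => j a; rewrite /pat ?join3_1 ?join3_2 ?join3_3; apply: fit.
have [H HP] := fin_all_exists one.
exists (\prod_t H t); split.
- by apply/prodf_neq0 => t _; have [] := HP t.
- elim/big_rec: _ => [|t p _ [e he]]; first by exists 0%N; exact: dhomog1.
  by have [_ [e' he'] _] := HP t; exists (e' + e)%N; exact: dhomogM.
move=> c x w v nx nw nv rk cE.
have [[_ [p xp]] [_ [i0 wi]] [_ [j0 vj]]] := And3 nx nw nv.
have [_ _ Ht] := HP (p, i0, j0).
by rewrite (bigD1 (p, i0, j0)) //= mevalM (Ht c x w v) ?mul0r.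
Qed.

End GenericFamily.

(** The columns of [C] list the linear relations obeyed by the conditions; if every vector
    satisfying them is attained, the rank loses at most [q]. *)
Lemma rank_lower_bound (F : fieldType) m R q (E : 'M[F]_(m, R)) (C : 'M[F]_(R, q)) :
  (forall y : 'rV_R, y *m C = 0 -> exists c, y = c *m E) -> (R - q <= \rank E)%N.
Proof.
move=> H; have : (kermx C <= E)%MS.
  apply/row_subP => i; have /sub_kermxP/H [c ->] : (row i (kermx C) <= kermx C)%MS by rewrite row_sub.
  exact: submxMl.
move/mxrankS; apply: leq_trans; rewrite mxrank_ker leq_sub2l //.
exact: rank_leq_col.
Qed.

(** * Jets as linear functions of the coefficient vector *)

Section ParameterSpace.
Variables (F : closedFieldType) (n d : nat).
Local Notation P := (param_dim n d).
Local Notation k := (n.+1 + n.+1 + n.+1)%N.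
Implicit Types (c : 'I_P -> F) (x w v : 'I_n.+1 -> F).

Definition comp_of (l : 'I_P) : 'I_n.+1 := (enum_val (l : 'I_#|coeff_index n d|)).1.
Definition mon_of (l : 'I_P) : {mpoly F[n.+1]} :=
  'X_[bmnm (val (enum_val (l : 'I_#|coeff_index n d|)).2)].

Lemma poly_map_homog c i : poly_map c i \is d.-homog.
Proof.
apply: rpred_sum => m _; apply: rpredZ; rewrite dhomogX /=; exact: (valP m).
Qed.

Lemma poly_map_onto (f : 'I_n.+1 -> {mpoly F[n.+1]}) : (forall i, f i \is d.-homog) ->
  exists c, forall i, poly_map c i = f i.
Proof.
move=> homf; pose c (l : 'I_P) :=
  (f (comp_of l))@_(bmnm (val (enum_val (l : 'I_#|coeff_index n d|)).2)).
exists c => i; have sf : (msize (f i) <= d.+1)%N by exact: msize_homog.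
rewrite [RHS](mpolywE sf) /poly_map /c /comp_of.
under eq_bigr do rewrite enum_rankK /=.
rewrite [RHS](bigID (fun m : 'X_{1..n.+1 < d.+1} => mdeg m == d)) /= [X in _ = _ + X]big1 ?addr0.
  rewrite [RHS](reindex_omap (val : deg_monom n d -> _) insub) => [|m dm]; last first.
    by rewrite insubT.
  by apply: eq_bigl => m; rewrite valK eqxx andbT (valP m).
by move=> m nd; rewrite (dhomog_nemf_coeff (homf i) nd) scale0r.
Qed.

Lemma param_sum c (h : 'I_n.+1 -> F) (phi : {mpoly F[n.+1]} -> F) :
    (forall a p q, phi (a *: p + q) = a * phi p + phi q) ->
  \sum_l c l * (h (comp_of l) * phi (mon_of l)) = \sum_i h i * phi (poly_map c i).
Proof.
move=> lin; have phi0 : phi 0 = 0.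
  by have := lin (-1) 0 0; rewrite scaler0 addr0 mulN1r addNr.
have phiS (I : Type) (r : seq I) (a : I -> F) f :
    phi (\sum_(i <- r) a i *: f i) = \sum_(i <- r) a i * phi (f i).
  by elim/big_rec2: _ => // i u q _ <-; rewrite lin.
rewrite (reindex (fun t : coeff_index n d => enum_rank t : 'I_P)) /=; last first.
  by exists (fun l : 'I_P => enum_val (l : 'I_#|coeff_index n d|)) => [t|l] _; rewrite ?enum_rankK ?enum_valK.
rewrite [RHS](eq_bigr (fun i => \sum_(m : deg_monom n d)
   h i * (c (enum_rank ((i, m) : coeff_index n d)) * phi 'X_[bmnm (val m)]))); last first.
  by move=> i _; rewrite phiS mulr_sumr.
rewrite pair_big /=; apply: eq_bigr => -[i m] _.
by rewrite /comp_of /mon_of enum_rankK /= mulrCA.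
Qed.

Local Notation xt := [tuple ('X_(ix1 j) : {mpoly F[k]}) | j < n.+1].
Local Notation W i := ('X_(ix2 i) : {mpoly F[k]}).
Local Notation V j := ('X_(ix3 j) : {mpoly F[k]}).

(** The 3(n + 1) variables hold x, w and v. A coefficient vector times this matrix is f(x); with the
    next four matrices it is w Df, Df v, the row of second derivatives w D²f(v, -), and the number w
    D²f(v, v), all at x. *)
Definition jet_value : 'M[{mpoly F[k]}]_(P, n.+1) :=
  \matrix_(l, i) ((comp_of l == i)%:R * (mon_of l \mPo xt)).
Definition jet_row : 'M[{mpoly F[k]}]_(P, n.+1) :=
  \matrix_(l, j) (W (comp_of l) * ((mon_of l)^`M(j) \mPo xt)).
Definition jet_col : 'M[{mpoly F[k]}]_(P, n.+1) :=
  \matrix_(l, i) ((comp_of l == i)%:R * \sum_j V j * ((mon_of l)^`M(j) \mPo xt)).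
Definition jet_second : 'M[{mpoly F[k]}]_(P, n.+1) :=
  \matrix_(l, s) (W (comp_of l) * \sum_j V j * ((mon_of l)^`M(j)^`M(s) \mPo xt)).
Definition jet_cusp : 'M[{mpoly F[k]}]_(P, 1) :=
  \matrix_(l, _) (W (comp_of l) *
     \sum_s V s * \sum_j V j * ((mon_of l)^`M(j)^`M(s) \mPo xt)).

Section Evaluate.
Variables (c : 'I_P -> F) (x w v : 'I_n.+1 -> F).
Local Notation z := (join3 x w v).
Local Notation cr := (\row_l c l).

Lemma eval_xt p : (p \mPo xt).@[z] = p.@[x].
Proof.
rewrite comp_mpoly_meval; apply: meval_eq => j.
by rewrite tnth_mktuple mevalXU join3_1.
Qed.

Lemma ddir_mderiv (u : 'I_n.+1 -> F) (p : {mpoly F[n.+1]}) s :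
  (ddir u p)^`M(s) = \sum_j u j *: p^`M(j)^`M(s).
Proof. by rewrite raddf_sum /=; apply: eq_bigr => j _; rewrite mderivZ. Qed.

Lemma jet_valueE i : (cr *m map_mx (meval z) jet_value) 0 i = (poly_map c i).@[x].
Proof.
have lin a p q : (a *: p + q).@[x] = a * p.@[x] + q.@[x] by rewrite mevalD mevalZ.
have := param_sum c (fun i' => (i' == i)%:R) lin; rewrite (bigD1 i) //= eqxx mul1r.
rewrite [X in _ = _ + X]big1 ?addr0 => [|i' /negbTE ->]; last by rewrite mul0r.
move=> <-; rewrite mxE; apply: eq_bigr => l _; rewrite !mxE mevalM eval_xt.
by rewrite -mpolyC_nat mevalC.
Qed.

Lemma jet_rowE j :
  (cr *m map_mx (meval z) jet_row) 0 j = \sum_i w i * (poly_map c i)^`M(j).@[x].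
Proof.
rewrite -(param_sum c w (phi := fun p => p^`M(j).@[x])) => [|a p q]; last first.
  by rewrite mderivD mderivZ mevalD mevalZ.
rewrite mxE; apply: eq_bigr => l _; rewrite !mxE mevalM eval_xt.
by rewrite mevalXU join3_2.
Qed.

Lemma jet_colE i :
  (cr *m map_mx (meval z) jet_col) 0 i = (ddir v (poly_map c i)).@[x].
Proof.
have lin a p q : (ddir v (a *: p + q)).@[x] = a * (ddir v p).@[x] + (ddir v q).@[x].
  by rewrite linearP mevalD mevalZ.
have := param_sum c (fun i' => (i' == i)%:R) lin; rewrite (bigD1 i) //= eqxx mul1r.
rewrite [X in _ = _ + X]big1 ?addr0 => [|i' /negbTE ->]; last by rewrite mul0r.
move=> <-; rewrite mxE; apply: eq_bigr => l _; rewrite !mxE mevalM -mpolyC_nat mevalC.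
congr (_ * (_ * _)); rewrite raddf_sum /= ddir_eval; apply: eq_bigr => j _.
by rewrite mevalM eval_xt mevalXU join3_3.
Qed.

Lemma jet_secondE s : (cr *m map_mx (meval z) jet_second) 0 s =
  \sum_i w i * (ddir v (poly_map c i))^`M(s).@[x].
Proof.
rewrite -(param_sum c w (phi := fun p => (ddir v p)^`M(s).@[x])) => [|a p q]; last first.
  by rewrite linearP mderivD mderivZ mevalD mevalZ.
rewrite mxE; apply: eq_bigr => l _; rewrite !mxE mevalM mevalXU join3_2.
congr (_ * (_ * _)); rewrite ddir_mderiv !raddf_sum /=; apply: eq_bigr => j _.
by rewrite mevalM eval_xt mevalXU join3_3 mevalZ.
Qed.

Lemma jet_cuspE : (cr *m map_mx (meval z) jet_cusp) 0 0 =
  \sum_i w i * (ddir v (ddir v (poly_map c i))).@[x].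
Proof.
rewrite -(param_sum c w (phi := fun p => (ddir v (ddir v p)).@[x])) => [|a p q]; last first.
  by rewrite !ddir_is_linear mevalD mevalZ.
rewrite mxE; apply: eq_bigr => l _; rewrite !mxE mevalM mevalXU join3_2.
congr (_ * (_ * _)); rewrite ddir_eval raddf_sum /=; apply: eq_bigr => s _.
rewrite mevalM mevalXU join3_3 ddir_mderiv !raddf_sum /=; congr (_ * _).
by apply: eq_bigr => j _; rewrite mevalM eval_xt mevalXU join3_3 mevalZ.
Qed.

End Evaluate.
End ParameterSpace.

Section GenericMaps.
Variables (F : closedFieldType) (n e : nat).
Hypothesis F0 : [pchar F] =i pred0.
Hypothesis n_gt1 : (1 < n)%N.
Local Notation d := e.+2.
Local Notation P := (param_dim n d).
Implicit Types (c : 'I_P -> F) (x w v : 'I_n.+1 -> F).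

Definition indep x v := exists p s, x p * v s != x s * v p.

Definition nonzero_homog (G : {mpoly F[P]}) := G != 0 /\ exists m, G \is m.-homog.

Lemma jets_onto x w v (al be ga : 'I_n.+1 -> F) i0 : indep x v -> w i0 != 0 ->
    dot ga x = e.+1%:R * dot al v -> dot w be = dot al v ->
  exists c, [/\ forall j, \sum_i w i * (poly_map c i)^`M(j).@[x] = al j,
    forall i, (ddir v (poly_map c i)).@[x] = be i &
    forall j, \sum_i w i * (ddir v (poly_map c i))^`M(j).@[x] = ga j].
Proof.
move=> [p [s nzD]] nzw gax wbe.
have [la [mu [lax lav mux muv]]] := dual_pair nzD.
have [f [homf f1 f2 f3]] := vector_jet F0 lax lav mux muv nzw gax wbe.
have [c cE] := poly_map_onto homf; exists c; split=> i; rewrite -?f1 -?f2 -?f3 ?cE //;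
  by apply: eq_bigr => j _; rewrite cE.
Qed.

Lemma normalized_neq0 (Z : pred 'I_n.+1) (y : 'I_n.+1 -> F) :
  normalized Z y -> exists i, y i != 0.
Proof. by move=> [_ [i yi]]; exists i; rewrite yi oner_neq0. Qed.

Lemma generic_morphism : exists2 G : {mpoly F[P]}, nonzero_homog G &
  forall c x, normalized pred0 x -> (forall i, (poly_map c i).@[x] = 0) -> G.@[c] = 0.
Proof.
(* Only x varies: w and v are frozen at the point [o], so n parameters face the n + 1 values
   f(x). *)
pose o (j : 'I_n.+1) : F := (j == ord0)%:R; pose Zo := predC (pred1 (ord0 : 'I_n.+1)).
have no : normalized Zo o.
  split=> [j|]; first by rewrite /Zo /o inE /= => /negbTE ->.
  by exists ord0; rewrite /o eqxx.
have [|G [nzG homG GP]] := @generic_family _ _ _ _ (jet_value F n d) pred0 Zo Zo n.+1.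
  have -> : #|predC Zo| = 1%N.
    by rewrite (eq_card (B := pred1 (ord0 : 'I_n.+1))) ?card1 // => j; rewrite !inE negbK.
  by rewrite (eq_card (B := 'I_n.+1)) ?card_ord //= !addn0.
exists G => // c x nx fx; have {}GP := GP (\row_l c l) x o o nx no no.
rewrite (meval_eq (v2 := (\row_l c l) 0)) => [|l]; last by rewrite mxE.
apply: GP; last by apply/rowP => i; rewrite jet_valueE fx mxE.
have := @rank_lower_bound F P n.+1 0 (map_mx (meval (join3 x o o)) (jet_value F n d)) 0.
rewrite subn0; apply => y _.
have [_ [p xp]] := nx.
have [c' c'E] : exists c', forall i, poly_map c' i = (y 0 i *: 'X_p ^+ d : {mpoly F[n.+1]}).
  apply: poly_map_onto => i; apply: rpredZ; rewrite mpolyXn dhomogX /=.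
  by rewrite mdegMn mdeg1 mul1n.
exists (\row_l c' l); apply/rowP => i.
by rewrite jet_valueE c'E mevalZ rmorphXn /= mevalXU xp expr1n mulr1.
Qed.

Lemma dotC (a b : 'I_n.+1 -> F) : dot a b = dot b a.
Proof. by apply: eq_bigr => j _; rewrite mulrC. Qed.

Lemma sum_ix3 (f : 'I_(n.+1 + n.+1 + n.+1) -> F) :
  \sum_i f i = \sum_j f (ix1 j) + \sum_j f (ix2 j) + \sum_j f (ix3 j).
Proof. by rewrite !big_split_ord. Qed.

Definition plane_zero (k : nat) : pred 'I_n.+1 := fun j => (k <= j)%N.

Lemma card_plane k : (k <= n.+1)%N -> #|predC (plane_zero k)| = k.
Proof.
move=> le_k; rewrite -sum1_card -[RHS]card_ord -sum1_card.
rewrite (reindex_omap (widen_ord le_k) (fun j : 'I_n.+1 => insub (val j))) /= => [|j]; last first.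
  rewrite inE /plane_zero -ltnNge => lt_jk; rewrite (insubT (fun j => j < k)%N lt_jk) /=.
  by congr Some; apply: val_inj.
apply: eq_bigl => j; rewrite !inE /plane_zero /= -ltnNge ltn_ord /=.
by rewrite (insubT (fun j => j < k)%N (ltn_ord j)); apply/eqP; congr Some; apply: val_inj.
Qed.

Lemma card_pred0C : #|predC (pred0 : pred 'I_n.+1)| = n.+1.
Proof. by rewrite (eq_card (B := 'I_n.+1)) ?card_ord. Qed.

(* Singular points of the critical locus where the Jacobian has corank one. *)
Lemma generic_smooth : exists2 G : {mpoly F[P]}, nonzero_homog G &
  forall c x w v, normalized (plane_zero 3) x -> normalized pred0 w -> normalized pred0 v ->
    indep x v -> (forall j, \sum_i w i * (poly_map c i)^`M(j).@[x] = 0) ->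
    (forall i, (ddir v (poly_map c i)).@[x] = 0) ->
    (forall j, \sum_i w i * (ddir v (poly_map c i))^`M(j).@[x] = 0) -> G.@[c] = 0.
Proof.
pose E := row_mx (row_mx (jet_row F n d) (jet_col F n d)) (jet_second F n d).
have [|G [nzG homG GP]] := @generic_family _ _ _ _ E (plane_zero 3) pred0 pred0
    (n.+1 + n.+1 + n.+1 - 2).
  rewrite card_plane ?card_pred0C //= ; move: n_gt1; lia.
have EE c x w v (z := join3 x w v) : let y := \row_l c l *m map_mx (meval z) E in
    [/\ forall j, y 0 (ix1 j) = \sum_i w i * (poly_map c i)^`M(j).@[x],
     forall i, y 0 (ix2 i) = (ddir v (poly_map c i)).@[x] &
     forall j, y 0 (ix3 j) = \sum_i w i * (ddir v (poly_map c i))^`M(j).@[x]].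
  rewrite /E !map_row_mx !mul_mx_row /=; split=> j.
  - by rewrite /ix1 !row_mxEl jet_rowE.
  - by rewrite /ix2 row_mxEl row_mxEr jet_colE.
  - by rewrite /ix3 row_mxEr jet_secondE.
exists G => // c x w v nx nw nv ind c1 c2 c3.
rewrite (meval_eq (v2 := (\row_l c l) 0)) => [|l]; last by rewrite mxE.
have {}GP := GP (\row_l c l) x w v nx nw nv; apply: GP; last first.
  have [e1 e2 e3] := EE c x w v; apply/rowP; apply: ix_cases => j; rewrite [RHS]mxE.
  - by rewrite e1 c1.
  - by rewrite e2 c2.
  - by rewrite e3 c3.
(* The two relations among the conditions: (w Df) v = w (Df v), and Euler's relation along x for the
   derivative of w f in the direction v. *)
pose C : 'M[F]_(n.+1 + n.+1 + n.+1, 2) := \matrix_(i, q)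
  (if q == 0 then join3 v (fun j => - w j) (fun=> 0) i
   else join3 (fun j => - (e.+1%:R * v j)) (fun=> 0) x i).
apply: (@rank_lower_bound _ _ _ _ _ C) => y yC.
pose al j := y 0 (ix1 j); pose be j := y 0 (ix2 j); pose ga j := y 0 (ix3 j).
have wbe : dot w be = dot al v.
  have /rowP/(_ 0) := yC; rewrite !mxE sum_ix3.
  under eq_bigr do rewrite mxE /= join3_1.
  under [X in _ + X + _]eq_bigr do rewrite mxE /= join3_2 mulrN.
  under [X in _ + _ + X]eq_bigr do rewrite mxE /= join3_3 mulr0.
  rewrite sumrN big1_eq addr0 => /eqP; rewrite subr_eq0 => /eqP.
  by rewrite dotC /dot => ->.
have gax : dot ga x = e.+1%:R * dot al v.
  have /rowP/(_ 1) := yC; rewrite !mxE sum_ix3.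
  under eq_bigr do rewrite mxE /= join3_1 mulrN mulrCA.
  under [X in _ + X + _]eq_bigr do rewrite mxE /= join3_2 mulr0.
  under [X in _ + _ + X]eq_bigr do rewrite mxE /= join3_3.
  rewrite sumrN -mulr_sumr big1_eq addr0 addrC => /eqP; rewrite subr_eq0 => /eqP.
  by [].
have [i0 nzw] := normalized_neq0 nw.
have [c' [c1' c2' c3']] := jets_onto ind nzw gax wbe.
exists (\row_l c' l); have [e1 e2 e3] := EE c' x w v.
apply/rowP; apply: ix_cases => j.
- by rewrite e1 c1'.
- by rewrite e2 c2'.
- by rewrite e3 c3'.
Qed.

Lemma indep_dual_pair x v : indep x v ->
  exists la mu, [/\ dot la x = 1, dot la v = 0, dot mu x = 0 & dot mu v = 1].
Proof. by move=> [p [s nz]]; exact: dual_pair nz. Qed.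

Lemma dot_comb (a b : F) (la mu y : 'I_n.+1 -> F) :
  dot (fun j => a * la j + b * mu j) y = a * dot la y + b * dot mu y.
Proof.
rewrite /dot !mulr_sumr -big_split /=; apply: eq_bigr => j _.
by rewrite mulrDl !mulrA.
Qed.

(* Points of a line where the kernel of the Jacobian is tangent to the critical
   locus. *)
Lemma generic_fold : exists2 G : {mpoly F[P]}, nonzero_homog G &
  forall c x w v, normalized (plane_zero 2) x -> normalized pred0 w -> normalized pred0 v ->
    indep x v -> (forall j, \sum_i w i * (poly_map c i)^`M(j).@[x] = 0) ->
    (forall i, (ddir v (poly_map c i)).@[x] = 0) ->
    \sum_i w i * (ddir v (ddir v (poly_map c i))).@[x] = 0 -> G.@[c] = 0.
Proof.
pose E := row_mx (row_mx (jet_row F n d) (jet_col F n d)) (jet_cusp F n d).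
have [|G [nzG homG GP]] := @generic_family _ _ _ _ E (plane_zero 2) pred0 pred0
    (n.+1 + n.+1 + 1 - 1).
  rewrite card_plane ?card_pred0C //= ; move: n_gt1; lia.
have EE c x w v (z := join3 x w v) : let y := \row_l c l *m map_mx (meval z) E in
    [/\ forall j, y 0 (lshift 1 (lshift n.+1 j)) = \sum_i w i * (poly_map c i)^`M(j).@[x],
     forall i, y 0 (lshift 1 (rshift n.+1 i)) = (ddir v (poly_map c i)).@[x] &
     y 0 (rshift (n.+1 + n.+1) 0) = \sum_i w i * (ddir v (ddir v (poly_map c i))).@[x]].
  rewrite /E !map_row_mx !mul_mx_row /=; split=> [j|j|].
  - by rewrite !row_mxEl jet_rowE.
  - by rewrite row_mxEl row_mxEr jet_colE.
  - by rewrite row_mxEr jet_cuspE.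
have split_cases (Q : 'I_(n.+1 + n.+1 + 1) -> Prop) :
    (forall j, Q (lshift 1 (lshift n.+1 j))) -> (forall j, Q (lshift 1 (rshift n.+1 j))) ->
    Q (rshift (n.+1 + n.+1) 0) -> forall i, Q i.
  move=> Q1 Q2 Q3 i; rewrite -(splitK i); case: (split i) => [i1|j] /=; last by rewrite ord1.
  by rewrite -(splitK i1); case: (split i1) => j /=.
exists G => // c x w v nx nw nv ind c1 c2 c3.
rewrite (meval_eq (v2 := (\row_l c l) 0)) => [|l]; last by rewrite mxE.
have {}GP := GP (\row_l c l) x w v nx nw nv; apply: GP; last first.
  have [e1 e2 e3] := EE c x w v; apply/rowP; apply: split_cases => [j|j|]; rewrite [RHS]mxE.
  - by rewrite e1 c1.
  - by rewrite e2 c2.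
  - by rewrite e3 c3.
pose C : 'M[F]_(n.+1 + n.+1 + 1, 1) :=
  col_mx (col_mx (\col_j v j) (\col_j - w j)) 0.
apply: (@rank_lower_bound _ _ _ _ _ C) => y yC.
pose al j := y 0 (lshift 1 (lshift n.+1 j)); pose be j := y 0 (lshift 1 (rshift n.+1 j)).
have wbe : dot w be = dot al v.
  have /rowP/(_ 0) := yC; rewrite !mxE !big_split_ord big_ord1 /=.
  under eq_bigr do rewrite !col_mxEu mxE.
  under [X in _ + X + _]eq_bigr do rewrite col_mxEu col_mxEd mxE mulrN.
  rewrite col_mxEd mxE mulr0 addr0 sumrN => /eqP; rewrite subr_eq0 => /eqP.
  by rewrite dotC /dot => ->.
have [la [mu [lax lav mux muv]]] := indep_dual_pair ind.
(* Only the value along v is prescribed; the value along x is the one forced by Euler's relation. *)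
pose ga j := e.+1%:R * dot al v * la j + y 0 (rshift (n.+1 + n.+1) 0) * mu j.
have gax : dot ga x = e.+1%:R * dot al v by rewrite dot_comb lax mux mulr1 mulr0 addr0.
have gav : dot ga v = y 0 (rshift (n.+1 + n.+1) 0).
  by rewrite dot_comb lav muv mulr1 mulr0 add0r.
have [i0 nzw] := normalized_neq0 nw.
have [c' [c1' c2' c3']] := jets_onto ind nzw gax wbe.
exists (\row_l c' l); have [e1 e2 e3] := EE c' x w v.
apply/rowP; apply: split_cases => [j|j|].
- by rewrite e1 c1'.
- by rewrite e2 c2'.
- rewrite e3 -gav /dot; under eq_bigr do rewrite -c3' mulr_suml.
  rewrite exchange_big /=; apply: eq_bigr => i _.
  rewrite ddir_eval mulr_sumr; apply: eq_bigr => j _.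
  by rewrite -mulrA [_ * v j]mulrC.
Qed.

Definition plane_first : pred 'I_n.+1 := pred1 ord0.

(* Points of a plane where the Jacobian has corank at least two; one coordinate
   of a kernel vector can then be prescribed on each side. *)
Lemma generic_corank : exists2 G : {mpoly F[P]}, nonzero_homog G &
  forall c x w v, normalized (plane_zero 3) x -> normalized plane_first w ->
    normalized plane_first v ->
    indep x v -> (forall j, \sum_i w i * (poly_map c i)^`M(j).@[x] = 0) ->
    (forall i, (ddir v (poly_map c i)).@[x] = 0) -> G.@[c] = 0.
Proof.
pose E := row_mx (jet_row F n d) (jet_col F n d).
have [|G [nzG homG GP]] := @generic_family _ _ _ _ E (plane_zero 3) plane_first plane_first
    (n.+1 + n.+1 - 1).
  have cf : (#|predC plane_first| = n)%N.
    by have := cardC plane_first; rewrite card_ord card1 add1n => -[].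
  rewrite card_plane ?cf //=; move: n_gt1; lia.
have EE c x w v (z := join3 x w v) : let y := \row_l c l *m map_mx (meval z) E in
    (forall j, y 0 (lshift n.+1 j) = \sum_i w i * (poly_map c i)^`M(j).@[x]) /\
    (forall i, y 0 (rshift n.+1 i) = (ddir v (poly_map c i)).@[x]).
  rewrite /E !map_row_mx !mul_mx_row /=; split=> j.
  - by rewrite !row_mxEl jet_rowE.
  - by rewrite row_mxEr jet_colE.
have split_cases (Q : 'I_(n.+1 + n.+1) -> Prop) :
    (forall j, Q (lshift n.+1 j)) -> (forall j, Q (rshift n.+1 j)) -> forall i, Q i.
  by move=> Q1 Q2 i; rewrite -(splitK i); case: (split i) => j /=.
exists G => // c x w v nx nw nv ind c1 c2.
rewrite (meval_eq (v2 := (\row_l c l) 0)) => [|l]; last by rewrite mxE.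
have {}GP := GP (\row_l c l) x w v nx nw nv; apply: GP; last first.
  have [e1 e2] := EE c x w v; apply/rowP; apply: split_cases => j; rewrite [RHS]mxE.
  - by rewrite e1 c1.
  - by rewrite e2 c2.
pose C : 'M[F]_(n.+1 + n.+1, 1) := col_mx (\col_j v j) (\col_j - w j).
apply: (@rank_lower_bound _ _ _ _ _ C) => y yC.
pose al j := y 0 (lshift n.+1 j); pose be j := y 0 (rshift n.+1 j).
have wbe : dot w be = dot al v.
  have /rowP/(_ 0) := yC; rewrite !mxE !big_split_ord /=.
  under eq_bigr do rewrite col_mxEu mxE.
  under [X in _ + X]eq_bigr do rewrite col_mxEd mxE mulrN.
  rewrite sumrN => /eqP; rewrite subr_eq0 => /eqP.
  by rewrite dotC /dot => ->.
have [la [mu [lax lav mux muv]]] := indep_dual_pair ind.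
pose ga j := e.+1%:R * dot al v * la j + 0 * mu j.
have gax : dot ga x = e.+1%:R * dot al v by rewrite dot_comb lax mulr1 mul0r addr0.
have [i0 nzw] := normalized_neq0 nw.
have [c' [c1' c2' _]] := jets_onto ind nzw gax wbe.
exists (\row_l c' l); have [e1 e2] := EE c' x w v.
apply/rowP; apply: split_cases => j.
- by rewrite e1 c1'.
- by rewrite e2 c2'.
Qed.

End GenericMaps.

(** * The critical locus *)

Section Adjugate.
Variables (F : fieldType) (n : nat).
Implicit Types M : 'M[F]_n.+1.

(** The relation [u] does not involve row [j], so the other rows are dependent and every minor
    avoiding row [j] vanishes. *)
Lemma cofactor_dependent M (u : 'rV[F]_n.+1) j : u != 0 -> u *m M = 0 -> u 0 j = 0 ->
  forall i, cofactor M j i = 0.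
Proof.
move=> nzu uM uj i; rewrite /cofactor; apply/eqP; rewrite mulf_eq0; apply/orP; right.
apply/det0P; exists (col' j u).
  apply: contraNneq nzu => u0; apply/eqP/rowP => k; rewrite mxE.
  case: (unliftP j k) => [k'|] -> //.
  by have /rowP/(_ k') := u0; rewrite !mxE.
apply/rowP => k; have /rowP/(_ (lift i k)) := uM.
rewrite !mxE (bigD1_ord j) //= uj mul0r add0r => s0; rewrite -[RHS]s0.
by apply: eq_bigr => l _; rewrite !mxE.
Qed.

(** A row r of the adjugate also lies in the left kernel. If it were not proportional to y,
    combinations of r and y with vanishing coordinate j or l would kill the corresponding cofactors,
    hence r_j and r_l. *)
Lemma adj_row_proportional M (y : 'rV[F]_n.+1) : y *m M = 0 ->
  forall i j l, y 0 l * (\adj M) i j = y 0 j * (\adj M) i l.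
Proof.
move=> yM i j l; have [y0|nzy] := eqVneq y 0; first by rewrite y0 !mxE !mul0r.
have det0 : \det M = 0 by apply/eqP/det0P; exists y.
apply/eqP; rewrite -subr_eq0; apply/eqP.
set r := row i (\adj M).
have rM : r *m M = 0 by rewrite -row_mul mul_adj_mx det0 -scalemx1 scale0r row0.
have rE k : (\adj M) i k = r 0 k by rewrite !mxE.
rewrite !rE; apply: NNPP => /eqP nz.
have rj : r 0 j = 0.
  rewrite !mxE; apply: (@cofactor_dependent M (y 0 j *: r - r 0 j *: y)).
  - apply: contraNneq nz => /rowP/(_ l); rewrite !mxE => /eqP.
    by rewrite -oppr_eq0 opprB [_ * y 0 l]mulrC.
  - by rewrite mulmxBl -!scalemxAl rM yM !scaler0 subr0.
  - by rewrite !mxE mulrC subrr.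
have rl : r 0 l = 0.
  rewrite !mxE; apply: (@cofactor_dependent M (y 0 l *: r - r 0 l *: y)).
  - apply: contraNneq nz => /rowP/(_ j); rewrite !mxE => /eqP.
    by rewrite [_ * y 0 j]mulrC.
  - by rewrite mulmxBl -!scalemxAl rM yM !scaler0 subr0.
  - by rewrite !mxE mulrC subrr.
by case/eqP: nz; rewrite rj rl !mulr0 subrr.
Qed.

(** Replacing row 0 by a unit vector gives a determinant equal to a cofactor, that is zero. Without
    a relation avoiding row 0, all unit vectors would lie in the span of the n remaining rows. *)
Lemma adj0_kernel M : \adj M = 0 ->
  exists w : 'rV[F]_n.+1, [/\ w != 0, w *m M = 0 & w 0 ord0 = 0].
Proof.
move=> adj0; apply: NNPP => noker.
have span i : ((delta_mx 0 i : 'rV[F]_n.+1) <= row' ord0 M)%MS.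
  pose Mi := \matrix_(k, j) (if k == ord0 then (j == i)%:R else M k j).
  have row'Mi : row' ord0 Mi = row' ord0 M.
    by apply/matrixP => k j; rewrite !mxE eq_sym (negbTE (neq_lift _ _)).
  have /eqP/det0P [u nzu uMi] : \det Mi = 0.
    rewrite (expand_det_row _ ord0) (bigD1 i) //= mxE !eqxx mul1r.
    rewrite big1 ?addr0 => [|j /negbTE ne]; last by rewrite mxE eqxx ne mul0r.
    have /matrixP/(_ i ord0) := adj0; rewrite !mxE /cofactor => cf; rewrite -[RHS]cf.
    by congr (_ * \det _); apply/matrixP => k j; have /matrixP/(_ k (lift i j)) := row'Mi; rewrite !mxE.
  have uE (N : 'M[F]_n.+1) : u *m N = u 0 ord0 *: row ord0 N + col' ord0 u *m row' ord0 N.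
    apply/rowP => j; rewrite !mxE (bigD1_ord ord0) //=; congr (_ + _).
    by apply: eq_bigr => l _; rewrite !mxE.
  have [u0|nzu0] := eqVneq (u 0 ord0) 0.
    case: noker; exists u; split=> //.
    by move: uMi; rewrite !uE u0 !scale0r !add0r row'Mi.
  have -> : (delta_mx 0 i : 'rV[F]_n.+1) = row ord0 Mi.
    by apply/rowP => j; rewrite !mxE eqxx.
  move: uMi; rewrite uE row'Mi => /eqP; rewrite addr_eq0 => /eqP uMi.
  rewrite -[row ord0 Mi](scalerK nzu0) uMi scalemx_sub // eqmx_opp.
  exact: submxMl.
have : (1%:M <= row' ord0 M)%MS.
  by apply/row_subP => i; rewrite row1.
move/mxrankS; rewrite mxrank1 => le_n.
by have := leq_trans le_n (rank_leq_row _); rewrite ltnn.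
Qed.

End Adjugate.

Section DetDerivative.
Variables (F : fieldType) (m : nat) (s : 'I_m).

Lemma mderiv_prod (I : finType) (a : I -> {mpoly F[m]}) :
  (\prod_i a i)^`M(s) = \sum_i (a i)^`M(s) * \prod_(j | j != i) a j.
Proof.
have gen (r : seq I) : uniq r -> (\prod_(i <- r) a i)^`M(s) =
    \sum_(i <- r) (a i)^`M(s) * \prod_(j <- r | j != i) a j.
  elim: r => [|i r IHr] /=; first by rewrite !big_nil -mpolyC1 mderivC.
  case/andP=> ir ur; rewrite !big_cons mderivM IHr // eqxx /=; congr (_ + _).
    congr (_ * _); rewrite big_seq [RHS]big_seq_cond; apply: eq_bigl => j.
    by case jr: (j \in r) => //=; symmetry; apply: contraNneq ir => <-.
  rewrite mulr_sumr big_seq [RHS]big_seq; apply: eq_bigr => j jr.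
  rewrite big_cons ifT; last by apply: contraNneq ir => ->.
  by rewrite mulrCA.
exact: gen (index_enum_uniq _).
Qed.

(** Jacobi's formula: the rows are differentiated one at a time and each determinant is expanded
    along the differentiated row. *)
Lemma mderiv_det n (A : 'M[{mpoly F[m]}]_n) :
  (\det A)^`M(s) = \sum_i \sum_j cofactor A i j * (A i j)^`M(s).
Proof.
pose Ai i := \matrix_(k, j) (if k == i then (A k j)^`M(s) else A k j).
transitivity (\sum_i \det (Ai i)).
  rewrite /determinant raddf_sum exchange_big /=; apply: eq_bigr => t _.
  have sgM (b : bool) (p : {mpoly F[m]}) : ((-1) ^+ b * p)^`M(s) = (-1) ^+ b * p^`M(s).
    by case: b; rewrite ?expr1 ?expr0 ?mul1r // !mulN1r mderivN.
  rewrite sgM mderiv_prod mulr_sumr; apply: eq_bigr => i _.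
  congr (_ * _); rewrite [RHS](bigD1 i) //= mxE eqxx; congr (_ * _).
  by apply: eq_bigr => j /negbTE ne; rewrite mxE ne.
apply: eq_bigr => i _; rewrite (expand_det_row _ i); apply: eq_bigr => j _.
have -> : cofactor (Ai i) i j = cofactor A i j.
  rewrite /cofactor; congr (_ * \det _); apply/matrixP => k l.
  by rewrite !mxE eq_sym (negbTE (neq_lift _ _)).
have -> : Ai i i j = (A i j)^`M(s) by rewrite mxE eqxx.
exact: mulrC.
Qed.

End DetDerivative.

Section Homogeneity.
Variables (R : nzRingType) (m : nat).

Lemma prod_homog (I : finType) (P : pred I) (a : I -> {mpoly R[m]}) k :
  (forall i, a i \is k.-homog) -> \prod_(i | P i) a i \is (#|P| * k).-homog.
Proof.
move=> ha; rewrite -sum1_card; elim/big_rec2: _ => [|i x p _ hp]; first exact: dhomog1.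
by rewrite mulnDl mul1n dhomogM.
Qed.

End Homogeneity.

Lemma det_homog (R : comNzRingType) m n (A : 'M[{mpoly R[m]}]_n) k :
  (forall i j, A i j \is k.-homog) -> \det A \is (n * k).-homog.
Proof.
move=> hA; apply: rpred_sum => s _.
have hp (t : 'I_n -> 'I_n) : \prod_i A i (t i) \is (n * k).-homog.
  have := @prod_homog R m 'I_n predT (fun i => A i (t i)) k (fun i => hA i (t i)).
  by rewrite cardT size_enum_ord.
case: (perm.odd_perm _) => /=; first by rewrite expr1 mulN1r rpredN; exact: hp.
by rewrite expr0 mul1r; exact: hp.
Qed.

Lemma adj_homog (R : comNzRingType) m n (A : 'M[{mpoly R[m]}]_n.+1) k i j :
  (forall i j, A i j \is k.-homog) -> (\adj A) i j \is (n * k).-homog.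
Proof.
move=> hA; rewrite mxE /cofactor.
have hp : \det (row' j (col' i A)) \is (n * k).-homog.
  by apply: det_homog => a b; rewrite !mxE.
by elim: (j + i)%N => [|t IHt]; rewrite ?expr0 ?mul1r // exprS -mulrA mulN1r rpredN.
Qed.

(* Otherwise the two forms and the equations of the plane would generate an
   ideal of too large height. *)
Lemma forms_meet_on_plane (F : closedFieldType) r (p q : {mpoly F[r.+3]}) dp dq :
    p != 0 -> p \is dp.-homog -> (0 < dp)%N -> q \is dq.-homog -> (0 < dq)%N ->
  exists x : 'I_r.+3 -> F, [/\ exists i, x i != 0, forall j : 'I_r.+3, (3 <= j)%N -> x j = 0,
                p.@[x] = 0 & q.@[x] = 0].
Proof.
move=> nzp hp a0 hq b0; apply: NNPP => nomeet.
(* With [B] = q and [A] = 1 the transfer of relations is trivial, and the [r] extra forms are the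
   coordinates vanishing on the plane. *)
apply: (@height_three_contradiction F r 'I_1 p (fun=> q) (fun=> 1)
  (fun i : 'I_r => 'X_(rshift 3 i)) dp dq 0 1 nzp hp a0) => //.
- by move=> j; rewrite msize1.
- by move=> i; rewrite dhomogX /= mdeg1.
- move=> x px qx gx k; apply/eqP/negPn/negP => xk; apply: nomeet; exists x; split=> //.
  + by exists k.
  + move=> j le_3j; have lt_j : (j - 3 < r)%N by have := ltn_ord j; lia.
    have := gx (Ordinal lt_j); rewrite mevalXU => xj; rewrite -[RHS]xj; congr x.
    by apply: val_inj; rewrite /= addnC subnK.
  + exact: qx 0.
- move=> P; rewrite !big_ord1 mulr1 => -[u ->]; exists (u * q).
  by rewrite mulrAC.
Qed.

Section CriticalLocus.
Variables (F : closedFieldType) (n e : nat) (c : 'I_(param_dim n e.+2) -> F).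
Hypothesis F0 : [pchar F] =i pred0.
Hypothesis mor : is_morphism c.
Local Notation f := (poly_map c).
Local Notation J := (jac_det c).
Implicit Types (x w v : 'I_n.+1 -> F).

Definition jac_mx : 'M[{mpoly F[n.+1]}]_n.+1 := \matrix_(i, j) (f i)^`M(j).
Definition jac_at x : 'M[F]_n.+1 := map_mx (meval x) jac_mx.

Lemma jac_mx_homog i j : jac_mx i j \is e.+1.-homog.
Proof. by rewrite mxE mderiv_homog // poly_map_homog. Qed.

Lemma jac_det_homog : J \is (n.+1 * e.+1).-homog.
Proof. by apply: det_homog => i j; exact: jac_mx_homog. Qed.

Lemma jac_det_eval x : J.@[x] = \det (jac_at x).
Proof. by rewrite -det_map_mx. Qed.

Lemma jac_at_E x i j : jac_at x i j = (f i)^`M(j).@[x].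
Proof. by rewrite !mxE. Qed.

Lemma normalize (Z : pred 'I_n.+1) x : (exists i, x i != 0) -> (forall j, Z j -> x j = 0) ->
  exists2 t, t != 0 & normalized Z (fun j => t * x j).
Proof.
move=> [p xp] xZ; exists (x p)^-1; first by rewrite invr_neq0.
split=> [j /xZ ->|]; first by rewrite mulr0.
by exists p; rewrite mulVf.
Qed.

(** If v were a multiple of x, Euler's identity in characteristic zero would make x a common zero of
    the components of f. *)
Lemma kernel_indep x v : (exists i, x i != 0) -> (exists j, v j != 0) ->
  (forall i, (ddir v (f i)).@[x] = 0) -> indep x v.
Proof.
move=> nzx [j0 vj0] kv; apply: NNPP => dep.
have dep' p s : x p * v s = x s * v p.
  by apply/eqP/negPn/negP => nz; apply: dep; exists p, s.
have [p xp] := nzx.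
have [t vE] : exists t, forall s, v s = t * x s.
  exists (v p / x p) => s; apply: (mulfI xp).
  by rewrite dep' mulrA [x p * _]mulrC divfK // mulrC.
have nz : t != 0 by apply: contraNneq vj0 => t0; rewrite vE t0 mul0r.
have [i] := mor nzx; rewrite /eval_map => /negP; apply.
have := kv i; rewrite ddir_eval.
under eq_bigr do rewrite vE -mulrA.
rewrite -mulr_sumr (euler _ (poly_map_homog c i)) => /eqP.
rewrite !mulf_eq0 (negbTE nz) /=; have /pcharf0P -> := F0.
by [].
Qed.

(** A nonzero adjugate of a singular matrix has rank one: its rows are left kernel vectors and its
    columns right kernel vectors. *)
Lemma corank_one_kernel x : J.@[x] = 0 -> \adj (jac_at x) != 0 ->
  exists w v k, [/\ normalized pred0 w, normalized pred0 v, k != 0,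
    (forall j, \sum_i w i * (f i)^`M(j).@[x] = 0) /\ (forall i, (ddir v (f i)).@[x] = 0) &
    forall j i, (\adj (jac_at x)) j i = k * v j * w i].
Proof.
rewrite jac_det_eval => det0 nzadj; set A := \adj _ in nzadj *.
have [j0 [i0 nzk]] : exists j i, A j i != 0.
  apply: NNPP => no; case/eqP: nzadj; apply/matrixP => j i; rewrite [RHS]mxE.
  by apply/eqP/negPn/negP => nz; apply: no; exists j, i.
pose w i := A j0 i / A j0 i0; pose v j := A j i0 / A j0 i0.
have AM : A *m jac_at x = 0 by rewrite mul_adj_mx det0 -scalemx1 scale0r.
have MA : jac_at x *m A = 0 by rewrite mul_mx_adj det0 -scalemx1 scale0r.
exists w, v, (A j0 i0); split=> //.
- by split=> //; exists i0; rewrite /w mulfV.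
- by split=> //; exists j0; rewrite /v mulfV.
- split=> [j|i].
    have /matrixP/(_ j0 j) := AM; rewrite mxE [RHS]mxE => s0.
    move/(congr1 ( *%R (A j0 i0)^-1)): s0; rewrite mulr0 mulr_sumr => s1; rewrite -[RHS]s1.
    apply: eq_bigr => i _.
    by rewrite jac_at_E /w mulrAC mulrC.
  have /matrixP/(_ i i0) := MA; rewrite mxE [RHS]mxE => s0.
  move/(congr1 ( *%R (A j0 i0)^-1)): s0; rewrite mulr0 mulr_sumr => s1.
  rewrite ddir_eval -[RHS]s1; apply: eq_bigr => j _.
  by rewrite jac_at_E /v [RHS]mulrCA mulrC [_^-1 * _]mulrC.
move=> j i.
have wM : row j0 A *m jac_at x = 0 by rewrite -row_mul AM row0.
have := adj_row_proportional wM j i i0; rewrite ![row _ _ _ _]mxE -/A => prop.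
apply: (mulfI nzk); rewrite prop /w /v; field.
by [].
Qed.

(** Jacobi's formula for a rank-one adjugate. It identifies the second-order row of the jet with the
    gradient of [J] up to the factor [k]. *)
Lemma jac_det_deriv x w v k l : (forall j i, (\adj (jac_at x)) j i = k * v j * w i) ->
  J^`M(l).@[x] = k * \sum_i w i * (ddir v (f i))^`M(l).@[x].
Proof.
move=> adjE; rewrite /jac_det mderiv_det raddf_sum mulr_sumr; apply: eq_bigr => i _.
rewrite raddf_sum ddir_mderiv raddf_sum /= !mulr_sumr; apply: eq_bigr => j _.
rewrite mevalM mevalZ -/jac_mx [jac_mx i j]mxE.
have -> : (cofactor jac_mx i j).@[x] = (\adj (jac_at x)) j i.
  by rewrite mxE /jac_at -cofactor_map_mx.
by rewrite adjE; ring.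
Qed.

End CriticalLocus.

Lemma pihomog_topM (R : idomainType) n (p q : {mpoly R[n]}) a b :
  (msize p <= a.+1)%N -> (msize q <= b.+1)%N ->
  pihomog mdeg (a + b) (p * q) = pihomog mdeg a p * pihomog mdeg b q.
Proof.
move=> sp sq; rewrite {1}(pihomog_partitionE (mf := mdeg) sq) mulr_sumr raddf_sum /=.
rewrite big_ord_recr /= (pihomogM _ _ (pihomogP _ _ _)) leq_addl addnK.
rewrite big1 ?add0r // => i _; rewrite (pihomogM _ _ (pihomogP _ _ _)).
have lt_ib : (i < b)%N by [].
case: ifP => // _; have -> : pihomog mdeg (a + b - i) p = 0; last by rewrite mul0r.
apply/mpolyP => m; rewrite mcoeff_pihomog mcoeff0; case: eqP => // dm.
by apply: mcoeff_ge_msize; rewrite dm (leq_trans sp) //; lia.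
Qed.

Section GenericCriticalLocus.
Variables (F : closedFieldType) (r e : nat) (c : 'I_(param_dim r.+2 e.+2) -> F).
Hypothesis F0 : [pchar F] =i pred0.
Hypothesis mor : is_morphism c.
Local Notation n := r.+2.
Local Notation f := (poly_map c).
Local Notation J := (jac_det c).
Implicit Types (x w v : 'I_n.+1 -> F).

Hypothesis no_corank_two : forall x w v, normalized (@plane_zero n 3) x ->
  normalized (@plane_first n) w -> normalized (@plane_first n) v -> indep x v ->
  (forall j, \sum_i w i * (f i)^`M(j).@[x] = 0) ->
  (forall i, (ddir v (f i)).@[x] = 0) -> False.
Hypothesis no_singular : forall x w v, normalized (@plane_zero n 3) x ->
  normalized pred0 w -> normalized pred0 v -> indep x v ->
  (forall j, \sum_i w i * (f i)^`M(j).@[x] = 0) ->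
  (forall i, (ddir v (f i)).@[x] = 0) ->
  (forall j, \sum_i w i * (ddir v (f i))^`M(j).@[x] = 0) -> False.
Hypothesis no_cusp : forall x w v, normalized (@plane_zero n 2) x ->
  normalized pred0 w -> normalized pred0 v -> indep x v ->
  (forall j, \sum_i w i * (f i)^`M(j).@[x] = 0) ->
  (forall i, (ddir v (f i)).@[x] = 0) ->
  \sum_i w i * (ddir v (ddir v (f i))).@[x] = 0 -> False.

Lemma jac_deriv_homog l : J^`M(l) \is (e + n * e.+1).-homog.
Proof. by apply: mderiv_homog; exact: jac_det_homog. Qed.

Lemma ddir_scale t v p x : (ddir (fun j => t * v j) p).@[x] = t * (ddir v p).@[x] :> F.
Proof.
by rewrite !ddir_eval mulr_sumr; apply: eq_bigr => j _; rewrite mulrA.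
Qed.

Lemma adj_jac_neq0 x : normalized (@plane_zero n 3) x -> \adj (jac_at c x) != 0.
Proof.
move=> nx; apply/eqP => adj0.
have [w [nzw wM w0]] := adj0_kernel adj0.
have [v [nzv vM v0]] : exists v : 'rV[F]_n.+1, [/\ v != 0, v *m (jac_at c x)^T = 0 & v 0 ord0 = 0].
  by apply: adj0_kernel; rewrite -trmx_adj adj0 trmx0.
have ex0 (y : 'rV[F]_n.+1) : y != 0 -> exists i, y 0 i != 0 by case/rV0Pn=> i; exists i.
have first0 (y : 'rV[F]_n.+1) : y 0 ord0 = 0 -> forall j, @plane_first n j -> y 0 j = 0.
  by move=> y0 j /eqP ->.
have [t nzt nw] := normalize (ex0 w nzw) (first0 w w0).
have [u nzu nv] := normalize (ex0 v nzv) (first0 v v0).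
have kv i : (ddir (fun j => u * v 0 j) (f i)).@[x] = 0.
  rewrite ddir_scale ddir_eval; have /rowP/(_ i) := vM; rewrite !mxE => s0.
  rewrite (eq_bigr (fun j => v 0 j * (jac_at c x)^T j i)) ?s0 ?mulr0 // => j _.
  by rewrite mxE jac_at_E.
apply: (no_corank_two nx nw nv) => //.
  by apply: (kernel_indep F0 mor); [exact: normalized_neq0 nx | exact: normalized_neq0 nv |].
move=> j; have /rowP/(_ j) := wM; rewrite !mxE => s0.
rewrite (eq_bigr (fun i => t * (w 0 i * jac_at c x i j))) => [|i _].
  by rewrite -mulr_sumr s0 mulr0.
by rewrite jac_at_E mulrA.
Qed.

Lemma smooth_on_plane x : (exists i, x i != 0) ->
  (forall j : 'I_n.+1, (3 <= j)%N -> x j = 0) -> J.@[x] = 0 ->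
  (forall l, J^`M(l).@[x] = 0) -> False.
Proof.
move=> nzx xL Jx dJx; have [t nzt nx] := normalize (Z := @plane_zero n 3) nzx xL.
set y := (fun j => t * x j) in nx.
have Jy : J.@[y] = 0 by rewrite (meval_homog_scale _ _ (jac_det_homog c)) Jx mulr0.
have dJy l : J^`M(l).@[y] = 0 by rewrite (meval_homog_scale _ _ (jac_deriv_homog l)) dJx mulr0.
have [w [v [k [nw nv nzk [kw kv] adjE]]]] := corank_one_kernel Jy (adj_jac_neq0 nx).
apply: (no_singular nx nw nv _ kw kv).
  by apply: (kernel_indep F0 mor); [exact: normalized_neq0 nx | exact: normalized_neq0 nv |].
move=> j; have := jac_det_deriv j adjE; rewrite dJy => /esym/eqP.
by rewrite mulf_eq0 (negbTE nzk) => /eqP.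
Qed.

Lemma jac_det_neq0 : J != 0.
Proof.
apply/eqP => J0; apply: (@smooth_on_plane (fun j => (j == ord0)%:R)).
- by exists ord0; rewrite eqxx oner_neq0.
- by move=> j; case: eqP => // -> .
- by rewrite J0 meval0.
- by move=> l; rewrite J0 mderiv0 meval0.
Qed.

(** The sum is the derivative of [J] along a column of the adjugate; being nonzero, it says that the
    kernel direction is transverse to the locus. The point lies on the line spanned by the first two
    coordinates, obtained by cutting the plane with ['X_i2]. *)
Lemma fold_point : exists x, J.@[x] = 0 /\
  exists i, \sum_l J^`M(l).@[x] * (\adj (jac_at c x)) l i != 0.
Proof.
pose i2 : 'I_n.+1 := inord 2.
have v2 : i2 = 2 :> nat by rewrite inordK.
have [] := @forms_meet_on_plane F r J 'X_i2 (n.+1 * e.+1) 1 jac_det_neq0 (jac_det_homog c) _ _ _ => //.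
  by rewrite dhomogX /= mdeg1.
move=> x [nzx xL Jx]; rewrite mevalXU => x2.
have xl (j : 'I_n.+1) : @plane_zero n 2 j -> x j = 0.
  rewrite /plane_zero leq_eqVlt => /orP[/eqP j2|]; last exact: xL.
  by rewrite -x2; congr x; apply: val_inj; rewrite /= v2.
have [t nzt nx] := normalize nzx xl.
set y := (fun j => t * x j) in nx.
have Jy : J.@[y] = 0 by rewrite (meval_homog_scale _ _ (jac_det_homog c)) Jx mulr0.
have nx3 : normalized (@plane_zero n 3) y.
  by case: nx => yl yp; split=> // j lt; apply: yl; apply: ltnW.
have [w [v [k [nw nv nzk [kw kv] adjE]]]] := corank_one_kernel Jy (adj_jac_neq0 nx3).
exists y; split=> //; have [_ [i wi]] := nw; exists i.
apply/eqP => sum0; apply: (no_cusp nx nw nv _ kw kv).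
  by apply: (kernel_indep F0 mor); [exact: normalized_neq0 nx | exact: normalized_neq0 nv |].
have : k * k * \sum_i w i * (ddir v (ddir v (f i))).@[y] = 0.
  rewrite -[RHS]sum0; under [RHS]eq_bigr do rewrite (jac_det_deriv _ adjE) adjE wi mulr1.
  rewrite !mulr_sumr.
  rewrite [RHS](eq_bigr (fun l => \sum_i k * k * (w i * (v l * (ddir v (f i))^`M(l).@[y])))); last first.
    move=> l _; rewrite mulr_sumr mulr_suml; apply: eq_bigr => j _.
    by ring.
  rewrite exchange_big /=; apply: eq_bigr => j _.
  by rewrite ddir_eval !mulr_sumr.
by move/eqP; rewrite !mulf_eq0 (negbTE nzk) => /eqP.
Qed.

(** Two nonunit factors, replaced by their top forms since [J] is homogeneous, have a common zero on
    the plane, and there the gradient of their product vanishes. So the prime factorization of [J]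
    has exactly one prime. *)
Lemma jac_det_prime : rprime J.
Proof.
have nzJ := jac_det_neq0.
have sJ : msize J = (n.+1 * e.+1).+1 by exact: msize_homog_neq0 (jac_det_homog c).
have unit_size (p : {mpoly F[n.+1]}) : p \is a GRing.unit -> msize p = 1%N :> nat.
  move=> /unitrP [q [qp _]]; have nzp : p != 0.
    by apply/eqP => p0; move: qp; rewrite p0 mulr0 => /esym/eqP; rewrite oner_eq0.
  have nzq : q != 0.
    by apply/eqP => q0; move: qp; rewrite q0 mul0r => /esym/eqP; rewrite oner_eq0.
  have := congr1 (fun p => msize p) qp; rewrite msizeM // msize1.
  rewrite (mpolySpred mdeg nzp) (mpolySpred mdeg nzq) addSn addnS /=.
  by move=> [] /eqP; rewrite addn_eq0 => /andP[_ /eqP ->].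
have size_unit (p : {mpoly F[n.+1]}) : msize p = 1%N :> nat -> p \is a GRing.unit.
  move=> /eqP/msize_poly1P [a nza ->]; apply/unitrP; exists (a^-1)%:MP.
  by rewrite -!mpolyCM mulVf // mulfV.
have irr p q : J = p * q -> p \isn't a GRing.unit -> q \isn't a GRing.unit -> False.
  move=> JE np nq.
  have : (p != 0) && (q != 0) by rewrite -negb_or -mulf_eq0 -JE.
  case/andP=> nzp nzq.
  have deg_pos (u : {mpoly F[n.+1]}) : u != 0 -> u \isn't a GRing.unit -> (0 < (msize u).-1)%N.
    move=> nzu nu; rewrite lt0n; apply: contra nu => /eqP u0; apply: size_unit.
    by rewrite (mpolySpred mdeg nzu) u0.
  pose a := (msize p).-1; pose b := (msize q).-1.
  have sp : msize p = a.+1 by exact: mpolySpred.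
  have sq : msize q = b.+1 by exact: mpolySpred.
  have ab : (n.+1 * e.+1 = a + b)%N.
    by move: sJ; rewrite JE msizeM // sp sq addSn addnS /= => -[].
  pose p' := pihomog mdeg a p; pose q' := pihomog mdeg b q.
  have JE' : J = p' * q'.
    by rewrite -pihomog_topM ?sp ?sq // -JE -ab pihomog_dE // jac_det_homog.
  have nzp' : p' != 0 by rewrite pihomog_top_neq0.
  have [x [nzx xL px qx]] := forms_meet_on_plane nzp' (pihomogP _ _ _) (deg_pos p nzp np)
    (pihomogP mdeg b q) (deg_pos q nzq nq).
  apply: (smooth_on_plane nzx xL); first by rewrite JE' mevalM px mul0r.
  by move=> l; rewrite JE' mderivM mevalD !mevalM px qx mulr0 mul0r addr0.
have [u [s [uu ps JE]]] := mpoly_factorial nzJ.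
case: s ps JE => [|p [|q s]] ps JE.
- by move: sJ; rewrite JE big_nil mulr1 (unit_size _ uu).
- have [nzp nup pp] := ps p (mem_head _ _).
  rewrite big_seq1 in JE; rewrite JE; split; first by rewrite -JE.
  + by rewrite unitrM negb_and nup orbT.
  + move=> a b [t tE]; have : rdvd p (a * b) by exists (t * u); rewrite tE mulrA.
    by case/pp => -[k ->]; [left|right]; exists (k * u^-1); rewrite mulrA divrK.
case: (irr p (u * (q * \prod_(p <- s) p))).
- by rewrite JE !big_cons mulrCA.
- by have [] := ps p (mem_head _ _).
have [_ nq _] : rprime q by apply: ps; rewrite !inE eqxx orbT.
by apply/negP; rewrite !unitrM => /and3P[_ qu _]; rewrite qu in nq.
Qed.

End GenericCriticalLocus.

(** * Dynamics of the critical locus *)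

Section Composition.
Variables (F : fieldType) (m k : nat).
Implicit Types (p : {mpoly F[m]}) (q : m.-tuple {mpoly F[k]}).

Lemma comp_homog p q dp dq : p \is dp.-homog -> (forall i, tnth q i \is dq.-homog) ->
  p \mPo q \is (dp * dq).-homog.
Proof.
move=> /dhomogP hp hq; rewrite comp_mpolyEX big_seq; apply: rpred_sum => t /hp dt.
apply: rpredZ; rewrite comp_mpolyX -dt /= mdegE.
elim: (index_enum _) => [|i r IHr]; first by rewrite !big_nil; exact: dhomog1.
by rewrite !big_cons mulnDl dhomogM // mulnC dhomogMn.
Qed.

Lemma chain_rule p q j :
  (p \mPo q)^`M(j) = \sum_i (p^`M(i) \mPo q) * (tnth q i)^`M(j).
Proof.
pose ok p := (p \mPo q)^`M(j) = \sum_i (p^`M(i) \mPo q) * (tnth q i)^`M(j).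
rewrite -/(ok p).
have okM p1 p2 : ok p1 -> ok p2 -> ok (p1 * p2).
  rewrite /ok => h1 h2; rewrite rmorphM mderivM h1 h2 mulr_suml mulr_sumr -big_split /=.
  by apply: eq_bigr => i _; rewrite mderivM rmorphD !rmorphM /=; ring.
have ok1 : ok 1.
  rewrite /ok comp_mpoly1 -mpolyC1 mderivC big1 // => i _.
  by rewrite mderivC comp_mpoly0 mul0r.
have okX i : ok 'X_i.
  rewrite /ok comp_mpolyXU -tnth_nth (bigD1 i) //= big1 ?addr0 => [|l ne].
    rewrite mderivX mnm1E eqxx scale1r.
    have -> : (U_(i) - U_(i))%MM = 0%MM :> 'X_{1..m}.
      by apply/mnmP => s; rewrite mnmBE mnm0E subnn.
    by rewrite mpolyX0 comp_mpoly1 mul1r.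
  by rewrite mderivX mnm1E eq_sym (negbTE ne) scale0r comp_mpoly0 mul0r.
have okE i s : ok ('X_i ^+ s).
  elim: s => [|s IHs]; first by rewrite expr0; exact: ok1.
  by rewrite exprS; exact: okM (okX i) IHs.
have okXm t : ok 'X_[t].
  rewrite mpolyXE_id; elim/big_rec: _ => [|i p' _ okp]; first exact: ok1.
  exact: okM (okE i (t i)) okp.
rewrite [p]mpolyE; elim/big_rec: _ => [|t p' _ okp].
  rewrite /ok comp_mpoly0 mderiv0 big1 // => i _.
  by rewrite mderiv0 comp_mpoly0 mul0r.
rewrite /ok comp_mpolyD mderivD okp comp_mpolyZ mderivZ okXm scaler_sumr -big_split /=.
apply: eq_bigr => i _.
by rewrite mderivD mderivZ comp_mpolyD comp_mpolyZ mulrDl scalerAl.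
Qed.

End Composition.

Section Dynamics.
Variables (F : closedFieldType) (r e : nat) (c : 'I_(param_dim r.+2 e.+2) -> F).
Hypothesis mor : is_morphism c.
Local Notation n := r.+2.
Local Notation d := e.+2.
Local Notation f := (poly_map c).
Local Notation J := (jac_det c).
Local Notation M := (jac_mx c).

Hypothesis prime_J : rprime J.
Hypothesis smooth : forall x, (exists i, x i != 0) ->
  (forall j : 'I_n.+1, (3 <= j)%N -> x j = 0) -> J.@[x] = 0 ->
  (forall l, J^`M(l).@[x] = 0) -> False.
Hypothesis fold : exists x, J.@[x] = 0 /\
  exists i, \sum_l J^`M(l).@[x] * (\adj (jac_at c x)) l i != 0.

Fixpoint iterate (k : nat) : n.+1.-tuple {mpoly F[n.+1]} :=
  if k is k'.+1 then [tuple f i \mPo iterate k' | i < n.+1] else [tuple 'X_i | i < n.+1].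

Lemma iterate_eval k x i : (tnth (iterate k) i).@[x] = iter k (eval_map c) x i.
Proof.
elim: k i => [|k IHk] i /=; first by rewrite tnth_mktuple mevalXU.
by rewrite tnth_mktuple comp_mpoly_meval; apply: meval_eq => j; exact: IHk.
Qed.

Lemma comp_iterate_eval (p : {mpoly F[n.+1]}) k x :
  (p \mPo iterate k).@[x] = p.@[iter k (eval_map c) x].
Proof. by rewrite comp_mpoly_meval; apply: meval_eq => i; exact: iterate_eval. Qed.

Lemma iterate_homog k i : tnth (iterate k) i \is (d ^ k).-homog.
Proof.
elim: k i => [|k IHk] i /=; rewrite tnth_mktuple; first by rewrite dhomogX /= mdeg1.
by rewrite expnS; apply: comp_homog => //; exact: poly_map_homog.
Qed.

Lemma iter_nonzero k x : nonzero_pt x -> nonzero_pt (iter k (eval_map c) x).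
Proof. by elim: k => //= k IHk /IHk /mor. Qed.

Definition diff_iterate k : 'M[{mpoly F[n.+1]}]_n.+1 :=
  \matrix_(i, j) (tnth (iterate k) i)^`M(j).

Lemma diff_iterate0 : diff_iterate 0 = 1%:M.
Proof.
apply/matrixP => i j; rewrite !mxE tnth_mktuple mderivX mnm1E eq_sym.
case: eqP => [->|_]; last by rewrite scale0r mulr0n.
have -> : (U_(i) - U_(i))%MM = 0%MM :> 'X_{1..n.+1}.
  by apply/mnmP => s; rewrite mnmBE mnm0E subnn.
by rewrite mpolyX0 scale1r.
Qed.

Lemma diff_iterateS k :
  diff_iterate k.+1 = map_mx (comp_mpoly (iterate k)) M *m diff_iterate k.
Proof.
apply/matrixP => i j; rewrite !mxE /= tnth_mktuple chain_rule.
by apply: eq_bigr => l _; rewrite !mxE.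
Qed.

Lemma prime_not_unit : ~ rdvd J 1.
Proof.
have [_ nu _] := prime_J; move=> [u u1]; case/negP: nu.
by apply/unitrP; exists u; rewrite -u1 mulrC -u1.
Qed.

(** By the chain rule det N is the product of the pullbacks of [J] under the iterates 1 to k, and
    the prime [J] divides none of them. *)
Lemma diff_iterate_factor k : (forall i, (0 < i <= k)%N -> ~ rdvd J (J \mPo iterate i)) ->
  exists2 N, diff_iterate k.+1 = N *m M & ~ rdvd J (\det N).
Proof.
elim: k => [_|k IHk nd].
  exists 1%:M; last by rewrite det1; exact: prime_not_unit.
  rewrite diff_iterateS diff_iterate0 mulmx1 mul1mx; apply/matrixP => i j.
  by rewrite mxE comp_mpoly_id.
have [|N DE nN] := IHk; first by move=> i /andP[i0 ik]; apply: nd; rewrite i0 ltnW.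
exists (map_mx (comp_mpoly (iterate k.+1)) M *m N).
  by rewrite diff_iterateS DE mulmxA.
rewrite det_mulmx det_map_mx -/J; have [_ _ pr] := prime_J.
by case/pr => //; apply: nd; rewrite ltnSn.
Qed.

Lemma vanish_dvd (p : {mpoly F[n.+1]}) : (forall x, J.@[x] = 0 -> p.@[x] = 0) -> rdvd J p.
Proof.
move=> vp; have [_ _ pr] := prime_J.
have [||| N] := @nullstellensatz F n.+1 (rdvd J) p.
- by split=> [x y|a x]; [exact: rdvdD | exact: rdvd_mull].
- exact: rdvd0.
- by move=> a za; apply: vp; apply: za; exists 1; rewrite mul1r.
elim: N => [|N IHN]; first by rewrite expr0 => /prime_not_unit.
by rewrite exprS => /pr [].
Qed.

Lemma J_pos_homog k : J \mPo iterate k \is (n.+1 * e.+1 * d ^ k).-homog.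
Proof. by apply: comp_homog (jac_det_homog c) _; exact: iterate_homog. Qed.

Lemma periodic_dvd k : (forall x, in_crit c x -> in_crit c (iter k (eval_map c) x)) ->
  rdvd J (J \mPo iterate k).
Proof.
move=> per; apply: vanish_dvd => x Jx; rewrite comp_iterate_eval.
(* The origin is not a point of projective space, so periodicity says nothing there; the pullback
   vanishes at it as a form of positive degree. *)
have [nzx|zx] := classic (nonzero_pt x).
  by have [] := per x (conj nzx Jx).
have x0 i : x i = 0 * x i.
  by rewrite mul0r; apply/eqP/negPn/negP => nz; apply: zx; exists i.
rewrite -comp_iterate_eval (meval_eq _ x0) (meval_homog_scale _ _ (J_pos_homog k)).
by rewrite expr0n muln_eq0 expn_eq0 mul0r.
Qed.

Section FirstReturn.
Variables (k : nat) (H : {mpoly F[n.+1]}) (N : 'M[{mpoly F[n.+1]}]_n.+1).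
Local Notation g := (iterate k).
Local Notation Dg := (diff_iterate k).
Hypothesis JgE : J \mPo g = H * J.
Hypothesis DgE : Dg = N *m M.
Hypothesis nN : ~ rdvd J (\det N).

Let B (j : 'I_n.+1) := J^`M(j) \mPo g.
Let A := \adj Dg.

Lemma return_gradient j :
  \sum_i B i * Dg i j = H^`M(j) * J + H * J^`M(j).
Proof.
rewrite -mderivM -JgE chain_rule; apply: eq_bigr => i _.
by rewrite mxE.
Qed.

(* A kernel vector of the Jacobian at a fold point is transverse to the critical
   locus, so [H] vanishes there: the locus is superattracting. *)
Lemma return_superattracting : rdvd J H.
Proof.
have [x [Jx [i nz]]] := fold; have [_ _ pr] := prime_J.
pose T := \sum_l J^`M(l) * (\adj M) l i.
have nT : ~ rdvd J T.
  case=> u uE; case/negP: nz; have := congr1 (meval x) uE.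
  rewrite mevalM Jx mulr0 raddf_sum /= => T0; apply/eqP; rewrite -[RHS]T0.
  by apply: eq_bigr => l _; rewrite mevalM /jac_at -map_mx_adj mxE.
have : rdvd J (H * T).
  (* The gradient identity is multiplied by column [i] of the adjugate of [M], using Dg adj(M) = N M
     adj(M) = J N. *)
  have -> : H * T = (\sum_a B a * N a i) * J - (\sum_l H^`M(l) * (\adj M) l i) * J.
    have -> : (\sum_a B a * N a i) * J = \sum_l (\sum_a B a * Dg a l) * (\adj M) l i.
      have MA a : N a i * J = \sum_l Dg a l * (\adj M) l i.
        have : (Dg *m \adj M) a i = (J *: N) a i by rewrite DgE -mulmxA mul_mx_adj mul_mx_scalar.
        by rewrite [RHS]mxE mxE mulrC => ->.
      rewrite mulr_suml; under eq_bigr do rewrite -mulrA MA mulr_sumr.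
      rewrite exchange_big /=; apply: eq_bigr => l _; rewrite mulr_suml.
      by apply: eq_bigr => a _; rewrite mulrA.
    rewrite mulr_sumr mulr_suml -sumrB; apply: eq_bigr => l _.
    by rewrite return_gradient; ring.
  apply: rdvdD; first by exists (\sum_a B a * N a i).
  by apply: rdvdN; exists (\sum_l H^`M(l) * (\adj M) l i).
by case/pr.
Qed.

Lemma return_proportional i j l : rdvd J (B l * A i j - B j * A i l).
Proof.
apply: vanish_dvd => x Jx.
have Hx : H.@[x] = 0.
  by have [u ->] := return_superattracting; rewrite mevalM Jx mulr0.
pose y : 'rV[F]_n.+1 := \row_a (B a).@[x].
have yD : y *m map_mx (meval x) Dg = 0.
  apply/rowP => s; rewrite !mxE; have := congr1 (meval x) (return_gradient s).
  rewrite mevalD !mevalM Jx Hx mulr0 mul0r addr0 raddf_sum /= => s0.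
  rewrite -[RHS]s0; apply: eq_bigr => a _.
  by rewrite [y 0 a]mxE [map_mx _ _ _ _]mxE mevalM.
have := adj_row_proportional yD i j l; rewrite -map_mx_adj.
rewrite ![y 0 _]mxE ![map_mx _ _ _ _]mxE => prop.
by rewrite mevalB !mevalM -/A prop subrr.
Qed.

(** Otherwise J^(n+1) would divide det(adj Dg) = (det Dg)^n = (det N)^n J^n, and the prime [J] would
    divide det N. *)
Lemma return_adj_nonzero : exists i j, ~ rdvd J (A i j).
Proof.
apply: NNPP => no; have [nzJ _ pr] := prime_J.
have dvdA (t : 'I_n.+1 * 'I_n.+1) : exists u, A t.1 t.2 = u * J.
  by apply: NNPP => nd; apply: no; exists t.1, t.2.
have [u uE] := fin_all_exists dvdA.
pose A' := \matrix_(i, j) u (i, j).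
have AE : A = J *: A'.
  by apply/matrixP => i j; rewrite [RHS]mxE [A' i j]mxE mulrC; exact: (uE (i, j)).
have nzN : \det N != 0 by apply/eqP => N0; apply: nN; rewrite N0; exact: rdvd0.
have detDg : \det Dg = \det N * J by rewrite DgE det_mulmx.
have nzD : \det Dg != 0 by rewrite detDg mulf_neq0.
have detA : \det A = (\det Dg) ^+ n.
  apply: (mulfI nzD); rewrite -det_mulmx mul_mx_adj det_scalar.
  by rewrite exprS.
have pow s : ~ rdvd J (\det N ^+ s).
  elim: s => [|s IHs]; first by rewrite expr0; exact: prime_not_unit.
  by rewrite exprS => /pr [].
apply: (pow n).
exists (\det A'); have nzJn : J ^+ n != 0 by rewrite expf_neq0.
apply: (mulIf nzJn); rewrite -exprMn -detDg -detA AE detZ exprS.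
by ring.
Qed.

Lemma no_return : (0 < k)%N -> False.
Proof.
move=> k0; have [i [j0 nA]] := return_adj_nonzero; have [nzJ _ pr] := prime_J.
have D0 : (0 < d ^ k)%N by rewrite expn_gt0.
apply: (@height_three_contradiction F r 'I_n.+1 J B (A i)
  (fun s : 'I_r => tnth g (rshift 3 s)) (n.+1 * e.+1) ((e + n * e.+1) * d ^ k)
  (n * (d ^ k).-1) (d ^ k) nzJ (jac_det_homog c)) => //.
- move=> j; apply: comp_homog; last exact: iterate_homog.
  by apply: mderiv_homog; exact: jac_det_homog.
- move=> j; apply: msize_homog; apply: adj_homog => a b; rewrite mxE.
  by apply: mderiv_homog; rewrite prednK //; exact: iterate_homog.
- rewrite mulnDl; apply: leq_trans (leq_addl _ _).
  rewrite -mulnA ltn_pmul2l //; apply: leq_trans (_ : d ^ k <= _)%N; first by rewrite prednK.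
  by rewrite leq_pmull.
- by move=> s; exact: iterate_homog.
(* At a nonzero common zero, g(x) is a nonzero point of the plane where [J] and its gradient vanish,
   contrary to smoothness. *)
- move=> x Jx Bx gx s; apply/eqP/negPn/negP => xs.
  have nzy : nonzero_pt (iter k (eval_map c) x) by apply: iter_nonzero; exists s.
  apply: (smooth nzy).
  + move=> j le_3j; have lt_j : (j - 3 < r)%N by have := ltn_ord j; lia.
    have := gx (Ordinal lt_j); rewrite iterate_eval => xj; rewrite -[RHS]xj; congr (iter _ _ _ _).
    by apply: val_inj; rewrite /= addnC subnK.
  + by rewrite -comp_iterate_eval JgE mevalM Jx mulr0.
  + by move=> l; rewrite -comp_iterate_eval; exact: Bx.
(* Modulo [J], proportionality turns A_{i j0} B_j into B_{j0} A_{ij}; the prime [J] does not divide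
   A_{i j0}, which can then be cancelled. *)
move=> P dPA; have : rdvd J (A i j0 * \sum_j P j * B j).
  have -> : A i j0 * \sum_j P j * B j =
      B j0 * (\sum_j P j * A i j) + \sum_j P j * (B j * A i j0 - B j0 * A i j).
    rewrite !mulr_sumr -big_split /=; apply: eq_bigr => j _.
    by ring.
  apply: rdvdD; first exact: rdvd_mull.
  by apply: rdvd_sum => j _; apply: rdvd_mull; exact: return_proportional.
by case/pr.
Qed.

End FirstReturn.

Lemma not_post_crit_periodic : ~ post_crit_periodic c.
Proof.
move=> [k0 [k0_gt0 per]].
have [k [k_gt0 dk mink]] : exists k, [/\ (0 < k)%N, rdvd J (J \mPo iterate k) &
    forall i, (0 < i < k)%N -> ~ rdvd J (J \mPo iterate i)].
  move: (periodic_dvd per); elim/ltn_ind: k0 k0_gt0 {per} => k IHk k_gt0 dk.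
  have [[i [/andP[i0 ik] di]]|no] := classic (exists i, (0 < i < k)%N /\ rdvd J (J \mPo iterate i)).
    exact: (IHk i).
  by exists k; split=> // i ik di; apply: no; exists i.
have [H HE] := dk.
have kE : k = k.-1.+1 by rewrite prednK.
have [N DE nN] : exists2 N, diff_iterate k = N *m M & ~ rdvd J (\det N).
  rewrite kE; apply: diff_iterate_factor => i /andP[i0 ik]; apply: mink.
  by rewrite i0 kE ltnS.
exact: (no_return HE DE nN k_gt0).
Qed.

End Dynamics.

(* The post-critically periodic maps lie in a proper Zariski closed subset of
   End_d^n: the common zero locus (inside End_d^n) of a finite family S of
   homogeneous polynomials in the coefficients, which misses some point of
   End_d^n. *)
Theorem theorem16 (F : closedFieldType) (HF : [pchar F] =i pred0)
    (n d : nat) (Hd : (3 <= d)%N) (Hn : (2 <= n)%N) :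
  exists S : seq {mpoly F[param_dim n d]},
    (forall G, G \in S -> exists e : nat, G \is e.-homog) /\
    (exists c0 : 'I_(param_dim n d) -> F,
        is_morphism c0 /\ exists2 G, G \in S & G.@[c0] != 0) /\
    (forall c : 'I_(param_dim n d) -> F,
        is_morphism c -> post_crit_periodic c ->
        forall G, G \in S -> G.@[c] = 0).
Proof.
case: n Hn => [|[|r]] // Hn; case: d Hd => [|[|e]] // _.
have [GM [nzM _] hM] := generic_morphism F r.+2 e.
have [GS [nzS [mS homS]] hS] := generic_smooth e HF Hn.
have [GF [nzF [mF homF]] hF] := generic_fold e HF Hn.
have [GC [nzC [mC homC]] hC] := generic_corank e HF Hn.
(* A single hypersurface. [GM] serves only to pick the witness: a point where the product with [GM]
   is nonzero is a morphism off the hypersurface. *)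
exists [:: GS * GF * GC]; split; [|split].
- by move=> G; rewrite inE => /eqP ->; exists (mS + mF + mC)%N; rewrite !dhomogM.
- have : GS * GF * GC * GM != 0 by rewrite !mulf_neq0.
  move=> /mpoly_nonroot [c0]; rewrite mevalM mulf_eq0 negb_or => /andP[nzG nzGM].
  exists c0; split; last by exists (GS * GF * GC); rewrite ?mem_head.
  move=> x nzx; apply: NNPP => noi; case/negP: nzGM; apply/eqP.
  have [//|t _ norm_tx] := normalize (Z := pred0) nzx.
  apply: hM norm_tx _ => i; rewrite (meval_homog_scale _ _ (poly_map_homog c0 i)).
  have -> : (poly_map c0 i).@[x] = 0; last by rewrite mulr0.
  by apply/eqP; apply/negPn/negP => nzi; apply: noi; exists i.
move=> c mor pcp G; rewrite inE => /eqP ->; apply/eqP; apply/negPn/negP.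
rewrite !mevalM !mulf_eq0 !negb_or => /andP[/andP[/eqP cS /eqP cF] /eqP cC].
have no_corank_two x w v xP wP vP xv wM Mv := cC (hC c x w v xP wP vP xv wM Mv).
have no_singular x w v xP wP vP xv wM Mv wD := cS (hS c x w v xP wP vP xv wM Mv wD).
have no_cusp x w v xP wP vP xv wM Mv wD := cF (hF c x w v xP wP vP xv wM Mv wD).
apply: (not_post_crit_periodic mor _ _ _ pcp).
- exact: jac_det_prime HF mor no_corank_two no_singular.
- exact: smooth_on_plane HF mor no_corank_two no_singular.
- exact: fold_point HF mor no_corank_two no_singular no_cusp.
Qed.
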